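(* There exist universal constants $c,c'>0$ such that the following holds. Let $A$ be the infinitesimal generator of a strongly continuous semigroup $(T(t))_{t\ge0}$ on a Banach space $X$ with $\|T(t)\|\le M$ for all $t\ge0$, where $M\ge1$. Suppose that there exists a constant $C\ge1$ such that for all real $s$ with $|s|>0$ one has $is\in\rho(A)$ and $$\|R(is,A)\|\le\frac{C}{|s|}.$$ Then $A$ generates a bounded holomorphic semigroup $T(z)$, defined at every $z\in\mathbb{C}\setminus\{0\}$ such that $|\arg(z)|\le\frac{c}{CM}$, and satisfying for these $z$ the bound $$\|T(z)\|\le c'\,CM\bigl(1+\log(CM)\bigr).$$
   Context: Banach spaces are over $\mathbb{C}$. A strongly continuous ($C_0$-) semigroup on $X$ is a family $(T(t))_{t\ge0}$ of bounded linear operators with $T(0)=I$, $T(t+s)=T(t)T(s)$ for $t,s\ge0$, and $\lim_{t\downarrow0}T(t)x=x$ for all $x\in X$. Its infinitesimal generator is $Ax=\lim_{h\downarrow0}\frac{T(h)x-x}{h}$ with domain $D(A)$ the set of $x$ for which this limit exists. $\rho(A)=\{\lambda\in\mathbb{C}:\lambda-A:D(A)\to X\text{ is bijective}\}$ is the resolvent set and $R(\lambda,A)=(\lambda-A)^{-1}$ the resolvent. For $\alpha\in[0,\pi)$, $\Sigma_\alpha=\{z\in\mathbb{C}\setminus\{0\}:|\arg z|<\alpha\}$ and $\overline{\Sigma_\alpha}=\{z:|\arg z|\le\alpha\}$ (including $0$), with argument in $(-\pi,\pi)$. A bounded holomorphic semigroup (of angle $\delta$) is a family of bounded operators $(T(z))_{z\in\Sigma_\delta\cup\{0\}}$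 with (i) $T(z_1+z_2)=T(z_1)T(z_2)$ for $z_1,z_2\in\Sigma_\delta$; (ii) $z\mapsto T(z)$ holomorphic in $\Sigma_\delta$; (iii) $T(z)x\to x$ as $z\to0$, $z\in\overline{\Sigma_{\delta'}}$, for all $x\in X$ and $0<\delta'<\delta$; (iv) $\|T(z)\|$ bounded on $\overline{\Sigma_{\delta'}}$ for every $0<\delta'<\delta$. That $A$ generates the bounded holomorphic semigroup $T(z)$ means that $T(z)$ extends the given semigroup $(T(t))_{t\ge0}$ generated by $A$. *)

(* Defs.v *)
From Stdlib Require Import Reals.
From Coquelicot Require Import Coquelicot.

Open Scope R_scope.

(* [is_linear] is Coquelicot's notion of a *bounded* linear map. *)

(* A partially defined operator; the values of [op_val] outside [op_dom] are
   irrelevant. *)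
Record operator (X : CompleteNormedModule C_AbsRing) : Type := Operator {
  op_dom : X -> Prop;
  op_val : X -> X
}.

Arguments op_dom {X}.
Arguments op_val {X}.

Section Operators.

Context {X : CompleteNormedModule C_AbsRing}.

(* Takes the value [p_infty] on an unbounded map. *)
Definition opnorm (B : X -> X) : Rbar :=
  Lub_Rbar (fun r : R => exists x : X, norm x <= 1 /\ r = norm (B x)).

(* Only the values of [T] at nonnegative times are meaningful. *)
Record C0_semigroup (T : R -> X -> X) : Prop := {
  C0_bounded : forall t : R, 0 <= t -> is_linear (T t);
  C0_zero : forall x : X, T 0 x = x;
  C0_add : forall (t s : R) (x : X),
    0 <= t -> 0 <= s -> T (t + s) x = T t (T s x);
  C0_continuous : forall x : X,
    filterlim (fun t : R => T t x) (at_right 0) (locally x)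
}.

Definition is_generator_value (T : R -> X -> X) (x y : X) : Prop :=
  filterlim (fun h : R => scal (RtoC (/ h)) (minus (T h x) x))
    (at_right 0) (locally y).

(* [iota P] is the unique element satisfying [P] when there is one. *)
Definition generator (T : R -> X -> X) : operator X := {|
  op_dom := fun x => exists y : X, is_generator_value T x y;
  op_val := fun x => iota (is_generator_value T x)
|}.

Definition in_resolvent_set (A : operator X) (l : C) : Prop :=
  forall y : X, exists! x : X,
    op_dom A x /\ minus (scal l x) (op_val A x) = y.

Definition resolvent (l : C) (A : operator X) (y : X) : X :=
  iota (fun x : X => op_dom A x /\ minus (scal l x) (op_val A x) = y).

(* Differentiability of [S] at [z] for the operator norm. *)
Definition holomorphic_at (S : C -> X -> X) (z : C) : Prop :=
  exists L : X -> X, is_linear L /\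
    forall eps : posreal,
      locally' (RtoC 0) (fun h : C =>
        Rbar_lt
          (opnorm (fun x : X =>
             minus (scal (/ h)%C (minus (S (z + h)%C x) (S z x))) (L x)))
          eps).

End Operators.

Definition is_arg (z : C) (theta : R) : Prop :=
  - PI < theta < PI /\ z = (Cmod z * cos theta, Cmod z * sin theta).

Definition sector (alpha : R) (z : C) : Prop :=
  z <> RtoC 0 /\ exists theta : R, is_arg z theta /\ Rabs theta < alpha.

(* [is_arg] is vacuous on [0], so this contains the vertex for [alpha >= 0]. *)
Definition closed_sector (alpha : R) (z : C) : Prop :=
  exists theta : R, is_arg z theta /\ Rabs theta <= alpha.

(* The angle is at most [PI / 2], so that the sector is stable under addition.
   Only the values of [S] on the sector and at [0] are meaningful. *)
Record bounded_holomorphic_semigroup {X : CompleteNormedModule C_AbsRing}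
    (delta : R) (S : C -> X -> X) : Prop := {
  bhs_angle : 0 < delta <= PI / 2;
  bhs_bounded : forall z : C,
    sector delta z \/ z = RtoC 0 -> is_linear (S z);
  bhs_add : forall (z1 z2 : C) (x : X),
    sector delta z1 -> sector delta z2 -> S (z1 + z2)%C x = S z1 (S z2 x);
  bhs_holomorphic : forall z : C, sector delta z -> holomorphic_at S z;
  bhs_continuous : forall (delta' : R) (x : X), 0 < delta' < delta ->
    filterlim (fun z : C => S z x)
      (within (closed_sector delta') (locally (RtoC 0))) (locally x);
  bhs_norm_bounded : forall delta' : R, 0 < delta' < delta ->
    exists K : R, forall z : C,
      closed_sector delta' z -> Rbar_le (opnorm (S z)) K
}.

Definition extends_semigroup {X : CompleteNormedModule C_AbsRing}
    (T : R -> X -> X) (S : C -> X -> X) : Prop :=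
  forall (t : R) (x : X), 0 <= t -> S (RtoC t) x = T t x.

(* Main.v *)
Require Import Defs.
From Stdlib Require Import Reals Lra Lia List Factorial ClassicalEpsilon.
From Coquelicot Require Import Coquelicot.
Open Scope R_scope.

(** The semigroup is approximated by exponentials of bounded operators that are
    bounded, uniformly, on a sector of half-angle comparable with [1 / K]; their
    strong limit is the holomorphic extension. No contour integral occurs: the
    role of Cauchy's formula is played by finite sums over roots of unity.

    In the equivalent norm [orbit_norm], the supremum of the norm over the
    orbit, the semigroup is contractive and the resolvent bound on the imaginary
    axis persists. Dissipativity controls the resolvent of the generator [A]
    where [Re l] dominates, and the bound on the axis, by perturbation, where
    [Im l] dominates; hence [|l| |(l - A)^-1| <= 3 K] in the whole right
    half-plane ([gen_sectorial]). For the contraction [V = mu (mu - A)^-1] this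
    is the Ritt condition [|(1 - z V)^-1| <= 5 K / |1 - z|] on the unit disc
    ([yosida_Ritt]), with a constant that does not depend on [mu].

    The main estimate, [Ritt_power_estimate], states that a contraction [U] with
    the Ritt condition of constant [K] satisfies
      [|(U - 1)^n U^k| <= 96 K (n + 1)! (4 K / (k + 1))^n] if [K <= k + 1].
    The operator [U^k] is a coefficient of the power series of
    [(1 - z U)^-(n + 2)], and is isolated by averaging over the circle of radius
    [1 - 1 / (2 (k + 1))]. On this circle [(U - 1)^n (1 - z U)^-(n + 2)] is
    bounded by [(4 K)^n] times the square of a resolvent bound, and that square
    is dominated by a Poisson kernel whose average is known. What matters is
    that the constant in front is linear in [K] and that the rate in [n] is
    exactly a power of [K].

    The Euler steps of the Yosida approximation [B = mu (V - 1)] are convex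
    combinations of [1] and [V], which inherit the Ritt condition. Passing to
    the limit gives [|B^n exp (t B)| <= 96 K (n + 1)! (4 K / t)^n] with [5 K] in
    place of [K], uniformly in [mu] ([exp_gen_power]), and the Taylor series in
    the imaginary direction bounds [exp (z B)] by a multiple of [K] on a sector
    ([exp_gen_cone]). Going back to the given norm costs a factor [M], whence a
    bound of order [K M].

    Convergence as [mu] tends to infinity, the identification with the given
    semigroup on the half-line, continuity at the vertex and differentiability
    all follow from comparing two products of many small steps term by term
    ([telescope], [expm_compare], [expm_increment2]). *)

(** * Linear identities in a module over the complex numbers *)

(* The structures are fixed in these notations: those that unification infers
   depend on the operands, and would give several forms to one expression. *)
Local Notation "x ⊕ y" := (@plus (CompleteNormedModule.AbelianMonoid C_AbsRing _) x y)
  (at level 50, left associativity).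
Local Notation "x ⊖ y" := (@minus (CompleteNormedModule.AbelianGroup C_AbsRing _) x y)
  (at level 50, left associativity).
Local Notation "a ⊙ x" :=
  (@scal _ (CompleteNormedModule.ModuleSpace C_AbsRing _) (a : C) x)
  (at level 35, right associativity).
Local Notation vzero := (@zero (CompleteNormedModule.AbelianMonoid C_AbsRing _)).
Local Notation vopp := (@opp (CompleteNormedModule.AbelianGroup C_AbsRing _)).

Section LinearIdentities.

Context {X : CompleteNormedModule C_AbsRing}.
Implicit Types (l : list X) (f g : nat -> C).

Lemma scal0 (x : X) : RtoC 0 ⊙ x = vzero.
Proof. exact (scal_zero_l x). Qed.

Lemma scal1 (x : X) : RtoC 1 ⊙ x = x.
Proof. exact (scal_one x). Qed.

Lemma scalA (a b : C) (x : X) : a ⊙ b ⊙ x = (a * b)%C ⊙ x.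
Proof. exact (scal_assoc a b x). Qed.

Lemma scalDl (a b : C) (x : X) : (a + b)%C ⊙ x = a ⊙ x ⊕ b ⊙ x.
Proof. exact (scal_distr_r a b x). Qed.

Lemma scalDr (a : C) (x y : X) : a ⊙ (x ⊕ y) = a ⊙ x ⊕ a ⊙ y.
Proof. exact (scal_distr_l a x y). Qed.

(** Syntax for linear combinations of atoms, on which the tactic [vec] below
    computes: an identity holds as soon as each atom has the same coefficient
    on both sides. *)
Inductive vexp : Type :=
| VAtom (n : nat)
| VZero
| VPlus (e1 e2 : vexp)
| VMinus (e1 e2 : vexp)
| VOpp (e : vexp)
| VScal (a : C) (e : vexp).

Fixpoint veval l (e : vexp) : X :=
  match e with
  | VAtom n => nth n l vzero
  | VZero => vzero
  | VPlus e1 e2 => veval l e1 ⊕ veval l e2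
  | VMinus e1 e2 => veval l e1 ⊖ veval l e2
  | VOpp e => vopp (veval l e)
  | VScal a e => a ⊙ veval l e
  end.

Fixpoint vcoef (e : vexp) (k : nat) : C :=
  match e with
  | VAtom n => if Nat.eqb k n then RtoC 1 else RtoC 0
  | VZero => RtoC 0
  | VPlus e1 e2 => (vcoef e1 k + vcoef e2 k)%C
  | VMinus e1 e2 => (vcoef e1 k - vcoef e2 k)%C
  | VOpp e => (- vcoef e k)%C
  | VScal a e => (a * vcoef e k)%C
  end.

Fixpoint vlin l f : X :=
  match l with
  | nil => vzero
  | x :: l' => f O ⊙ x ⊕ vlin l' (fun k => f (S k))
  end.

Fixpoint vcoefs_eq l f g : Prop :=
  match l with
  | nil => True
  | _ :: l' => f O = g O /\ vcoefs_eq l' (fun k => f (S k)) (fun k => g (S k))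
  end.

Lemma vlin_ext l f g : vcoefs_eq l f g -> vlin l f = vlin l g.
Proof.
  revert f g; induction l as [|x l IH]; intros f g; simpl; [easy|].
  intros [-> H]; now rewrite (IH _ _ H).
Qed.

Lemma vlin_zero l : vlin l (fun _ => RtoC 0) = vzero.
Proof.
  induction l as [|x l IH]; simpl; [easy|].
  now rewrite IH, plus_zero_r, scal0.
Qed.

Lemma vlin_plus l f g : vlin l f ⊕ vlin l g = vlin l (fun k => (f k + g k)%C).
Proof.
  revert f g; induction l as [|x l IH]; intros f g; simpl.
  - apply plus_zero_l.
  - rewrite <- IH, scalDl.
    rewrite <- !plus_assoc; f_equal.
    now rewrite !plus_assoc, (plus_comm (vlin l _)).
Qed.

Lemma vlin_scal l a f : a ⊙ vlin l f = vlin l (fun k => (a * f k)%C).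
Proof.
  revert f; induction l as [|x l IH]; intros f; simpl.
  - exact (scal_zero_r a).
  - now rewrite scalDr, IH, scalA.
Qed.

Lemma vlin_ext_all l f g : (forall k, f k = g k) -> vlin l f = vlin l g.
Proof.
  intros H; apply vlin_ext.
  revert f g H; induction l; simpl; intros; [easy|]; split; auto.
Qed.

Lemma vlin_opp l f : vopp (vlin l f) = vlin l (fun k => (- f k)%C).
Proof.
  transitivity ((- (1))%C ⊙ vlin l f); [symmetry; exact (scal_opp_one _)|].
  rewrite vlin_scal; apply vlin_ext_all; intros k; ring.
Qed.

Lemma vlin_atom l n :
  vlin l (fun k => if Nat.eqb k n then RtoC 1 else RtoC 0) = nth n l vzero.
Proof.
  revert n; induction l as [|x l IH]; intros [|n]; simpl; try easy.
  - rewrite vlin_zero, plus_zero_r; apply scal1.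
  - rewrite IH, scal0; apply plus_zero_l.
Qed.

Lemma veval_vlin l e : veval l e = vlin l (vcoef e).
Proof.
  induction e as [n| |e1 IH1 e2 IH2|e1 IH1 e2 IH2|e IH|a e IH]; simpl.
  - symmetry; apply vlin_atom.
  - symmetry; apply vlin_zero.
  - now rewrite IH1, IH2, vlin_plus.
  - unfold minus; now rewrite IH1, IH2, vlin_opp, vlin_plus.
  - now rewrite IH, vlin_opp.
  - now rewrite IH, vlin_scal.
Qed.

Lemma vec_correct l e1 e2 :
  vcoefs_eq l (vcoef e1) (vcoef e2) -> veval l e1 = veval l e2.
Proof. intros H; rewrite !veval_vlin; now apply vlin_ext. Qed.

End LinearIdentities.

Ltac vec_index x l :=
  match l with
  | cons ?y ?l' =>
    match constr:(x) with
    | y => constr:(O)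
    | _ => let n := vec_index x l' in constr:(S n)
    end
  end.

Ltac vec_mem x l :=
  match l with
  | nil => constr:(false)
  | cons ?y ?l' =>
    match constr:(x) with
    | y => constr:(true)
    | _ => vec_mem x l'
    end
  end.

Ltac vec_atoms e l :=
  match e with
  | plus ?a ?b => let l := vec_atoms a l in vec_atoms b l
  | minus ?a ?b => let l := vec_atoms a l in vec_atoms b l
  | opp ?a => vec_atoms a l
  | scal _ ?a => vec_atoms a l
  | @zero _ => l
  | _ => match vec_mem e l with
         | true => l
         | false => constr:(cons e l)
         end
  end.

Ltac vec_reify e l :=
  match e with
  | plus ?a ?b =>
    let a := vec_reify a l in let b := vec_reify b l in constr:(VPlus a b)
  | minus ?a ?b =>
    let a := vec_reify a l in let b := vec_reify b l in constr:(VMinus a b)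
  | opp ?a => let a := vec_reify a l in constr:(VOpp a)
  | scal ?c ?a => let a := vec_reify a l in constr:(VScal c a)
  | @zero _ => constr:(VZero)
  | _ => let n := vec_index e l in constr:(VAtom n)
  end.

(** Reduces an equality of linear combinations to the equalities of the
    coefficients of its atoms, which are left as goals over the complex
    numbers. *)
Ltac vec_goals :=
  match goal with
  | |- @eq ?T ?a ?b =>
    let l := vec_atoms a (@nil T) in
    let l := vec_atoms b l in
    let e1 := vec_reify a l in
    let e2 := vec_reify b l in
    change (veval l e1 = veval l e2);
    apply vec_correct;
    cbn [vcoefs_eq vcoef Nat.eqb];
    repeat split
  end.

Ltac vec := vec_goals; ring.

(** * Scalar limits *)

Lemma le_of_vanishing_error (x y c : R) :
  (exists n0, forall n, (n0 <= n)%nat -> x <= y + c / (INR n + 1)) -> x <= y.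
Proof.
  intros [n0 H].
  apply le_epsilon; intros eps Heps.
  destruct (INR_unbounded (Rabs c / eps)) as [n Hn].
  specialize (H (max n0 n) ltac:(lia)).
  assert (Hmax : INR n <= INR (max n0 n)) by (apply le_INR; lia).
  assert (Hc : Rabs c < INR n * eps).
  { apply (Rmult_lt_compat_r eps) in Hn; [|easy].
    replace (Rabs c / eps * eps) with (Rabs c) in Hn by (field; lra); lra. }
  assert (Hpos : 0 < INR (max n0 n) + 1) by (pose proof (pos_INR (max n0 n)); lra).
  enough (c / (INR (max n0 n) + 1) <= eps) by lra.
  apply Rle_div_l; [easy|].
  pose proof (Rle_abs c); nra.
Qed.

Lemma pow_vanishes (q c eps : R) :
  0 <= q < 1 -> 0 < eps ->
  exists n0, forall n, (n0 <= n)%nat -> c * q ^ n <= eps.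
Proof.
  intros Hq Heps.
  destruct (pow_lt_1_zero q) with (y := eps / (Rabs c + 1)) as [n0 Hn0].
  { rewrite Rabs_pos_eq; lra. }
  { apply Rdiv_lt_0_compat; [easy|]; pose proof (Rabs_pos c); lra. }
  exists n0; intros n Hn; specialize (Hn0 n Hn).
  assert (0 <= q ^ n) by (apply pow_le; lra).
  rewrite Rabs_pos_eq in Hn0 by easy.
  assert (0 < Rabs c + 1) by (pose proof (Rabs_pos c); lra).
  apply Rlt_div_r in Hn0; [|easy].
  pose proof (Rle_abs c); nra.
Qed.

(** * Equivalent norms *)

Section EquivalentNorm.

Context {X : CompleteNormedModule C_AbsRing}.

Implicit Types (x y z l : X) (u v : nat -> X) (B P Q : X -> X).

(** Estimates are made in an equivalent norm, chosen later so that the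
    semigroup is contractive. *)
Record equivalent_norm (N : X -> R) (M : R) : Prop := {
  en_plus : forall x y : X, N (x ⊕ y) <= N x + N y;
  en_scal : forall (a : C) (x : X), N (a ⊙ x) <= Cmod a * N x;
  en_lower : forall x : X, norm x <= N x;
  en_upper : forall x : X, N x <= M * norm x
}.

Record linear_map (B : X -> X) : Prop := {
  lin_plus : forall x y : X, B (x ⊕ y) = B x ⊕ B y;
  lin_scal : forall (a : C) (x : X), B (a ⊙ x) = a ⊙ B x
}.

Lemma lin_minus B : linear_map B -> forall x y : X, B (x ⊖ y) = B x ⊖ B y.
Proof.
  intros HB x y.
  replace (x ⊖ y) with (x ⊕ (-1)%C ⊙ y) by vec.
  rewrite (lin_plus _ HB), (lin_scal _ HB); vec.
Qed.

Lemma lin_zero B : linear_map B -> B vzero = vzero.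
Proof.
  intros HB; replace (vzero : X) with (RtoC 0 ⊙ (vzero : X)) at 1 by vec.
  rewrite (lin_scal _ HB); vec.
Qed.

Lemma linear_id : linear_map (fun x => x).
Proof. now split. Qed.

Lemma linear_comp B1 B2 :
  linear_map B1 -> linear_map B2 -> linear_map (fun x => B1 (B2 x)).
Proof.
  intros H1 H2; split; intros.
  - now rewrite (lin_plus _ H2), (lin_plus _ H1).
  - now rewrite (lin_scal _ H2), (lin_scal _ H1).
Qed.

Lemma linear_comb (a b : C) B1 B2 :
  linear_map B1 -> linear_map B2 -> linear_map (fun x => a ⊙ B1 x ⊕ b ⊙ B2 x).
Proof.
  intros H1 H2; split; intros.
  - rewrite (lin_plus _ H2), (lin_plus _ H1); vec.
  - rewrite (lin_scal _ H2), (lin_scal _ H1); vec.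
Qed.

Lemma linear_iter n B : linear_map B -> linear_map (Nat.iter n B).
Proof.
  intros HB; induction n as [|n IH]; simpl.
  - apply linear_id.
  - now apply (linear_comp B (Nat.iter n B)).
Qed.

Lemma iter_comm (P Q : X -> X) n :
  (forall x, P (Q x) = Q (P x)) ->
  forall x, Nat.iter n P (Q x) = Q (Nat.iter n P x).
Proof.
  intros H; induction n as [|n IH]; intros x; simpl; [easy|].
  now rewrite IH, H.
Qed.

Lemma iter_comm_iter (P Q : X -> X) n m :
  (forall x, P (Q x) = Q (P x)) ->
  forall x, Nat.iter n P (Nat.iter m Q x) = Nat.iter m Q (Nat.iter n P x).
Proof.
  intros H; apply iter_comm; intros x.
  symmetry; apply iter_comm; intros y; now rewrite H.
Qed.

Lemma iter_ext (P Q : X -> X) n :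
  (forall x, P x = Q x) -> forall x, Nat.iter n P x = Nat.iter n Q x.
Proof.
  intros H x; induction n as [|n IH]; simpl; [easy|]; now rewrite IH, H.
Qed.

Definition bounded_by (N : X -> R) (B : X -> X) (b : R) : Prop :=
  forall x : X, N (B x) <= b * N x.

Definition tends (N : X -> R) (u : nat -> X) (l : X) : Prop :=
  forall eps, 0 < eps ->
  exists n0, forall n, (n0 <= n)%nat -> N (u n ⊖ l) <= eps.

Definition vlim (N : X -> R) (u : nat -> X) : X := iota (tends N u).

Definition dense (N : X -> R) (D : X -> Prop) : Prop :=
  forall x eps, 0 < eps -> exists y, D y /\ N (x ⊖ y) <= eps.

Context {N : X -> R} {M : R} (HN : equivalent_norm N M).

Lemma N_ge0 x : 0 <= N x.
Proof. eapply Rle_trans; [apply (norm_ge_0 x)|apply (en_lower _ _ HN)]. Qed.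

Lemma N_zero : N vzero = 0.
Proof.
  apply Rle_antisym; [|apply N_ge0].
  pose proof (en_scal _ _ HN 0 vzero) as H.
  rewrite scal0, Cmod_0 in H; lra.
Qed.

Lemma N_scal a x : N (a ⊙ x) = Cmod a * N x.
Proof.
  apply Rle_antisym; [apply (en_scal _ _ HN)|].
  destruct (Ceq_dec a 0) as [->|Ha].
  - rewrite Cmod_0, scal0, N_zero; lra.
  - pose proof (en_scal _ _ HN (/ a)%C (a ⊙ x)) as H.
    rewrite scalA, Cinv_l, scal1, Cmod_inv in H by easy.
    apply Cmod_gt_0 in Ha.
    apply (Rmult_le_compat_l (Cmod a)) in H; [|lra].
    rewrite <- Rmult_assoc, Rinv_r in H by lra; lra.
Qed.

Lemma N_opp x : N (vopp x) = N x.
Proof.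
  replace (vopp x) with ((-1)%C ⊙ x) by vec.
  rewrite N_scal, Cmod_R, Rabs_left by lra; lra.
Qed.

Lemma N_minus_sym x y : N (x ⊖ y) = N (y ⊖ x).
Proof. rewrite <- N_opp; f_equal; vec. Qed.

Lemma N_minus x y : N (x ⊖ y) <= N x + N y.
Proof. rewrite <- (N_opp y); apply (en_plus _ _ HN). Qed.

Lemma N_chain y x z : N (x ⊖ z) <= N (x ⊖ y) + N (y ⊖ z).
Proof.
  replace (x ⊖ z) with ((x ⊖ y) ⊕ (y ⊖ z)) by vec.
  apply (en_plus _ _ HN).
Qed.

Lemma N_le_minus x y : N x <= N y + N (x ⊖ y).
Proof.
  replace x with (y ⊕ (x ⊖ y)) at 1 by vec; apply (en_plus _ _ HN).
Qed.

Lemma N_eq0 x : N x <= 0 -> x = vzero.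
Proof.
  intros H; refine (norm_eq_zero x (Rle_antisym _ _ _ (norm_ge_0 x))).
  pose proof (en_lower _ _ HN x); lra.
Qed.

Lemma N_separates x y : (forall eps, 0 < eps -> N (x ⊖ y) <= eps) -> x = y.
Proof.
  intros H; replace x with (y ⊕ (x ⊖ y)) by vec.
  replace (x ⊖ y) with (vzero : X); [apply plus_zero_r|].
  symmetry; apply N_eq0, le_epsilon; intros; rewrite Rplus_0_l; auto.
Qed.

Lemma bounded_by_iter B b n :
  0 <= b -> bounded_by N B b -> bounded_by N (Nat.iter n B) (b ^ n).
Proof.
  intros Hb HB x; induction n as [|n IH]; simpl; [lra|].
  eapply Rle_trans; [apply HB|]; nra.
Qed.

Lemma contraction_iter B n : bounded_by N B 1 -> bounded_by N (Nat.iter n B) 1.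
Proof. intros HB; rewrite <- (pow1 n); apply bounded_by_iter; [lra|easy]. Qed.

(** * Limits of sequences of vectors *)

Lemma tends_unique u l1 l2 : tends N u l1 -> tends N u l2 -> l1 = l2.
Proof.
  intros H1 H2; apply N_separates; intros eps Heps.
  destruct (H1 (eps / 2)) as [n1 H1']; [lra|].
  destruct (H2 (eps / 2)) as [n2 H2']; [lra|].
  specialize (H1' (max n1 n2) ltac:(lia)); specialize (H2' (max n1 n2) ltac:(lia)).
  pose proof (N_chain (u (max n1 n2)) l1 l2).
  rewrite N_minus_sym in H1'; lra.
Qed.

Lemma tends_ext u v l : (forall n, u n = v n) -> tends N u l -> tends N v l.
Proof.
  intros E H eps Heps; destruct (H eps Heps) as [n0 Hn0].
  exists n0; intros; rewrite <- E; auto.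
Qed.

Lemma tends_const x : tends N (fun _ => x) x.
Proof.
  intros eps Heps; exists O; intros _ _.
  replace (x ⊖ x) with (vzero : X) by vec; rewrite N_zero; lra.
Qed.

Lemma tends_plus u v l m :
  tends N u l -> tends N v m -> tends N (fun n => u n ⊕ v n) (l ⊕ m).
Proof.
  intros H1 H2 eps Heps.
  destruct (H1 (eps / 2)) as [n1 H1']; [lra|].
  destruct (H2 (eps / 2)) as [n2 H2']; [lra|].
  exists (max n1 n2); intros n Hn.
  specialize (H1' n ltac:(lia)); specialize (H2' n ltac:(lia)).
  replace (u n ⊕ v n ⊖ (l ⊕ m)) with ((u n ⊖ l) ⊕ (v n ⊖ m)) by vec.
  eapply Rle_trans; [apply (en_plus _ _ HN)|]; lra.
Qed.

(** Convergence of the maps at the single point [l] suffices, because a uniform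
    bound makes them equicontinuous. *)
Lemma tends_map (B : nat -> X -> X) b u l m :
  (forall n, linear_map (B n)) -> (forall n, bounded_by N (B n) b) ->
  tends N u l -> tends N (fun n => B n l) m -> tends N (fun n => B n (u n)) m.
Proof.
  intros HB Hb Hu Hm eps Heps.
  assert (Hb1 : 0 < Rabs b + 1) by (pose proof (Rabs_pos b); lra).
  destruct (Hu (eps / 2 / (Rabs b + 1))) as [n1 H1]; [now apply Rdiv_lt_0_compat; [lra|]|].
  destruct (Hm (eps / 2)) as [n2 H2]; [lra|].
  exists (max n1 n2); intros n Hn.
  specialize (H1 n ltac:(lia)); specialize (H2 n ltac:(lia)).
  eapply Rle_trans; [apply (N_chain (B n l))|].
  rewrite <- (lin_minus _ (HB n)).
  pose proof (Hb n (u n ⊖ l)) as H3.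
  apply Rle_div_r in H1; [|easy].
  pose proof (Rle_abs b); pose proof (N_ge0 (u n ⊖ l)); nra.
Qed.

Lemma tends_linear B b u l :
  linear_map B -> bounded_by N B b -> tends N u l -> tends N (fun n => B (u n)) (B l).
Proof.
  intros HB Hb Hu.
  apply (tends_map (fun _ => B) b u l); auto; apply tends_const.
Qed.

Lemma tends_scal (a : C) u l : tends N u l -> tends N (fun n => a ⊙ u n) (a ⊙ l).
Proof.
  apply (tends_linear (fun x => a ⊙ x) (Cmod a)).
  - split; intros; vec.
  - intros x; rewrite N_scal; lra.
Qed.

Lemma tends_minus u v l m :
  tends N u l -> tends N v m -> tends N (fun n => u n ⊖ v n) (l ⊖ m).
Proof.
  intros H1 H2.
  replace (l ⊖ m) with (l ⊕ (-1)%C ⊙ m) by vec.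
  apply (tends_ext (fun n => u n ⊕ (-1)%C ⊙ v n)); [intros; vec|].
  now apply tends_plus; [|apply tends_scal].
Qed.

Lemma tends_bound u l c :
  tends N u l -> (exists n0, forall n, (n0 <= n)%nat -> N (u n) <= c) -> N l <= c.
Proof.
  intros H [n0 Hc]; apply le_epsilon; intros eps Heps.
  destruct (H eps Heps) as [n1 H1].
  specialize (H1 (max n0 n1) ltac:(lia)); specialize (Hc (max n0 n1) ltac:(lia)).
  pose proof (N_le_minus l (u (max n0 n1))).
  rewrite N_minus_sym in H1; lra.
Qed.

Lemma tends_squeeze u l (c : R) :
  (exists n0, forall n, (n0 <= n)%nat -> N (u n ⊖ l) <= c / (INR n + 1)) -> tends N u l.
Proof.
  intros [n0 H] eps Heps.
  destruct (INR_unbounded (Rabs c / eps)) as [n1 Hn1].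
  exists (max n0 n1); intros n Hn.
  assert (Hm : INR n1 <= INR n) by (apply le_INR; lia).
  eapply Rle_trans; [apply H; lia|].
  apply Rlt_div_l in Hn1; [|easy].
  apply Rle_div_l; [pose proof (pos_INR n); lra|].
  pose proof (Rle_abs c); nra.
Qed.

Lemma tends_cauchy u :
  (forall eps, 0 < eps ->
     exists n0, forall n m, (n0 <= n)%nat -> (n0 <= m)%nat -> N (u n ⊖ u m) <= eps) ->
  exists l, tends N u l.
Proof.
  intros H.
  set (F := filtermap u eventually).
  assert (FF : ProperFilter F)
    by (apply filtermap_proper_filter, eventually_filter).
  assert (HC : cauchy F).
  { intros eps; destruct (H (eps / 2)) as [n0 H0].
    { pose proof (cond_pos eps); lra. }
    exists (u n0), n0; intros n Hn.
    apply (norm_compat1 (V:=CompleteNormedModule.NormedModule _ X)).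
    eapply Rle_lt_trans; [apply (en_lower _ _ HN)|].
    eapply Rle_lt_trans; [apply H0; lia|].
    pose proof (cond_pos eps); lra. }
  exists (lim F); intros eps Heps.
  pose proof (@norm_factor_gt_0 _ X) as Hnf.
  assert (HM : 0 < Rabs M + 1) by (pose proof (Rabs_pos M); lra).
  assert (Heps' : 0 < eps / (Rabs M + 1) / @norm_factor _ X).
  { apply Rdiv_lt_0_compat; [now apply Rdiv_lt_0_compat|easy]. }
  destruct (complete_cauchy F FF HC (mkposreal _ Heps')) as [n0 H0].
  exists n0; intros n Hn.
  apply H0, (norm_compat2 (V:=CompleteNormedModule.NormedModule _ X)) in Hn;
    simpl in Hn.
  replace (@norm_factor _ X * (eps / (Rabs M + 1) / @norm_factor _ X))
    with (eps / (Rabs M + 1)) in Hn by (field; lra).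
  apply Rlt_div_r in Hn; [|easy].
  eapply Rle_trans; [apply (en_upper _ _ HN)|].
  pose proof (Rle_abs M); pose proof (norm_ge_0 (u n ⊖ lim F)).
  set (t := norm _) in *; change (norm _) with t in Hn; nra.
Qed.

Lemma tends_geometric u c q :
  0 <= q < 1 -> (forall n, N (u (S n) ⊖ u n) <= c * q ^ n) ->
  exists l, tends N u l /\ N (l ⊖ u O) <= c / (1 - q).
Proof.
  intros Hq H.
  assert (Hc : 0 <= c).
  { specialize (H O); simpl in H; pose proof (N_ge0 (u 1%nat ⊖ u O)); lra. }
  assert (Hd : forall n k, N (u (n + k)%nat ⊖ u n) <= c / (1 - q) * q ^ n * (1 - q ^ k)).
  { intros n k; induction k as [|k IH].
    - rewrite Nat.add_0_r; replace (u n ⊖ u n) with (vzero : X) by vec.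
      rewrite N_zero; simpl; lra.
    - eapply Rle_trans; [apply (N_chain (u (n + k)%nat))|].
      rewrite Nat.add_succ_r; specialize (H (n + k)%nat).
      rewrite pow_add in H.
      replace (c / (1 - q) * q ^ n * (1 - q ^ S k))
        with (c * (q ^ n * q ^ k) + c / (1 - q) * q ^ n * (1 - q ^ k))
        by (simpl; field; lra); lra. }
  assert (Hd' : forall n k, N (u (n + k)%nat ⊖ u n) <= c / (1 - q) * q ^ n).
  { intros n k; eapply Rle_trans; [apply Hd|].
    assert (0 <= q ^ k) by (apply pow_le; lra).
    assert (0 <= c / (1 - q) * q ^ n).
    { apply Rmult_le_pos; [apply Rdiv_le_0_compat; lra|apply pow_le; lra]. }
    nra. }
  destruct (tends_cauchy u) as [l Hl].
  { intros eps Heps.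
    destruct (pow_vanishes q (c / (1 - q)) (eps / 2)) as [n0 H0]; [easy|lra|].
    specialize (H0 n0 (le_n _)).
    exists n0; intros n m Hn Hm.
    eapply Rle_trans; [apply (N_chain (u n0))|].
    pose proof (Hd' n0 (n - n0)%nat) as H1; pose proof (Hd' n0 (m - n0)%nat) as H2.
    replace (n0 + (n - n0))%nat with n in H1 by lia.
    replace (n0 + (m - n0))%nat with m in H2 by lia.
    rewrite (N_minus_sym (u n0)); lra. }
  exists l; split; [easy|].
  apply (tends_bound (fun n => u n ⊖ u O)).
  - apply tends_minus; [easy|apply tends_const].
  - exists O; intros n _; specialize (Hd' O n); simpl in Hd'; lra.
Qed.

Lemma vlim_tends u : (exists l, tends N u l) -> tends N u (vlim N u).
Proof.
  intros [l Hl]; apply (iota_correct (tends N u)).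
  exists l; split; [easy|]; intros; now apply (tends_unique u).
Qed.

Lemma vlim_eq u l : tends N u l -> vlim N u = l.
Proof. intros H; apply (tends_unique u); [apply vlim_tends; eauto|easy]. Qed.

(** * Strong limits of uniformly bounded operators *)

Lemma tends_on_dense (B : nat -> X -> X) b D :
  (forall n, linear_map (B n)) -> (forall n, bounded_by N (B n) b) -> dense N D ->
  (forall x, D x -> exists l, tends N (fun n => B n x) l) ->
  forall x, exists l, tends N (fun n => B n x) l.
Proof.
  intros HB Hb HD H x; apply tends_cauchy; intros eps Heps.
  assert (Hb1 : 0 < Rabs b + 1) by (pose proof (Rabs_pos b); lra).
  destruct (HD x (eps / 4 / (Rabs b + 1))) as [y [Hy Hxy]].
  { now apply Rdiv_lt_0_compat; [lra|]. }
  destruct (H y Hy) as [l Hl].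
  destruct (Hl (eps / 4)) as [n0 H0]; [lra|].
  apply Rle_div_r in Hxy; [|easy].
  assert (Hn : forall n, N (B n x ⊖ B n y) <= eps / 4).
  { intros n; rewrite <- (lin_minus _ (HB n)).
    pose proof (Hb n (x ⊖ y)); pose proof (Rle_abs b).
    pose proof (N_ge0 (x ⊖ y)); nra. }
  exists n0; intros n m Hn0 Hm0.
  eapply Rle_trans; [apply (N_chain (B n y))|].
  pose proof (N_chain l (B n y) (B m x)).
  pose proof (N_chain (B m y) l (B m x)).
  pose proof (Hn n); pose proof (Hn m); pose proof (H0 n Hn0); pose proof (H0 m Hm0).
  pose proof (N_minus_sym l (B m y)); pose proof (N_minus_sym (B m y) (B m x)); lra.
Qed.

Lemma linear_limit (B : nat -> X -> X) L :
  (forall n, linear_map (B n)) -> (forall x, tends N (fun n => B n x) (L x)) -> linear_map L.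
Proof.
  intros HB HL; split.
  - intros x y; apply (tends_unique (fun n => B n (x ⊕ y))); [easy|].
    apply (tends_ext (fun n => B n x ⊕ B n y)); [|now apply tends_plus].
    intros n; now rewrite (lin_plus _ (HB n)).
  - intros a x; apply (tends_unique (fun n => B n (a ⊙ x))); [easy|].
    apply (tends_ext (fun n => a ⊙ B n x)); [|now apply tends_scal].
    intros n; now rewrite (lin_scal _ (HB n)).
Qed.

Lemma bounded_by_limit (B : nat -> X -> X) L b :
  (forall n, bounded_by N (B n) b) -> (forall x, tends N (fun n => B n x) (L x)) ->
  bounded_by N L b.
Proof.
  intros Hb HL x; apply (tends_bound (fun n => B n x)); [easy|].
  exists O; intros n _; apply Hb.
Qed.

Lemma eq_on_dense (B1 B2 : X -> X) b D :
  linear_map B1 -> linear_map B2 -> bounded_by N B1 b -> bounded_by N B2 b -> dense N D ->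
  (forall x, D x -> B1 x = B2 x) -> forall x, B1 x = B2 x.
Proof.
  intros H1 H2 Hb1 Hb2 HD H x; apply N_separates; intros eps Heps.
  assert (Hb : 0 < Rabs b + 1) by (pose proof (Rabs_pos b); lra).
  destruct (HD x (eps / 2 / (Rabs b + 1))) as [y [Hy Hxy]].
  { now apply Rdiv_lt_0_compat; [lra|]. }
  apply Rle_div_r in Hxy; [|easy].
  replace (B1 x ⊖ B2 x) with (B1 (x ⊖ y) ⊖ B2 (x ⊖ y)).
  - pose proof (N_minus (B1 (x ⊖ y)) (B2 (x ⊖ y))).
    pose proof (Hb1 (x ⊖ y)); pose proof (Hb2 (x ⊖ y)).
    pose proof (Rle_abs b); pose proof (N_ge0 (x ⊖ y)); nra.
  - rewrite (lin_minus _ H1), (lin_minus _ H2), (H y Hy); vec.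
Qed.

(** * Telescoping *)

(** [P^k x - Q^k x] is the sum of the [P^i Q^(k-1-i) (P x - Q x)]. *)
Lemma telescope (P Q : X -> X) c k x :
  linear_map P -> linear_map Q -> (forall y, P (Q y) = Q (P y)) ->
  (forall i j, (i + j < k)%nat ->
     N (Nat.iter i P (Nat.iter j Q (P x ⊖ Q x))) <= c) ->
  N (Nat.iter k P x ⊖ Nat.iter k Q x) <= INR k * c.
Proof.
  intros HP HQ HPQ Hc.
  enough (H : forall i j, (i + j <= k)%nat ->
    N (Nat.iter j Q (Nat.iter i P x) ⊖ Nat.iter j Q (Nat.iter i Q x)) <= INR i * c)
    by (apply (H k O); lia).
  induction i as [|i IH]; intros j Hij.
  - simpl; replace (_ ⊖ _) with (vzero : X) by vec; rewrite N_zero; lra.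
  - rewrite S_INR.
    eapply Rle_trans; [apply (N_chain (Nat.iter (S j) Q (Nat.iter i P x)))|].
    specialize (IH (S j) ltac:(lia)); specialize (Hc i j ltac:(lia)).
    assert (E : forall y, Nat.iter (S j) Q (Nat.iter i Q y) = Nat.iter j Q (Nat.iter (S i) Q y)).
    { intros y; rewrite <- !Nat.iter_add; f_equal; lia. }
    rewrite <- E.
    replace (Nat.iter j Q (Nat.iter (S i) P x) ⊖ Nat.iter (S j) Q (Nat.iter i P x))
      with (Nat.iter i P (Nat.iter j Q (P x ⊖ Q x))); [lra|].
    rewrite (lin_minus _ (linear_iter j Q HQ)), (lin_minus _ (linear_iter i P HP)).
    rewrite !(iter_comm_iter P Q i j) by easy.
    rewrite (Nat.iter_succ_r j), (iter_comm P Q i) by easy.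
    now rewrite (Nat.iter_succ_r i).
Qed.

End EquivalentNorm.

(** * Finite sums and roots of unity *)

Fixpoint rsum (f : nat -> R) (n : nat) : R :=
  match n with O => 0 | S n => rsum f n + f n end.

Fixpoint csum (f : nat -> C) (n : nat) : C :=
  match n with O => RtoC 0 | S n => (csum f n + f n)%C end.

Fixpoint vsum {X : CompleteNormedModule C_AbsRing} (f : nat -> X) (n : nat) : X :=
  match n with O => vzero | S n => vsum f n ⊕ f n end.

Lemma rsum_le f g n : (forall i, f i <= g i) -> rsum f n <= rsum g n.
Proof. intros H; induction n; simpl; [lra|]; specialize (H n); lra. Qed.

Lemma rsum_scal a f n : rsum (fun i => a * f i) n = a * rsum f n.
Proof. induction n; simpl; [ring|]; rewrite IHn; ring. Qed.

Lemma csum_ext f g n : (forall i, f i = g i) -> csum f n = csum g n.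
Proof. intros H; induction n; simpl; [easy|]; now rewrite IHn, H. Qed.

Lemma csum_const a n : csum (fun _ => a) n = (RtoC (INR n) * a)%C.
Proof.
  induction n; [simpl; ring|].
  cbn [csum]; rewrite IHn, S_INR, RtoC_plus; ring.
Qed.

Lemma csum_scal a f n : csum (fun i => (a * f i)%C) n = (a * csum f n)%C.
Proof. induction n; simpl; [ring|]; rewrite IHn; ring. Qed.

Lemma csum_plus f g n : csum (fun i => (f i + g i)%C) n = (csum f n + csum g n)%C.
Proof. induction n; simpl; [ring|]; rewrite IHn; ring. Qed.

Lemma csum_swap (f : nat -> nat -> C) n m :
  csum (fun i => csum (f i) m) n = csum (fun j => csum (fun i => f i j) n) m.
Proof.
  induction n; simpl.
  - now rewrite csum_const, Cmult_0_r.
  - now rewrite IHn, <- csum_plus.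
Qed.

Lemma Re_csum f n : Re (csum f n) = rsum (fun i => Re (f i)) n.
Proof. induction n; simpl; [easy|]; now rewrite <- IHn. Qed.

Lemma csum_single (f : nat -> C) k n :
  (k < n)%nat -> (forall i, (i < n)%nat -> i <> k -> f i = RtoC 0) ->
  csum f n = f k.
Proof.
  induction n as [|n IH]; intros Hk H; [lia|]; simpl.
  destruct (Nat.eq_dec k n) as [->|Hkn].
  - replace (csum f n) with (RtoC 0); [ring|].
    assert (H' : forall i, (i < n)%nat -> f i = RtoC 0) by (intros; apply H; lia).
    clear H IH Hk; revert H'; induction n as [|n IH]; intros; simpl; [easy|].
    rewrite <- IH by auto; rewrite H' by lia; ring.
  - rewrite IH by (try lia; auto); rewrite (H n) by lia; ring.
Qed.

Lemma csum_geometric (z : C) n : ((1 - z) * csum (Cpow z) n = 1 - z ^ n)%C.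
Proof.
  induction n; simpl; [ring|].
  rewrite Cmult_plus_distr_l, IHn; ring.
Qed.

Lemma Cpow_add (z : C) m n : (z ^ (m + n) = z ^ m * z ^ n)%C.
Proof. induction m; simpl; [ring|]; rewrite IHm; ring. Qed.

Lemma Cpow_mult (z : C) m n : (z ^ (m * n) = (z ^ m) ^ n)%C.
Proof.
  induction n; simpl; [now rewrite Nat.mul_0_r|].
  now rewrite Nat.mul_succ_r, Nat.add_comm, Cpow_add, IHn.
Qed.

Lemma Cpow_mul_l (z w : C) n : ((z * w) ^ n = z ^ n * w ^ n)%C.
Proof. induction n; simpl; [ring|]; rewrite IHn; ring. Qed.

Lemma Cpow_1 n : (1 ^ n = 1)%C.
Proof. induction n; simpl; [easy|]; rewrite IHn; ring. Qed.

Lemma Cmod_Cpow (z : C) n : Cmod (z ^ n) = Cmod z ^ n.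
Proof. induction n; simpl; [apply Cmod_1|]; now rewrite Cmod_mult, IHn. Qed.

Lemma primitive_root_of_unity (n : nat) : (0 < n)%nat ->
  exists w : C, Cmod w = 1 /\ (w ^ n = 1)%C /\
    forall e, (0 < e < n)%nat -> (w ^ e)%C <> RtoC 1.
Proof.
  intros Hn; apply lt_INR in Hn as Hn'; simpl in Hn'.
  set (t := 2 * PI / INR n).
  assert (Hpow : forall e, ((cos t, sin t) ^ e)%C = (cos (INR e * t), sin (INR e * t))).
  { induction e as [|e IH].
    - simpl; now rewrite Rmult_0_l, cos_0, sin_0.
    - cbn [Cpow]; rewrite IH, S_INR, Rmult_plus_distr_r, Rmult_1_l, cos_plus, sin_plus.
      unfold Cmult; simpl; f_equal; ring. }
  exists (cos t, sin t); split; [|split].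
  - transitivity (sqrt 1); [|apply sqrt_1]; unfold Cmod; simpl; f_equal.
    pose proof (sin2_cos2 t); unfold Rsqr in *; lra.
  - rewrite Hpow; unfold t.
    replace (INR n * (2 * PI / INR n)) with (2 * PI) by (field; lra).
    now rewrite cos_2PI, sin_2PI.
  - intros e He; rewrite Hpow; intros [= Hcos _].
    assert (Het : INR e * t = 2 * (PI * (INR e / INR n))) by (unfold t; field; lra).
    rewrite Het, cos_2a_sin in Hcos.
    assert (Hs : 0 < sin (PI * (INR e / INR n))).
    2:{ pose proof (Rmult_lt_0_compat _ _ Hs Hs); lra. }
    destruct He as [He1 He2]; apply lt_INR in He1, He2; simpl in He1.
    assert (0 < INR e / INR n) by now apply Rdiv_lt_0_compat.
    assert (INR e / INR n < 1) by (apply Rlt_div_l; lra).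
    pose proof PI_RGT_0; apply sin_gt_0; nra.
Qed.

(** Averaging the powers of a primitive root extracts the exponents divisible
    by the order. *)
Lemma sum_root_powers (n : nat) (w : C) e :
  (w ^ n = 1)%C -> (forall e, (0 < e < n)%nat -> (w ^ e)%C <> RtoC 1) ->
  (0 < e < 2 * n)%nat -> e <> n -> csum (fun q => ((w ^ e) ^ q)%C) n = RtoC 0.
Proof.
  intros Hn Hprim He Hen.
  assert (H1 : (w ^ e)%C <> RtoC 1).
  { destruct (Nat.lt_ge_cases e n) as [H|H]; [apply Hprim; lia|].
    replace e with (n + (e - n))%nat by lia.
    rewrite Cpow_add, Hn, Cmult_1_l; apply Hprim; lia. }
  pose proof (csum_geometric (w ^ e)%C n) as H.
  rewrite <- Cpow_mult, Nat.mul_comm, Cpow_mult, Hn, Cpow_1 in H.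
  assert (H2 : (1 - w ^ e)%C <> RtoC 0).
  { intros E; apply H1; rewrite <- (Cplus_0_r (w ^ e)%C), <- E; ring. }
  replace (1 - 1)%C with (RtoC 0) in H by ring.
  change (csum (Cpow (w ^ e)%C) n = RtoC 0).
  rewrite <- (Cmult_1_l (csum _ _)), <- (Cinv_l (1 - w ^ e)%C) by easy.
  rewrite <- Cmult_assoc, H; ring.
Qed.

Lemma Cmod_sqr (z : C) : (Cmod z)² = (Re z)² + (Im z)².
Proof.
  unfold Cmod; rewrite Rsqr_sqrt; [unfold Re, Im, Rsqr; ring|].
  pose proof (pow2_ge_0 (fst z)); pose proof (pow2_ge_0 (snd z)); lra.
Qed.

Lemma Re_Im_Cinv (z : C) : z <> RtoC 0 -> Re (/ z) = Re z / (Cmod z)².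
Proof.
  intros Hz; rewrite Cmod_sqr; unfold Re, Im, Rsqr; simpl; f_equal; ring.
Qed.

(** Up to an affine change this is the Poisson kernel: the average of the real
    part of [1 / (1 - r w^q)] is explicit. *)
Lemma sum_Poisson (n : nat) (w : C) r :
  (0 < n)%nat -> Cmod w = 1 -> (w ^ n = 1)%C ->
  (forall e, (0 < e < n)%nat -> (w ^ e)%C <> RtoC 1) ->
  0 <= r < 1 -> r ^ n <= / 2 ->
  rsum (fun q => / (Cmod (1 - r * w ^ q))²) n <= 3 * INR n / (1 - r * r).
Proof.
  intros Hn0 Hw Hn Hprim Hr Hrn.
  assert (Hwq : forall q, Cmod (w ^ q) = 1) by (intros; now rewrite Cmod_Cpow, Hw, pow1).
  assert (Hne : forall q, (1 - r * w ^ q)%C <> RtoC 0).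
  { intros q E.
    assert (E1 : RtoC 1 = (r * w ^ q)%C)
      by (rewrite <- (Cplus_0_r (r * w ^ q)%C), <- E; ring).
    apply (f_equal Cmod) in E1.
    rewrite Cmod_1, Cmod_mult, Hwq, Cmod_R, Rabs_pos_eq in E1; lra. }
  assert (Hsum : csum (fun q => (/ (1 - r * w ^ q))%C) n = RtoC (INR n / (1 - r ^ n))).
  { transitivity (csum (fun q => (/ (1 - r ^ n) * csum (Cpow (r * w ^ q)) n)%C) n).
    { apply csum_ext; intros q.
      assert (Hrn' : (1 - r ^ n)%C <> RtoC 0).
      { rewrite <- RtoC_pow, <- RtoC_minus; intros [= E]; lra. }
      pose proof (csum_geometric (r * w ^ q)%C n) as G.
      rewrite Cpow_mul_l, <- (Cpow_mult w), Nat.mul_comm, Cpow_mult, Hn, Cpow_1, Cmult_1_r in G.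
      rewrite <- (Cmult_1_l (csum _ _)), <- (Cinv_l (1 - r * w ^ q)%C) by apply Hne.
      rewrite <- (Cmult_assoc _ _ (csum _ _)), G; field; split; [apply Hne|easy]. }
    rewrite csum_scal, csum_swap, (csum_single _ O).
    - simpl; rewrite csum_const, <- RtoC_pow.
      unfold Rdiv; rewrite RtoC_mult, RtoC_inv, RtoC_minus by lra; ring.
    - easy.
    - intros e He He0.
      transitivity (RtoC (r ^ e) * csum (fun q => ((w ^ e) ^ q)%C) n)%C.
      { rewrite <- csum_scal; apply csum_ext; intros q.
        now rewrite Cpow_mul_l, <- RtoC_pow, <- !Cpow_mult, Nat.mul_comm. }
      rewrite sum_root_powers; auto; try lia; ring. }
  assert (Hterm : forall q, / (Cmod (1 - r * w ^ q))²
     = / (1 - r * r) * (2 * Re (/ (1 - r * w ^ q)) - 1)).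
  { intros q; rewrite Re_Im_Cinv by apply Hne.
    specialize (Hwq q); pose proof (Cmod_sqr (w ^ q)) as E.
    rewrite Hwq in E.
    pose proof (Cmod_sqr (1 - r * w ^ q)) as E2.
    specialize (Hne q); apply Cmod_gt_0 in Hne.
    set (s := (Cmod (1 - r * w ^ q))²) in *.
    assert (0 < s) by (unfold s, Rsqr; nra).
    destruct (w ^ q)%C as [a b]; simpl in *; unfold Re, Im, Rsqr in *; simpl in *.
    ring_simplify (1 + - (r * a - 0 * b)).
    assert (Es : - r * a + 1 = (s + 1 - r * r) / 2).
    { enough (s = 1 - 2 * r * a + r * r * (a * a + b * b)) by (rewrite <- E in *; lra).
      rewrite E2; ring. }
    rewrite Es; field; split; nra. }
  assert (Hlin : forall m, rsum (fun q => / (Cmod (1 - r * w ^ q))²) m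
    = / (1 - r * r) * (2 * rsum (fun q => Re (/ (1 - r * w ^ q))) m - INR m)).
  { induction m as [|m IH]; [simpl; ring|].
    cbn [rsum]; rewrite IH, Hterm, S_INR; ring. }
  rewrite Hlin, <- Re_csum, Hsum; simpl.
  apply lt_INR in Hn0; simpl in Hn0.
  assert (INR n / (1 - r ^ n) <= 2 * INR n).
  { apply Rle_div_l; [lra|]; nra. }
  assert (0 < / (1 - r * r)) by (apply Rinv_0_lt_compat; nra).
  unfold Rdiv; rewrite (Rmult_comm (3 * _)); apply Rmult_le_compat_l; [lra|].
  unfold Rdiv in *; lra.
Qed.

Section VectorSums.

Context {X : CompleteNormedModule C_AbsRing} {N : X -> R} {M : R}
  (HN : equivalent_norm N M).

Lemma lin_vsum (B : X -> X) (f : nat -> X) n :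
  linear_map B -> B (vsum f n) = vsum (fun i => B (f i)) n.
Proof.
  intros HB; induction n; simpl; [now apply lin_zero|].
  now rewrite (lin_plus _ HB), IHn.
Qed.

Lemma vsum_swap (c : nat -> C) (d : nat -> nat -> C) (y : nat -> X) n m :
  vsum (fun q => c q ⊙ vsum (fun j => d q j ⊙ y j) m) n
  = vsum (fun j => csum (fun q => (c q * d q j)%C) n ⊙ y j) m.
Proof.
  induction m; simpl.
  - induction n; simpl; [easy|]; rewrite IHn; vec.
  - rewrite <- IHm; clear IHm; induction n; simpl; [vec|].
    rewrite IHn; vec.
Qed.

Lemma vsum_single (f : nat -> X) k n :
  (k < n)%nat -> (forall i, (i < n)%nat -> i <> k -> f i = vzero) ->
  vsum f n = f k.
Proof.
  induction n as [|n IH]; intros Hk H; [lia|]; simpl.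
  destruct (Nat.eq_dec k n) as [->|Hkn].
  - replace (vsum f n) with (vzero : X); [vec|].
    assert (H' : forall i, (i < n)%nat -> f i = vzero) by (intros; apply H; lia).
    clear H IH Hk; revert H'; induction n as [|n IH]; intros; simpl; [easy|].
    rewrite <- IH by auto; rewrite H' by lia; vec.
  - rewrite IH by (try lia; auto); rewrite (H n) by lia; vec.
Qed.

Lemma N_vsum (f : nat -> X) n : N (vsum f n) <= rsum (fun i => N (f i)) n.
Proof.
  induction n; simpl; [rewrite (N_zero HN); lra|].
  eapply Rle_trans; [apply (en_plus _ _ HN)|]; lra.
Qed.

End VectorSums.

(** * Powers of a contraction satisfying the Ritt condition *)

(** The binomial coefficient [j + m] over [m], which is the coefficient of
    [z ^ j] in [1 / (1 - z) ^ (m + 1)]. *)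
Fixpoint negbinom (m j : nat) : R :=
  match m with
  | O => 1
  | S m => negbinom m j * ((INR j + INR m + 1) / (INR m + 1))
  end.

Lemma negbinom_pos m j : 0 < negbinom m j.
Proof.
  induction m as [|m IH]; simpl; [lra|].
  pose proof (pos_INR m); pose proof (pos_INR j).
  apply Rmult_lt_0_compat; [easy|]; apply Rdiv_lt_0_compat; lra.
Qed.

Lemma negbinom_0_r m : negbinom m 0 = 1.
Proof.
  induction m as [|m IH]; simpl; [easy|]; rewrite IH.
  pose proof (pos_INR m); field; lra.
Qed.

Lemma negbinom_succ_r m j :
  negbinom m (S j) * (INR j + 1) = negbinom m j * (INR j + INR m + 1).
Proof.
  induction m as [|m IH]; [simpl; ring|].
  cbn [negbinom]; pose proof (pos_INR m); rewrite !S_INR.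
  replace (negbinom m (S j) * ((INR j + 1 + INR m + 1) / (INR m + 1)) * (INR j + 1))
    with (negbinom m (S j) * (INR j + 1) * ((INR j + 1 + INR m + 1) / (INR m + 1))) by ring.
  rewrite IH; field; lra.
Qed.

Lemma negbinom_Pascal m j :
  negbinom (S m) (S j) = negbinom (S m) j + negbinom m (S j).
Proof.
  cbn [negbinom]; pose proof (pos_INR m).
  replace (negbinom m j * ((INR j + INR m + 1) / (INR m + 1)))
    with (negbinom m j * (INR j + INR m + 1) / (INR m + 1)) by (field; lra).
  rewrite <- negbinom_succ_r, S_INR; field; lra.
Qed.

Lemma negbinom_lower m j : (INR j + 1) ^ m <= INR (fact m) * negbinom m j.
Proof.
  induction m as [|m IH]; [simpl; lra|].
  rewrite fact_simpl, mult_INR, S_INR; simpl.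
  pose proof (pos_INR m); pose proof (pos_INR j).
  replace ((INR m + 1) * INR (fact m) * (negbinom m j * ((INR j + INR m + 1) / (INR m + 1))))
    with (INR (fact m) * negbinom m j * (INR j + INR m + 1)) by (field; lra).
  rewrite Rmult_comm; apply Rmult_le_compat; try lra.
  apply pow_le; lra.
Qed.

Lemma pow_le_1 r n : 0 <= r <= 1 -> r ^ n <= 1.
Proof. intros H; rewrite <- (pow1 n); now apply pow_incr. Qed.

Lemma Bernoulli_minus e n : 0 <= e <= 1 -> 1 - INR n * e <= (1 - e) ^ n.
Proof.
  intros He; induction n as [|n IH]; [simpl; lra|].
  rewrite S_INR; simpl; pose proof (pos_INR n).
  apply (Rmult_le_compat_l (1 - e)) in IH; [|lra]; nra.
Qed.

Lemma negbinom_upper r m j :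
  0 <= r < 1 -> negbinom m j * r ^ j * (1 - r) ^ m <= 1.
Proof.
  intros Hr; revert j; induction m as [|m IHm]; intros j.
  - simpl; rewrite Rmult_1_l, Rmult_1_r; apply pow_le_1; lra.
  - induction j as [|j IHj].
    + rewrite negbinom_0_r, pow_O, !Rmult_1_l; apply pow_le_1; lra.
    + rewrite negbinom_Pascal; specialize (IHm (S j)).
      replace ((negbinom (S m) j + negbinom m (S j)) * r ^ S j * (1 - r) ^ S m)
        with (r * (negbinom (S m) j * r ^ j * (1 - r) ^ S m)
              + (1 - r) * (negbinom m (S j) * r ^ S j * (1 - r) ^ m)) by (simpl; ring).
      nra.
Qed.

(** The total weight of the boundary terms when [m + 1] factors are cancelled
    from the sums of length [l + 1]. *)
Fixpoint boundary_weight (m l : nat) : R :=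
  match m with
  | O => 1
  | S m => boundary_weight m l + 2 ^ S m * negbinom (S m) l
  end.

Lemma boundary_vanishes m r :
  0 < r < 1 -> exists l0, forall l, (l0 <= l)%nat -> boundary_weight m l * r ^ S l <= 1.
Proof.
  intros Hr; set (s := (1 + r) / 2).
  assert (Hs : r < s < 1) by (unfold s; lra).
  assert (Hc : exists c, forall l, boundary_weight m l * r ^ S l <= c * (r / s) ^ S l).
  { assert (Hq : 0 < r / s) by (apply Rdiv_lt_0_compat; lra).
    induction m as [|m [c IH]].
    - exists 1; intros l; simpl boundary_weight; rewrite !Rmult_1_l.
      apply pow_incr; split; [lra|]; apply Rle_div_r; nra.
    - exists (c + 2 ^ S m * / (1 - s) ^ S m); intros l; specialize (IH l).
      pose proof (negbinom_upper s (S m) l ltac:(lra)) as Hup.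
      assert (0 < (1 - s) ^ S m) by (apply pow_lt; lra).
      assert (0 < s ^ l) by (apply pow_lt; lra).
      assert (0 < (r / s) ^ S l) by (now apply pow_lt).
      assert (Hr' : r ^ S l = (r / s) ^ S l * s ^ S l).
      { rewrite <- Rpow_mult_distr; f_equal; field; lra. }
      assert (negbinom (S m) l * s ^ S l <= / (1 - s) ^ S m).
      { apply (Rmult_le_reg_r ((1 - s) ^ S m)); [easy|].
        rewrite Rinv_l by lra.
        pose proof (negbinom_pos (S m) l).
        replace (negbinom (S m) l * s ^ S l * (1 - s) ^ S m)
          with (s * (negbinom (S m) l * s ^ l * (1 - s) ^ S m)) by (simpl; ring).
        nra. }
      cbn [boundary_weight].
      rewrite !Rmult_plus_distr_r; apply Rplus_le_compat; [easy|].
      rewrite Hr'.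
      replace (2 ^ S m * negbinom (S m) l * ((r / s) ^ S l * s ^ S l))
        with (2 ^ S m * (r / s) ^ S l * (negbinom (S m) l * s ^ S l)) by ring.
      rewrite !Rmult_assoc, (Rmult_comm (/ _)).
      apply Rmult_le_compat_l; [apply pow_le; lra|].
      apply Rmult_le_compat_l; lra. }
  destruct Hc as [c Hc].
  destruct (pow_vanishes (r / s) c 1) as [l0 H0].
  { split; [apply Rdiv_le_0_compat; lra|apply Rlt_div_l; lra]. }
  { lra. }
  exists l0; intros l Hl; eapply Rle_trans; [apply Hc|]; apply H0; lia.
Qed.

Section Ritt.

Context {X : CompleteNormedModule C_AbsRing}.

(** A lower bound for [1 - z U]; when [U] is power bounded this is the Ritt
    resolvent condition. *)
Definition Ritt_bound (N : X -> R) (U : X -> X) (K : R) : Prop :=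
  forall (z : C) (x : X), Cmod z < 1 ->
    Cmod (1 - z) * N x <= K * N (x ⊖ z ⊙ U x).

Context {N : X -> R} {M : R} (HN : equivalent_norm N M).

Context (U : X -> X) (K : R) (HU : linear_map U) (HU1 : bounded_by N U 1)
  (HK : 1 <= K) (HR : Ritt_bound N U K).

Let D (x : X) : X := U x ⊖ x.
Let W (z : C) (x : X) : X := x ⊖ z ⊙ U x.

(** Truncation of the power series of [(1 - z U) ^ -(m + 1)]. *)
Let P (m L : nat) (z : C) (x : X) : X :=
  vsum (fun j => (RtoC (negbinom m j) * z ^ j)%C ⊙ Nat.iter j U x) L.

Lemma linear_D : linear_map D.
Proof.
  split; intros; unfold D; [rewrite (lin_plus _ HU)|rewrite (lin_scal _ HU)]; vec.
Qed.

Lemma linear_W z : linear_map (W z).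
Proof.
  split; intros; unfold W; [rewrite (lin_plus _ HU)|rewrite (lin_scal _ HU)]; vec.
Qed.

Lemma D_W_comm z x : D (W z x) = W z (D x).
Proof.
  unfold D, W; rewrite !(lin_minus _ HU), (lin_scal _ HU); vec.
Qed.

(** The series of order [m + 1] is an iterated sum of those of lower order, so
    that [1 - z U] lowers the order, at the cost of one boundary term. *)
Lemma W_P_0 l z x : W z (P 0 (S l) z x) = x ⊖ (z ^ S l)%C ⊙ Nat.iter (S l) U x.
Proof.
  induction l as [|l IH].
  - unfold P, W; simpl.
    rewrite (lin_plus _ HU), (lin_scal _ HU), (lin_zero _ HU); vec.
  - unfold P in *; cbn [vsum] in *.
    rewrite (lin_plus _ (linear_W z)), IH.
    unfold W at 1; rewrite (lin_scal _ HU).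
    cbn [negbinom]; simpl; vec.
Qed.

Lemma W_P_S m l z x :
  W z (P (S m) (S l) z x)
  = P m (S l) z x ⊖ (RtoC (negbinom (S m) l) * z ^ S l)%C ⊙ Nat.iter (S l) U x.
Proof.
  induction l as [|l IH].
  - unfold P, W; cbn [vsum]; rewrite !negbinom_0_r; simpl.
    rewrite (lin_plus _ HU), (lin_scal _ HU), (lin_zero _ HU); vec.
  - unfold P in *; cbn [vsum] in *.
    rewrite (lin_plus _ (linear_W z)), IH.
    unfold W at 1; rewrite (lin_scal _ HU), negbinom_Pascal, RtoC_plus.
    simpl; vec.
Qed.

Lemma bounded_by_W z : Cmod z <= 1 -> bounded_by N (W z) 2.
Proof.
  intros Hz x; unfold W; eapply Rle_trans; [apply (N_minus HN)|].
  rewrite (N_scal HN); pose proof (HU1 x); pose proof (N_ge0 HN (U x)); nra.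
Qed.

Lemma W_iter_P m l z x :
  Cmod z <= 1 ->
  N (Nat.iter (S m) (W z) (P m (S l) z x))
  <= (1 + boundary_weight m l * Cmod z ^ S l) * N x.
Proof.
  intros Hz.
  assert (Hit : N (Nat.iter (S l) U x) <= N x).
  { pose proof (contraction_iter U (S l) HU1 x); lra. }
  assert (Hzl : 0 <= Cmod z ^ S l) by apply pow_le, Cmod_ge_0.
  induction m as [|m IH].
  - change (Nat.iter 1 (W z) (P 0 (S l) z x)) with (W z (P 0 (S l) z x)).
    rewrite W_P_0.
    eapply Rle_trans; [apply (N_minus HN)|].
    rewrite (N_scal HN), Cmod_Cpow; cbn [boundary_weight]; nra.
  - rewrite Nat.iter_succ_r, W_P_S, (lin_minus _ (linear_iter (S m) _ (linear_W z))).
    eapply Rle_trans; [apply (N_minus HN)|].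
    rewrite (lin_scal _ (linear_iter (S m) _ (linear_W z))), (N_scal HN).
    rewrite Cmod_mult, Cmod_Cpow, Cmod_R, Rabs_pos_eq
      by (left; apply negbinom_pos).
    cbn [boundary_weight].
    pose proof (bounded_by_iter (W z) 2 (S m) ltac:(lra) (bounded_by_W z Hz)
                  (Nat.iter (S l) U x)) as H2.
    pose proof (negbinom_pos (S m) l) as Hb.
    assert (0 < 2 ^ S m) by (apply pow_lt; lra).
    assert (H3 : N (Nat.iter (S m) (W z) (Nat.iter (S l) U x)) <= 2 ^ S m * N x) by nra.
    apply (Rmult_le_compat_l (negbinom (S m) l * Cmod z ^ S l)) in H3; [|nra].
    lra.
Qed.

(** [z (U - 1) = (1 - z) - (1 - z U)], so the factor [U - 1] costs as much as
    a factor [1 - z U] restores. *)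
Lemma D_le_W z y :
  / 2 <= Cmod z < 1 -> N (D y) <= 4 * K * N (W z y).
Proof.
  intros Hz; pose proof (HR z y ltac:(lra)) as H.
  change (y ⊖ z ⊙ U y) with (W z y) in H.
  assert (E : z ⊙ D y = (1 - z)%C ⊙ y ⊖ W z y) by (unfold D, W; vec).
  apply (f_equal N) in E; rewrite (N_scal HN) in E.
  pose proof (N_minus HN ((1 - z)%C ⊙ y) (W z y)) as H2.
  rewrite (N_scal HN) in H2.
  pose proof (N_ge0 HN (D y)); pose proof (N_ge0 HN (W z y)); nra.
Qed.

Lemma D_iter_le_W z n y :
  / 2 <= Cmod z < 1 ->
  N (Nat.iter n D y) <= (4 * K) ^ n * N (Nat.iter n (W z) y).
Proof.
  intros Hz; revert y; induction n as [|n IH]; intros y; [simpl; lra|].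
  pose proof (D_le_W z (Nat.iter n D y) Hz) as H.
  rewrite <- (iter_comm D (W z)) in H by (intros; apply D_W_comm).
  specialize (IH (W z y)); rewrite <- Nat.iter_succ_r in IH.
  change (Nat.iter (S n) D y) with (D (Nat.iter n D y)); simpl pow; nra.
Qed.

(** For [|z| = r], the bound by the larger of [1 - r] and [|1 - z| / K] is
    comparable with a Poisson kernel of radius [r' = 1 - K (1 - r)], whose
    average over the circle is of order [1 / (1 - r')]. This gains a factor
    [K] over the use of [|1 - z| / K] alone. *)
Lemma W_lower r (q : C) y :
  / 2 <= r < 1 -> K * (1 - r) <= / 2 -> Cmod q = 1 ->
  N y <= 2 * K / Cmod (1 - RtoC (1 - K * (1 - r)) * q) * N (W (r * q) y).
Proof.
  intros Hr HKr Hq.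
  assert (Hrq : Cmod (r * q) = r) by (rewrite Cmod_mult, Hq, Cmod_R, Rabs_pos_eq; lra).
  pose proof (HR (r * q)%C y ltac:(lra)) as H1.
  change (y ⊖ (r * q)%C ⊙ U y) with (W (r * q) y) in H1.
  assert (H2 : (1 - r) * N y <= N (W (r * q) y)).
  { pose proof (N_le_minus HN y (W (r * q) y)) as H.
    replace (y ⊖ W (r * q) y) with ((r * q)%C ⊙ U y) in H by (unfold W; vec).
    rewrite (N_scal HN), Hrq in H; specialize (HU1 y); nra. }
  set (r' := 1 - K * (1 - r)) in *.
  assert (Hsq : (Cmod (1 - r' * q))² <= 4 * K * K * (Rmax (1 - r) (Cmod (1 - r * q) / K))²).
  { assert (HK2 : 1 <= K * K) by nra.
    pose proof (Cmod_sqr q) as Eq; rewrite Hq in Eq.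
    assert (Hs : forall s : R, (Cmod (1 - s * q))² = (1 - s) * (1 - s) + 2 * s * (1 - Re q)).
    { intros s; rewrite Cmod_sqr; destruct q as [a b]; unfold Re, Im, Rsqr in *; simpl in *.
      assert (Es : s * s = s * s * (a * a + b * b)) by (rewrite <- Eq; ring); nra. }
    assert (Hre : Re q <= 1) by (pose proof (re_le_Cmod q); pose proof (Rle_abs (Re q)); lra).
    assert (Hm1 : (1 - r)² <= (Rmax (1 - r) (Cmod (1 - r * q) / K))²).
    { apply Rsqr_incr_1; [apply Rmax_l|lra|].
      eapply Rle_trans; [|apply Rmax_l]; lra. }
    assert (Hm2 : (Cmod (1 - r * q))² <= K * K * (Rmax (1 - r) (Cmod (1 - r * q) / K))²).
    { replace ((Cmod (1 - r * q))²) with (K * K * (Cmod (1 - r * q) / K)²)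
        by (unfold Rsqr; field; lra).
      apply Rmult_le_compat_l; [nra|].
      apply Rsqr_incr_1; [apply Rmax_r| |].
      - apply Rdiv_le_0_compat; [apply Cmod_ge_0|lra].
      - eapply Rle_trans; [|apply Rmax_l]; lra. }
    rewrite Hs in Hm2; rewrite Hs.
    set (m2 := (Rmax _ _)²) in *; clearbody m2.
    assert (E1 : (1 - r') * (1 - r') = K * K * (1 - r)²) by (unfold r', Rsqr; ring).
    assert (r' <= 1) by (unfold r'; nra).
    assert (2 * r' * (1 - Re q) <= 2 * (2 * r * (1 - Re q))) by nra.
    assert (K * K * (1 - r)² <= K * K * m2) by (apply Rmult_le_compat_l; lra).
    nra. }
  assert (Hle : Cmod (1 - r' * q) <= 2 * K * Rmax (1 - r) (Cmod (1 - r * q) / K)).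
  { assert (0 <= Rmax (1 - r) (Cmod (1 - r * q) / K))
      by (eapply Rle_trans; [|apply Rmax_l]; lra).
    apply Rsqr_incr_0; [|apply Cmod_ge_0|nra].
    unfold Rsqr in *; lra. }
  assert (Hmax : Rmax (1 - r) (Cmod (1 - r * q) / K) * N y <= N (W (r * q) y)).
  { unfold Rmax; destruct Rle_dec as [_|_]; [|easy].
    apply (Rmult_le_reg_l K); [lra|].
    replace (K * (Cmod (1 - r * q) / K * N y)) with (Cmod (1 - r * q) * N y)
      by (field; lra); easy. }
  assert (Hpos : 0 < Cmod (1 - r' * q)).
  { apply Cmod_gt_0; intros E.
    assert (E1 : RtoC 1 = (r' * q)%C)
      by (rewrite <- (Cplus_0_r (r' * q)%C), <- E; ring).
    apply (f_equal Cmod) in E1.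
    rewrite Cmod_1, Cmod_mult, Hq, Cmod_R, Rabs_pos_eq in E1; unfold r' in *; nra. }
  replace (2 * K / Cmod (1 - r' * q) * N (W (r * q) y))
    with (2 * K * N (W (r * q) y) / Cmod (1 - r' * q)) by (field; lra).
  apply Rle_div_r; [easy|].
  pose proof (N_ge0 HN y); nra.
Qed.

(** Averaging over the roots of unity on the circle of radius [r] isolates one
    coefficient of the truncated series exactly. *)
Lemma sum_P m k l r w x :
  (k < l)%nat -> (w ^ l = 1)%C ->
  (forall e, (0 < e < l)%nat -> (w ^ e)%C <> RtoC 1) ->
  vsum (fun q => ((w ^ q) ^ (l - k))%C ⊙ P m l (RtoC r * w ^ q) x) l
  = (RtoC (INR l * (negbinom m k * r ^ k))) ⊙ Nat.iter k U x.
Proof.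
  intros Hk Hw Hprim; unfold P.
  rewrite (vsum_swap (fun q => ((w ^ q) ^ (l - k))%C)
             (fun q j => (RtoC (negbinom m j) * (RtoC r * w ^ q) ^ j)%C)).
  assert (Hc : forall j,
    csum (fun q => ((w ^ q) ^ (l - k) * (RtoC (negbinom m j) * (RtoC r * w ^ q) ^ j))%C) l
    = (RtoC (negbinom m j * r ^ j) * csum (fun q => ((w ^ (l - k + j)) ^ q)%C) l)%C).
  { intros j; rewrite <- csum_scal; apply csum_ext; intros q.
    rewrite Cpow_mul_l, <- RtoC_pow, RtoC_mult, <- !Cpow_mult.
    rewrite Nat.mul_add_distr_r, Cpow_add, (Nat.mul_comm (l - k)), (Nat.mul_comm j).
    ring. }
  rewrite (vsum_single _ k); [|easy|].
  - rewrite Hc; replace (l - k + k)%nat with l by lia.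
    rewrite Hw, (csum_ext _ (fun _ => RtoC 1)) by apply Cpow_1.
    rewrite csum_const, !RtoC_mult; f_equal; ring.
  - intros j Hj Hjk; rewrite Hc, sum_root_powers by (auto; lia); vec.
Qed.

(** Two of the [n + 2] factors [(1 - z U)^-1] provide the integrable kernel and
    the others compensate [(U - 1)^n]; the radius is at distance of order
    [1 / k] from [1], so that [r ^ k] stays bounded below. *)
Theorem Ritt_power_estimate n k x :
  K <= INR k + 1 ->
  N (Nat.iter n D (Nat.iter k U x))
  <= 96 * K * INR (fact (S n)) * (4 * K / (INR k + 1)) ^ n * N x.
Proof.
  intros HKk.
  assert (Hk0 : 0 < INR k + 1) by (pose proof (pos_INR k); lra).
  set (r := 1 - / (2 * (INR k + 1))).
  assert (He : K * (1 - r) <= / 2).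
  { unfold r; replace (K * (1 - (1 - / (2 * (INR k + 1))))) with (K / (INR k + 1) / 2)
      by (field; lra).
    assert (K / (INR k + 1) <= 1) by (apply Rle_div_l; lra); lra. }
  assert (Hr : / 2 <= r < 1).
  { assert (0 < / (2 * (INR k + 1))) by (apply Rinv_0_lt_compat; lra).
    split; [|unfold r; lra]; nra. }
  set (r' := 1 - K * (1 - r)) in *.
  assert (Hr' : / 2 <= r' < 1) by (unfold r'; nra).
  (* The number of roots: long enough for all truncation errors. *)
  destruct (boundary_vanishes (S n) r) as [l1 Hl1]; [lra|].
  destruct (pow_vanishes r' 1 (/ 2)) as [l2 Hl2]; [lra|lra|].
  set (l := max (max l1 l2) k).
  specialize (Hl1 l ltac:(lia)); specialize (Hl2 (S l) ltac:(lia)).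
  rewrite Rmult_1_l in Hl2.
  destruct (primitive_root_of_unity (S l) ltac:(lia)) as [w [Hw1 [Hw Hprim]]].
  assert (Hwq : forall q, Cmod (w ^ q) = 1) by (intros; now rewrite Cmod_Cpow, Hw1, pow1).
  assert (Hterm : forall q,
    N (Nat.iter n D (((w ^ q) ^ (S l - k))%C ⊙ P (S n) (S l) (RtoC r * w ^ q) x))
    <= (4 * K) ^ n * (2 * K) ^ 2 * 2 * N x * / (Cmod (1 - r' * w ^ q))²).
  { intros q; rewrite (lin_scal _ (linear_iter n _ linear_D)), (N_scal HN).
    rewrite Cmod_Cpow, Hwq, pow1, Rmult_1_l.
    set (z := (RtoC r * w ^ q)%C).
    assert (Hz : Cmod z = r)
      by (unfold z; rewrite Cmod_mult, Hwq, Cmod_R, Rabs_pos_eq; lra).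
    set (y := P (S n) (S l) z x).
    eapply Rle_trans; [apply (D_iter_le_W z); lra|].
    pose proof (W_lower r (w ^ q)%C (Nat.iter n (W z) y) Hr He (Hwq q)) as H1.
    pose proof (W_lower r (w ^ q)%C (Nat.iter (S n) (W z) y) Hr He (Hwq q)) as H2.
    pose proof (W_iter_P (S n) l z x ltac:(lra)) as H3.
    fold r' z y in H1, H2, H3; rewrite Hz in H3.
    change (W z (Nat.iter n (W z) y)) with (Nat.iter (S n) (W z) y) in H1.
    change (W z (Nat.iter (S n) (W z) y)) with (Nat.iter (S (S n)) (W z) y) in H2.
    set (p := Cmod (1 - r' * w ^ q)) in *.
    set (y1 := N (Nat.iter n (W z) y)) in *.
    set (y2 := N (Nat.iter (S n) (W z) y)) in *.
    set (y3 := N (Nat.iter (S (S n)) (W z) y)) in *.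
    assert (Hp : 0 <= 2 * K / p).
    { destruct (Req_dec p 0) as [->|Hp0]; [unfold Rdiv; rewrite Rinv_0; lra|].
      apply Rdiv_le_0_compat; [lra|]; pose proof (Cmod_ge_0 (1 - r' * w ^ q) : 0 <= p).
      lra. }
    assert (H4 : y3 <= 2 * N x) by (pose proof (N_ge0 HN x); nra).
    assert (H5 : y1 <= 2 * K / p * (2 * K / p) * (2 * N x)).
    { eapply Rle_trans; [exact H1|]; rewrite Rmult_assoc.
      apply Rmult_le_compat_l; [easy|].
      eapply Rle_trans; [exact H2|]; apply Rmult_le_compat_l; easy. }
    apply (Rmult_le_compat_l ((4 * K) ^ n)) in H5; [|apply pow_le; lra].
    eapply Rle_trans; [exact H5|]; right.
    unfold Rdiv, Rsqr; rewrite Rinv_mult; ring. }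
  pose proof (sum_P (S n) k (S l) r w x ltac:(lia) Hw Hprim) as Hsum.
  apply (f_equal (fun y => N (Nat.iter n D y))) in Hsum.
  rewrite (lin_scal _ (linear_iter n _ linear_D)), (N_scal HN) in Hsum.
  rewrite (lin_vsum _ _ _ (linear_iter n _ linear_D)) in Hsum.
  pose proof (N_vsum HN
    (fun q => Nat.iter n D (((w ^ q) ^ (S l - k))%C ⊙ P (S n) (S l) (RtoC r * w ^ q) x))
    (S l)) as Hle.
  rewrite Hsum in Hle.
  eapply Rle_trans in Hle; [|apply Rle_refl].
  assert (Hle2 := Rle_trans _ _ _ Hle (rsum_le _ _ (S l) Hterm)).
  rewrite rsum_scal in Hle2.
  pose proof (sum_Poisson (S l) w r' ltac:(lia) Hw1 Hw Hprim ltac:(lra) Hl2) as HP.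
  clear Hle Hsum Hterm.
  set (s := rsum _ _) in *; set (v := N (Nat.iter n D (Nat.iter k U x))) in *.
  assert (HL : 0 < INR (S l)) by (apply lt_0_INR; lia).
  assert (Hrk : / 2 <= r ^ k).
  { pose proof (Bernoulli_minus (1 - r) k ltac:(lra)) as HB.
    replace (1 - (1 - r)) with r in HB by ring.
    enough (INR k * (1 - r) <= / 2) by lra.
    unfold r; replace (INR k * (1 - (1 - / (2 * (INR k + 1)))))
      with (INR k / (INR k + 1) / 2) by (field; lra).
    enough (INR k / (INR k + 1) <= 1) by lra; apply Rle_div_l; lra. }
  pose proof (negbinom_lower (S n) k) as Hlow.
  pose proof (negbinom_pos (S n) k) as Hb.
  assert (Hnr : 0 <= INR (S l) * (negbinom (S n) k * r ^ k)).
  { apply Rmult_le_pos; [lra|apply Rmult_le_pos; lra]. }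
  rewrite Cmod_R, Rabs_pos_eq in Hle2 by easy.
  assert (Hv : 0 <= v) by apply (N_ge0 HN).
  assert (H4K : 0 < (4 * K) ^ n) by (apply pow_lt; lra).
  assert (Hx : 0 <= N x) by apply (N_ge0 HN).
  assert (Hs : s <= INR (S l) * (6 * (INR k + 1) / K)).
  { eapply Rle_trans; [exact HP|].
    assert (Er : K * (1 - r) = K / (2 * (INR k + 1))) by (unfold r; field; lra).
    assert (Hr2 : K / (2 * (INR k + 1)) <= 1 - r' * r') 
      by (rewrite <- Er; assert (1 - r' = K * (1 - r)) by (unfold r'; ring); nra).
    assert (0 < K / (2 * (INR k + 1))) by (apply Rdiv_lt_0_compat; lra).
    replace (INR (S l) * (6 * (INR k + 1) / K))
      with (3 * INR (S l) / (K / (2 * (INR k + 1)))) by (field; lra).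
    apply Rmult_le_compat_l; [lra|]; now apply Rinv_le_contravar. }
  assert (Hnv : negbinom (S n) k * v <= 96 * K * (INR k + 1) * (4 * K) ^ n * N x).
  { assert (H1 : INR (S l) * (negbinom (S n) k * r ^ k) * v
      <= (4 * K) ^ n * (2 * K) ^ 2 * 2 * N x * (INR (S l) * (6 * (INR k + 1) / K))).
    { eapply Rle_trans; [exact Hle2|]; apply Rmult_le_compat_l; [|easy].
      repeat apply Rmult_le_pos; lra. }
    replace ((4 * K) ^ n * (2 * K) ^ 2 * 2 * N x * (INR (S l) * (6 * (INR k + 1) / K)))
      with (INR (S l) * (48 * K * (INR k + 1) * (4 * K) ^ n * N x)) in H1 by (field; lra).
    rewrite Rmult_assoc in H1; apply Rmult_le_reg_l in H1; [|easy].
    assert (0 <= negbinom (S n) k * v) by (apply Rmult_le_pos; lra).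
    nra. }
  apply (Rmult_le_reg_l ((INR k + 1) ^ S n)); [apply pow_lt; lra|].
  apply (Rmult_le_compat_r v) in Hlow; [|easy].
  eapply Rle_trans; [exact Hlow|].
  rewrite Rmult_assoc.
  apply (Rmult_le_compat_l (INR (fact (S n)))) in Hnv; [|apply pos_INR].
  eapply Rle_trans; [exact Hnv|]; right.
  unfold Rdiv; rewrite !Rpow_mult_distr, pow_inv; simpl pow.
  assert ((INR k + 1) ^ n <> 0) by (apply pow_nonzero; lra).
  field; easy.
Qed.

End Ritt.

(** * Exponentials of bounded operators *)

Ltac C_nonzero :=
  repeat match goal with |- _ /\ _ => split end; intros [= ?]; lra.

Lemma exp_le x y : x <= y -> exp x <= exp y.
Proof. intros [H| ->]; [left; now apply exp_increasing|apply Rle_refl]. Qed.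

Section Exponential.

Context {X : CompleteNormedModule C_AbsRing}.

Definition step (B : X -> X) (a : C) (x : X) : X := x ⊕ a ⊙ B x.

(** The subsequence of the Euler products along the powers of two, for which
    consecutive terms are easily compared. *)
Definition euler (B : X -> X) (j : nat) (z : C) : X -> X :=
  Nat.iter (2 ^ j) (step B (z / INR (2 ^ j))%C).

Definition exp_op (N : X -> R) (B : X -> X) (z : C) (x : X) : X :=
  vlim N (fun j => euler B j z x).

Context {N : X -> R} {M : R} (HN : equivalent_norm N M).

Local Notation expm := (exp_op N).

Lemma iter_compose (P Q : X -> X) k x :
  (forall y, P (Q y) = Q (P y)) ->
  Nat.iter k (fun y => P (Q y)) x = Nat.iter k P (Nat.iter k Q x).
Proof.
  intros H; induction k as [|k IH]; [easy|].
  change (P (Q (Nat.iter k (fun y => P (Q y)) x))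
          = P (Nat.iter k P (Q (Nat.iter k Q x)))).
  now rewrite IH, (iter_comm P Q).
Qed.

Lemma INR_pow_two j : INR (2 ^ j) = 2 ^ j.
Proof. now rewrite pow_INR. Qed.

Lemma pow_two_ge j : INR j + 1 <= 2 ^ j.
Proof.
  induction j as [|j IH]; [simpl; lra|].
  rewrite S_INR; simpl; pose proof (pos_INR j); lra.
Qed.

Lemma telescope_bounded (P Q : X -> X) p k x :
  linear_map P -> linear_map Q -> (forall y, P (Q y) = Q (P y)) ->
  1 <= p -> bounded_by N P p -> bounded_by N Q p ->
  N (Nat.iter k P x ⊖ Nat.iter k Q x) <= INR k * (p ^ k * N (P x ⊖ Q x)).
Proof.
  intros HP HQ Hc Hp HPb HQb; apply (telescope HN); auto.
  intros i j Hij.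
  pose proof (bounded_by_iter P p i ltac:(lra) HPb (Nat.iter j Q (P x ⊖ Q x))) as H1.
  pose proof (bounded_by_iter Q p j ltac:(lra) HQb (P x ⊖ Q x)) as H2.
  pose proof (N_ge0 HN (P x ⊖ Q x)).
  assert (0 <= p ^ i) by (apply pow_le; lra).
  assert (H3 : p ^ i * p ^ j <= p ^ k)
    by (rewrite <- pow_add; apply Rle_pow; [easy|lia]).
  apply (Rmult_le_compat_l (p ^ i)) in H2; [|easy]; nra.
Qed.

Context (B : X -> X) (b : R) (HB : linear_map B) (Hb : 0 <= b)
  (HBb : bounded_by N B b).

Lemma linear_step a : linear_map (step B a).
Proof.
  split; intros; unfold step; [rewrite (lin_plus _ HB)|rewrite (lin_scal _ HB)]; vec.
Qed.

Lemma step_comm (P : X -> X) a x :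
  linear_map P -> (forall y, P (B y) = B (P y)) -> P (step B a x) = step B a (P x).
Proof.
  intros HP Hc; unfold step; now rewrite (lin_plus _ HP), (lin_scal _ HP), Hc.
Qed.

Lemma step_step_comm a a' x : step B a (step B a' x) = step B a' (step B a x).
Proof.
  apply (step_comm (step B a)); [apply linear_step|].
  intros y; symmetry; now apply step_comm.
Qed.

Lemma bounded_by_step a c : Cmod a * b <= c -> bounded_by N (step B a) (exp c).
Proof.
  intros Hc x; unfold step; eapply Rle_trans; [apply (en_plus _ _ HN)|].
  rewrite (N_scal HN); pose proof (HBb x); pose proof (N_ge0 HN x).
  pose proof (Cmod_ge_0 a); pose proof (exp_ineq1_le c).
  apply (Rmult_le_compat_l (Cmod a)) in H; [|easy]; nra.
Qed.

Lemma exp_pow c n : exp c ^ n = exp (INR n * c).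
Proof.
  induction n as [|n IH]; [simpl; now rewrite Rmult_0_l, exp_0|].
  rewrite S_INR; cbn [pow]; rewrite IH, <- exp_plus; f_equal; ring.
Qed.

Lemma linear_euler j z : linear_map (euler B j z).
Proof. apply linear_iter, linear_step. Qed.

Lemma Cmod_div_INR z n : (0 < n)%nat -> Cmod (z / INR n) = Cmod z / INR n.
Proof.
  intros Hn; apply lt_0_INR in Hn; unfold Cdiv.
  rewrite Cmod_mult, <- RtoC_inv, Cmod_R, Rabs_pos_eq; [easy| |lra].
  left; now apply Rinv_0_lt_compat.
Qed.

Lemma pow_two_pos j : (0 < 2 ^ j)%nat.
Proof. pose proof (Nat.pow_nonzero 2 j); lia. Qed.

Lemma bounded_by_euler_step j z c :
  Cmod z * b <= c -> bounded_by N (step B (z / INR (2 ^ j))) (exp (c / INR (2 ^ j))).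
Proof.
  intros Hc; apply bounded_by_step; rewrite Cmod_div_INR by apply pow_two_pos.
  pose proof (pow_two_pos j) as Hj; apply lt_0_INR in Hj.
  unfold Rdiv; rewrite Rmult_assoc, (Rmult_comm (/ _)), <- Rmult_assoc.
  apply Rmult_le_compat_r; [left; now apply Rinv_0_lt_compat|easy].
Qed.

Lemma exp_div_pow c j : exp (c / INR (2 ^ j)) ^ (2 ^ j) = exp c.
Proof.
  rewrite exp_pow; f_equal; pose proof (pow_two_pos j) as Hj; apply lt_0_INR in Hj.
  field; lra.
Qed.

Lemma bounded_by_euler j z : bounded_by N (euler B j z) (exp (Cmod z * b)).
Proof.
  rewrite <- (exp_div_pow _ j); apply bounded_by_iter; [left; apply exp_pos|].
  now apply bounded_by_euler_step.
Qed.

(** Halving the step changes one factor by a term of second order, and there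
    are [2 ^ j] factors. *)
Lemma euler_succ_diff j z x :
  N (euler B (S j) z x ⊖ euler B j z x)
  <= exp (Cmod z * b) * (Cmod z * b)² / 4 * N x * (/ 2) ^ j.
Proof.
  pose proof (pow_two_pos j) as Hj; apply lt_0_INR in Hj.
  set (a := (z / INR (2 ^ j))%C); set (h := (z / INR (2 ^ S j))%C).
  set (P := step B h).
  assert (Ea : a = (h + h)%C).
  { unfold a, h; replace (INR (2 ^ S j)) with (INR (2 ^ j) + INR (2 ^ j))
      by (rewrite !INR_pow_two; simpl; ring).
    rewrite RtoC_plus; field; rewrite <- ?RtoC_plus; C_nonzero. }
  assert (E : euler B (S j) z x = Nat.iter (2 ^ j) (fun y => P (P y)) x).
  { rewrite iter_compose by easy; unfold euler; fold h P.
    rewrite <- Nat.iter_add; f_equal; simpl; lia. }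
  rewrite E; unfold euler; fold a.
  assert (HPP : linear_map (fun y => P (P y))) by (apply linear_comp; apply linear_step).
  pose proof (telescope_bounded (fun y => P (P y)) (step B a)
    (exp (Cmod z * b / INR (2 ^ j))) (2 ^ j) x HPP (linear_step a)) as H.
  assert (Hz : 0 <= Cmod z * b) by (apply Rmult_le_pos; [apply Cmod_ge_0|easy]).
  rewrite exp_div_pow in H.
  eapply Rle_trans; [apply H|].
  - intros y; unfold P; now rewrite (step_step_comm _ a), (step_step_comm _ a).
  - rewrite <- exp_0; apply exp_le; apply Rdiv_le_0_compat; lra.
  - intros y.
    pose proof (bounded_by_step h (Cmod z * b / INR (2 ^ j) / 2)) as Hs.
    assert (Hm : Cmod h * b <= Cmod z * b / INR (2 ^ j) / 2).
    { right; unfold h; rewrite Cmod_div_INR by apply pow_two_pos; rewrite !INR_pow_two in *.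
      simpl; field; lra. }
    specialize (Hs Hm); fold P in Hs.
    pose proof (Hs (P y)) as H1; pose proof (Hs y) as H2.
    apply (Rmult_le_compat_l (exp (Cmod z * b / INR (2 ^ j) / 2))) in H2;
      [|left; apply exp_pos].
    rewrite <- Rmult_assoc, <- exp_plus in H2.
    replace (Cmod z * b / INR (2 ^ j) / 2 + Cmod z * b / INR (2 ^ j) / 2)
      with (Cmod z * b / INR (2 ^ j)) in H2 by (field; lra); lra.
  - now apply bounded_by_euler_step.
  - assert (Ed : P (P x) ⊖ step B a x = (h * h)%C ⊙ B (B x)).
    { unfold P, step; rewrite Ea, (lin_plus _ HB), (lin_scal _ HB); vec. }
    rewrite Ed, (N_scal HN), Cmod_mult.
    unfold h; rewrite Cmod_div_INR by apply pow_two_pos.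
    pose proof (HBb x); pose proof (HBb (B x)).
    assert (HBB : N (B (B x)) <= b * b * N x) by nra.
    rewrite !INR_pow_two in *; rewrite pow_inv; simpl pow.
    set (k := 2 ^ j) in *.
    replace (k * (exp (Cmod z * b) * (Cmod z / (2 * k) * (Cmod z / (2 * k)) * N (B (B x)))))
      with (exp (Cmod z * b) * (Cmod z * Cmod z) / 4 / k * N (B (B x))) by (field; lra).
    unfold Rsqr.
    replace (exp (Cmod z * b) * (Cmod z * b * (Cmod z * b)) / 4 * N x * / k)
      with (exp (Cmod z * b) * (Cmod z * Cmod z) / 4 / k * (b * b * N x)) by (field; lra).
    apply Rmult_le_compat_l; [|easy].
    pose proof (exp_pos (Cmod z * b)); pose proof (Cmod_ge_0 z).
    repeat (apply Rdiv_le_0_compat; try lra); apply Rmult_le_pos; nra.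
Qed.

Lemma euler_converges z x :
  tends N (fun j => euler B j z x) (expm B z x) /\
  N (expm B z x ⊖ (x ⊕ z ⊙ B x)) <= exp (Cmod z * b) * (Cmod z * b)² * N x.
Proof.
  destruct (tends_geometric HN (fun j => euler B j z x) _ (/ 2) ltac:(lra)
              (fun j => euler_succ_diff j z x)) as [l [Hl Hd]].
  assert (E : expm B z x = l) by now apply (vlim_eq HN).
  rewrite E; split; [easy|].
  assert (E0 : euler B 0 z x = x ⊕ z ⊙ B x).
  { unfold euler, step; simpl; vec_goals; try ring; field; C_nonzero. }
  cbv beta in Hd; rewrite E0 in Hd.
  eapply Rle_trans; [exact Hd|].
  assert (0 <= exp (Cmod z * b) * (Cmod z * b)² * N x).
  { apply Rmult_le_pos; [|apply (N_ge0 HN)].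
    apply Rmult_le_pos; [left; apply exp_pos|apply Rle_0_sqr]. }
  lra.
Qed.

Lemma euler_tends z x : tends N (fun j => euler B j z x) (expm B z x).
Proof. apply euler_converges. Qed.

Lemma expm_first_order z x :
  N (expm B z x ⊖ (x ⊕ z ⊙ B x)) <= exp (Cmod z * b) * (Cmod z * b)² * N x.
Proof. apply euler_converges. Qed.

Lemma linear_expm z : linear_map (expm B z).
Proof.
  apply (linear_limit HN (fun j => euler B j z)).
  - intros j; apply linear_euler.
  - intros x; apply euler_tends.
Qed.

Lemma bounded_by_expm z : bounded_by N (expm B z) (exp (Cmod z * b)).
Proof.
  apply (bounded_by_limit HN (fun j => euler B j z)).
  - intros j; apply bounded_by_euler.
  - intros x; apply euler_tends.
Qed.

Lemma expm_comm (P : X -> X) p z x :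
  linear_map P -> bounded_by N P p -> (forall y, P (B y) = B (P y)) ->
  P (expm B z x) = expm B z (P x).
Proof.
  intros HP HPb Hc.
  apply (tends_unique HN (fun j => euler B j z (P x))); [|apply euler_tends].
  apply (tends_ext (fun j => P (euler B j z x))).
  - intros j; unfold euler; symmetry; apply iter_comm.
    intros y; symmetry; now apply step_comm.
  - apply (tends_linear HN P p); auto; apply euler_tends.
Qed.

(** The product of the two steps differs from the step of the sum by a term of
    second order, so that the Euler products differ by one of first order. *)
Lemma expm_plus z w x : expm B (z + w) x = expm B z (expm B w x).
Proof.
  set (c := Cmod z * b + Cmod w * b).
  assert (Hzw : Cmod (z + w) * b <= c).
  { unfold c; pose proof (Cmod_triangle z w); nra. }
  assert (HBB : N (B (B x)) <= b * b * N x).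
  { pose proof (HBb x); pose proof (HBb (B x)); nra. }
  apply (tends_unique HN (fun j => expm B (z + w) x)); [apply (tends_const HN)|].
  assert (H1 : tends N (fun j => euler B j z (euler B j w x)) (expm B z (expm B w x))).
  { apply (tends_map HN (fun j => euler B j z) (exp (Cmod z * b))
             (fun j => euler B j w x) (expm B w x)).
    - intros j; apply linear_euler.
    - intros j; apply bounded_by_euler.
    - apply euler_tends.
    - apply euler_tends. }
  pose proof (euler_tends (z + w) x) as H2.
  assert (H3 : tends N (fun j => euler B j z (euler B j w x) ⊖ euler B j (z + w) x) vzero).
  { apply (tends_squeeze _ _ (exp c * (Cmod z * Cmod w) * (b * b * N x))).
    exists O; intros j _.
    replace (euler B j z (euler B j w x) ⊖ euler B j (z + w) x ⊖ vzero)
      with (euler B j z (euler B j w x) ⊖ euler B j (z + w) x) by vec.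
    pose proof (pow_two_pos j) as Hj; apply lt_0_INR in Hj.
    unfold euler; rewrite <- iter_compose by apply step_step_comm.
    set (k := INR (2 ^ j)) in *.
    eapply Rle_trans.
    - apply (telescope_bounded (fun y => step B (z / k) (step B (w / k) y)) _ (exp (c / k))).
      + apply linear_comp; apply linear_step.
      + apply linear_step.
      + intros y; now rewrite (step_step_comm (w / k)), (step_step_comm (z / k)).
      + rewrite <- exp_0; apply exp_le; apply Rdiv_le_0_compat; [|easy].
        unfold c; pose proof (Cmod_ge_0 z); pose proof (Cmod_ge_0 w); nra.
      + intros y.
        pose proof (bounded_by_euler_step j z (Cmod z * b) (Rle_refl _)) as Hz1.
        pose proof (bounded_by_euler_step j w (Cmod w * b) (Rle_refl _)) as Hw1.
        specialize (Hz1 (step B (w / k) y)); specialize (Hw1 y); fold k in Hz1, Hw1.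
        replace (c / k) with (Cmod z * b / k + Cmod w * b / k) by (unfold c; field; lra).
        rewrite exp_plus; pose proof (exp_pos (Cmod z * b / k)); nra.
      + now apply bounded_by_euler_step.
    - replace (exp (c / k) ^ (2 ^ j)) with (exp c) by (symmetry; apply exp_div_pow).
      assert (Ed : step B (z / k) (step B (w / k) x) ⊖ step B ((z + w) / k) x
                   = (z / k * (w / k))%C ⊙ B (B x)).
      { replace ((z + w) / k)%C with (z / k + w / k)%C by (unfold Cdiv; ring).
        unfold step; rewrite (lin_plus _ HB), (lin_scal _ HB); vec. }
      cbv beta; rewrite Ed, (N_scal HN), Cmod_mult; unfold k; rewrite !Cmod_div_INR by apply pow_two_pos.
      fold k; assert (Hk1 : INR j + 1 <= k).
      { unfold k; rewrite INR_pow_two; apply pow_two_ge. }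
      replace (k * (exp c * (Cmod z / k * (Cmod w / k) * N (B (B x)))))
        with (exp c * (Cmod z * Cmod w) * N (B (B x)) / k) by (field; lra).
      pose proof (pos_INR j); pose proof (exp_pos c).
      assert (0 <= exp c * (Cmod z * Cmod w)).
      { pose proof (Cmod_ge_0 z); pose proof (Cmod_ge_0 w).
        apply Rmult_le_pos; [lra|]; nra. }
      assert (0 <= N (B (B x))) by apply (N_ge0 HN).
      apply Rmult_le_compat; [nra|left; now apply Rinv_0_lt_compat| |].
      + apply Rmult_le_compat_l; easy.
      + apply Rinv_le_contravar; lra. }
  replace (expm B z (expm B w x))
    with (expm B z (expm B w x) ⊖ expm B (z + w) x ⊕ expm B (z + w) x) by vec.
  replace (expm B z (expm B w x) ⊖ expm B (z + w) x) with (vzero : X).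
  - replace (vzero ⊕ expm B (z + w) x) with (expm B (z + w) x) by vec.
    apply (tends_const HN).
  - apply (tends_unique HN _ _ _ H3); now apply (tends_minus HN).
Qed.

Lemma expm_0 x : expm B 0 x = x.
Proof.
  apply (tends_unique HN (fun j => euler B j 0 x)); [apply euler_tends|].
  apply (tends_ext (fun _ => x)); [|apply (tends_const HN)].
  intros j; unfold euler.
  replace (0 / INR (2 ^ j))%C with (RtoC 0) by (unfold Cdiv; ring).
  induction (2 ^ j)%nat as [|k IH]; [easy|].
  change (x = step B 0 (Nat.iter k (step B 0) x)); rewrite <- IH; unfold step; vec.
Qed.

Lemma expm_iter k z x : Nat.iter k (expm B z) x = expm B (INR k * z) x.
Proof.
  induction k as [|k IH].
  - simpl; rewrite Cmult_0_l; symmetry; apply expm_0.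
  - change (expm B z (Nat.iter k (expm B z) x) = expm B (INR (S k) * z) x).
    rewrite IH, <- expm_plus; f_equal; rewrite S_INR, RtoC_plus; ring.
Qed.

(** The assumption bounds the Taylor series of [exp (a k B) y] by that of
    [A / (1 - k |a| r) ^ 2]; the statement propagates to all derivatives, which
    makes the induction on the number of steps work. *)
Lemma step_iter_bound y A r a k n :
  0 <= A -> 0 <= r -> Cmod a * INR k * r < 1 ->
  (forall n, N (Nat.iter n B y) <= A * INR (fact (S n)) * r ^ n) ->
  N (Nat.iter n B (Nat.iter k (step B a) y))
  <= A * INR (fact (S n)) * r ^ n * (/ (1 - Cmod a * INR k * r)) ^ S (S n).
Proof.
  intros HA Hr Hk Hy; revert n Hk; induction k as [|k IH]; intros n Hk.
  - simpl INR; rewrite Rmult_0_r, Rmult_0_l, Rminus_0_r, Rinv_1, pow1, Rmult_1_r; apply Hy.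
  - rewrite S_INR in *.
    set (u := Cmod a * INR k * r) in *; set (d := Cmod a * r) in *.
    assert (Ed : Cmod a * (INR k + 1) * r = u + d) by (unfold u, d; ring).
    rewrite Ed in *.
    assert (Hd : 0 <= d) by (apply Rmult_le_pos; [apply Cmod_ge_0|easy]).
    assert (Hu : u < 1) by lra.
    pose proof (IH n Hu) as H1; pose proof (IH (S n) Hu) as H2; clear IH.
    assert (E : Nat.iter n B (Nat.iter (S k) (step B a) y)
      = Nat.iter n B (Nat.iter k (step B a) y)
        ⊕ a ⊙ Nat.iter (S n) B (Nat.iter k (step B a) y)).
    { change (Nat.iter (S k) (step B a) y) with (step B a (Nat.iter k (step B a) y)).
      unfold step at 1; rewrite (lin_plus _ (linear_iter n _ HB)), (lin_scal _ (linear_iter n _ HB)).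
      now rewrite <- Nat.iter_succ_r. }
    rewrite E; clear E.
    eapply Rle_trans; [apply (en_plus _ _ HN)|]; rewrite (N_scal HN).
    apply (Rmult_le_compat_l (Cmod a)) in H2; [|apply Cmod_ge_0].
    eapply Rle_trans; [apply Rplus_le_compat; [exact H1|exact H2]|].
    set (v := / (1 - u)) in *.
    assert (Hv : 0 < v) by (apply Rinv_0_lt_compat; lra).
    (* Convexity of [u |-> (1 - u) ^ -(n + 2)], in the form of Bernoulli's
       inequality. *)
    assert (Hconv : v ^ S (S n) * (1 + INR (S (S n)) * (d * v)) <= (/ (1 - (u + d))) ^ S (S n)).
    { assert (Hq : v * (1 + d * v) <= / (1 - (u + d))).
      { apply (Rmult_le_reg_r (1 - (u + d))); [lra|]; rewrite Rinv_l by lra.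
        assert (Hv1 : v * (1 - u) = 1) by (unfold v; apply Rinv_l; lra).
        replace (v * (1 + d * v) * (1 - (u + d)))
          with (v * (1 - u) + d * v * (v * (1 - u)) - d * v - (d * v) * (d * v)) by ring.
        rewrite Hv1; nra. }
      eapply Rle_trans; [|apply pow_incr; split; [|exact Hq]].
      - rewrite Rpow_mult_distr; apply Rmult_le_compat_l; [apply pow_le; lra|].
        assert (Hdv : 0 <= d * v) by nra.
        generalize (S (S n)); intros m; induction m as [|m IHm]; [simpl; lra|].
        rewrite S_INR; simpl; pose proof (pos_INR m).
        apply (Rmult_le_compat_l (1 + d * v)) in IHm; [|lra].
        assert (0 <= INR m * (d * v) * (d * v)) by (apply Rmult_le_pos; nra); lra.
      - apply Rmult_le_pos; nra. }
    apply (Rmult_le_compat_l (A * INR (fact (S n)) * r ^ n)) in Hconv.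
    2:{ apply Rmult_le_pos; [|now apply pow_le]; apply Rmult_le_pos; [easy|apply pos_INR]. }
    eapply Rle_trans; [|exact Hconv]; right.
    rewrite (fact_simpl (S n)), mult_INR; unfold d; simpl pow; ring.
Qed.

(** Each term of the Taylor series at [0] is dominated along the Euler products
    themselves, so that no expansion of the exponential is needed. *)
Lemma expm_bound_of_Taylor y A r w :
  0 <= A -> 0 <= r -> Cmod w * r <= / 2 ->
  (forall n, N (Nat.iter n B y) <= A * INR (fact (S n)) * r ^ n) ->
  N (expm B w y) <= 4 * A.
Proof.
  intros HA Hr Hw Hy.
  apply (tends_bound HN _ _ _ (euler_tends w y)); exists O; intros j _.
  pose proof (pow_two_pos j) as Hj; apply lt_0_INR in Hj as Hj'.
  assert (E : Cmod (w / INR (2 ^ j)) * INR (2 ^ j) * r = Cmod w * r).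
  { rewrite Cmod_div_INR by easy; field; lra. }
  pose proof (step_iter_bound y A r (w / INR (2 ^ j)) (2 ^ j) 0 HA Hr) as H.
  rewrite E in H; specialize (H ltac:(lra) Hy).
  unfold euler; eapply Rle_trans; [exact H|].
  simpl; rewrite !Rmult_1_r.
  assert (/ (1 - Cmod w * r) <= 2).
  { rewrite <- (Rinv_inv 2); apply Rinv_le_contravar; lra. }
  assert (0 < / (1 - Cmod w * r)) by (apply Rinv_0_lt_compat; lra).
  rewrite (Rmult_comm 4); apply Rmult_le_compat_l; nra.
Qed.

End Exponential.

(** * A sectorial bound for exponentials *)

(** The closed sector of half-angle [atan (1 / (8 K))], vertex included. *)
Definition cone (K : R) (z : C) : Prop := 8 * K * Rabs (Im z) <= Re z.

Section RittExponential.

Context {X : CompleteNormedModule C_AbsRing} {N : X -> R} {M : R}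
  (HN : equivalent_norm N M).

Local Notation expm := (exp_op N).

Context (V : X -> X) (K mu : R) (HV : linear_map V) (HV1 : bounded_by N V 1)
  (HK : 1 <= K) (HR : Ritt_bound N V K) (Hmu : 0 < mu).

Let B (x : X) : X := RtoC mu ⊙ (V x ⊖ x).
Let U (p : R) (x : X) : X := (1 - p)%C ⊙ x ⊕ RtoC p ⊙ V x.

Lemma linear_gen : linear_map B.
Proof.
  split; intros; unfold B; [rewrite (lin_plus _ HV)|rewrite (lin_scal _ HV)]; vec.
Qed.

Lemma bounded_by_gen : bounded_by N B (2 * mu).
Proof.
  intros x; unfold B; rewrite (N_scal HN), Cmod_R, Rabs_pos_eq by lra.
  pose proof (N_minus HN (V x) x); specialize (HV1 x); nra.
Qed.

Lemma linear_U p : linear_map (U p).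
Proof. unfold U; apply (linear_comb _ _ (fun x => x)); [apply linear_id|easy]. Qed.

Lemma bounded_by_U p : 0 <= p <= 1 -> bounded_by N (U p) 1.
Proof.
  intros Hp x; unfold U; eapply Rle_trans; [apply (en_plus _ _ HN)|].
  rewrite !(N_scal HN), <- RtoC_minus, !Cmod_R, !Rabs_pos_eq by lra.
  specialize (HV1 x); nra.
Qed.

(** The map [z |-> z p / (1 - z (1 - p))] sends the unit disc into itself, and
    carries [1 - z U] to [1 - z' V] up to the factor [(1 - z) / (1 - z')]. *)
Lemma Ritt_bound_U p : 0 <= p <= 1 -> Ritt_bound N (U p) K.
Proof.
  intros Hp z x Hz; set (d := (1 - z * (1 - p))%C).
  assert (Hd : Cmod z * p < Cmod d).
  { assert (H : Cmod (1 - d) = Cmod z * (1 - p)).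
    { replace (1 - d)%C with (z * RtoC (1 - p))%C by (unfold d; rewrite RtoC_minus; ring).
      rewrite Cmod_mult, Cmod_R, Rabs_pos_eq; lra. }
    pose proof (Cmod_triangle d (1 - d)) as H2.
    replace (d + (1 - d))%C with (RtoC 1) in H2 by ring.
    rewrite Cmod_1, H in H2; lra. }
  pose proof (Cmod_ge_0 z) as Hz0.
  assert (Hd0 : 0 < Cmod d) by nra.
  assert (Hdn : d <> RtoC 0) by now apply Cmod_gt_0.
  assert (Hz' : Cmod (z * p / d) < 1).
  { unfold Cdiv; rewrite !Cmod_mult, Cmod_inv, Cmod_R, Rabs_pos_eq by easy.
    apply Rlt_div_l; [easy|]; lra. }
  specialize (HR _ x Hz').
  assert (E1 : x ⊖ z ⊙ U p x = d ⊙ (x ⊖ (z * p / d)%C ⊙ V x)).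
  { unfold U; vec_goals; unfold d in *; field; easy. }
  assert (E2 : (1 - z)%C = (d * (1 - z * p / d))%C) by (unfold d in *; field; easy).
  rewrite E1, (N_scal HN), E2, Cmod_mult; nra.
Qed.

(** The Euler step [1 + (t / k) B] is the convex combination [U p] with
    [p = t mu / k], and [U p - 1 = (t / k) B]. *)
Lemma gen_power_estimate n k t x :
  0 < t -> t * mu <= INR k -> K <= INR k ->
  N (Nat.iter n B (Nat.iter k (step B (t / INR k)) x))
  <= 96 * K * INR (fact (S n)) * (4 * K / t) ^ n * N x.
Proof.
  intros Ht Htk HKk; set (p := t * mu / INR k).
  assert (Hk : 0 < INR k) by lra.
  assert (Hp : 0 <= p <= 1).
  { unfold p; split; [apply Rdiv_le_0_compat; nra|apply Rle_div_l; lra]. }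
  pose proof (Ritt_power_estimate HN (U p) K (linear_U p) (bounded_by_U p Hp) HK
                (Ritt_bound_U p Hp) n k x ltac:(lra)) as H.
  assert (Ep : RtoC p = (t / INR k * mu)%C).
  { unfold p, Rdiv; rewrite !RtoC_mult, RtoC_inv by lra; unfold Cdiv; ring. }
  rewrite (iter_ext (U p) (step B (t / INR k)) k) in H.
  2:{ intros y; unfold U, step, B; rewrite Ep; vec. }
  rewrite (iter_ext _ (fun y => (t / INR k)%C ⊙ B y) n) in H.
  2:{ intros y; unfold U, B; rewrite Ep; vec. }
  set (y := Nat.iter k _ x) in *.
  assert (Ei : Nat.iter n (fun y => (t / INR k)%C ⊙ B y) y
               = ((t / INR k) ^ n)%C ⊙ Nat.iter n B y).
  { clear H; induction n as [|n IH]; [simpl; vec|].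
    change (Nat.iter (S n) (fun y => (t / INR k)%C ⊙ B y) y)
      with ((t / INR k)%C ⊙ B (Nat.iter n (fun y => (t / INR k)%C ⊙ B y) y)).
    rewrite IH, (lin_scal _ linear_gen), scalA; reflexivity. }
  rewrite Ei, (N_scal HN), Cmod_Cpow in H.
  unfold Cdiv in H; rewrite Cmod_mult, <- RtoC_inv, !Cmod_R, !Rabs_pos_eq in H
    by (try lra; left; now apply Rinv_0_lt_compat).
  fold (t / INR k) in H.
  assert (Htk0 : 0 < t / INR k) by now apply Rdiv_lt_0_compat.
  apply (Rmult_le_reg_l ((t / INR k) ^ n)); [now apply pow_lt|].
  eapply Rle_trans; [exact H|].
  replace ((t / INR k) ^ n * (96 * K * INR (fact (S n)) * (4 * K / t) ^ n * N x))
    with (96 * K * INR (fact (S n)) * ((t / INR k) ^ n * (4 * K / t) ^ n) * N x) by ring.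
  rewrite <- Rpow_mult_distr; replace (t / INR k * (4 * K / t)) with (4 * K / INR k)
    by (field; lra).
  apply Rmult_le_compat_r; [apply (N_ge0 HN)|].
  apply Rmult_le_compat_l; [apply Rmult_le_pos; [lra|apply pos_INR]|].
  apply pow_incr; split; [apply Rdiv_le_0_compat; lra|].
  apply Rmult_le_compat_l; [lra|]; apply Rinv_le_contravar; lra.
Qed.

Lemma pow_two_exceeds (c : R) : exists j0, forall j, (j0 <= j)%nat -> c <= INR (2 ^ j).
Proof.
  destruct (INR_unbounded c) as [j0 H0]; exists j0; intros j Hj.
  apply le_INR in Hj; rewrite INR_pow_two; pose proof (pow_two_ge j); lra.
Qed.

(** The bound does not depend on [mu]: the condition [t mu <= k] disappears in
    the limit of infinitely many steps. *)
Lemma exp_gen_power n t x :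
  0 < t -> N (Nat.iter n B (expm B t x))
           <= 96 * K * INR (fact (S n)) * (4 * K / t) ^ n * N x.
Proof.
  intros Ht.
  assert (H : tends N (fun j => Nat.iter n B (euler B j t x)) (Nat.iter n B (expm B t x))).
  { apply (tends_linear HN (Nat.iter n B) ((2 * mu) ^ n) (fun j => euler B j t x)).
    - apply linear_iter, linear_gen.
    - apply bounded_by_iter; [lra|apply bounded_by_gen].
    - apply (euler_tends HN B (2 * mu)); [apply linear_gen|lra|apply bounded_by_gen]. }
  apply (tends_bound HN _ _ _ H).
  destruct (pow_two_exceeds (t * mu)) as [j1 H1]; destruct (pow_two_exceeds K) as [j2 H2].
  exists (max j1 j2); intros j Hj; apply gen_power_estimate; auto; [apply H1|apply H2]; lia.
Qed.

Lemma exp_gen_contraction t : 0 <= t -> bounded_by N (expm B t) 1.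
Proof.
  intros Ht x.
  assert (H : tends N (fun j => euler B j t x) (expm B t x)).
  { apply (euler_tends HN B (2 * mu)); [apply linear_gen|lra|apply bounded_by_gen]. }
  apply (tends_bound HN _ _ _ H).
  destruct (pow_two_exceeds (t * mu)) as [j1 H1]; exists j1; intros j Hj; unfold euler.
  specialize (H1 j Hj); pose proof (pow_two_pos j) as Hp; apply lt_0_INR in Hp.
  rewrite (iter_ext _ (U (t * mu / INR (2 ^ j)))).
  - apply contraction_iter, bounded_by_U.
    split; [apply Rdiv_le_0_compat; nra|apply Rle_div_l; lra].
  - intros y; unfold U, step, B, Rdiv; rewrite !RtoC_mult, RtoC_inv by lra.
    unfold Cdiv; vec.
Qed.

(** The Taylor series of [exp (i s B)] applied to [exp (t B) x] converges for
    [|s| < t / (4 K)]; half of this radius gives the factor [4]. *)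
Lemma exp_gen_cone z : cone K z -> bounded_by N (expm B z) (384 * K).
Proof.
  intros Hz x; unfold cone in Hz.
  destruct z as [t s]; simpl in Hz.
  pose proof (Rabs_pos s) as Hs.
  assert (Hs' : 0 <= 8 * K * Rabs s) by (apply Rmult_le_pos; lra).
  destruct (Req_dec t 0) as [->|Ht].
  - replace (0, s) with (RtoC 0).
    + rewrite (expm_0 HN B (2 * mu)) by (try apply linear_gen; try apply bounded_by_gen; lra).
      pose proof (N_ge0 HN x); nra.
    + unfold RtoC; f_equal; symmetry; apply Rabs_eq_0; nra.
  - assert (Ht' : 0 < t) by lra.
    replace (t, s) with ((0, s) + RtoC t)%C by (unfold Cplus, RtoC; simpl; f_equal; ring).
    rewrite (expm_plus HN B (2 * mu)) by (try apply linear_gen; try apply bounded_by_gen; lra).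
    replace (384 * K * N x) with (4 * (96 * K * N x)) by ring.
    assert (HNx := N_ge0 HN x).
    apply (expm_bound_of_Taylor HN B (2 * mu)) with (r := 4 * K / t);
      [apply linear_gen|lra|apply bounded_by_gen|nra|apply Rdiv_le_0_compat; lra| |].
    + replace (Cmod (0, s)) with (Rabs s).
      * replace (Rabs s * (4 * K / t)) with (4 * K * Rabs s / t) by (field; lra).
        apply Rle_div_l; lra.
      * unfold Cmod; simpl; replace (0 * (0 * 1) + s * (s * 1)) with (s²) by (unfold Rsqr; ring).
        symmetry; apply sqrt_Rsqr_abs.
    + intros n; eapply Rle_trans; [now apply exp_gen_power|]; right; ring.
Qed.

End RittExponential.

(** * Generators of contraction semigroups *)

Section Generator.

Context {X : CompleteNormedModule C_AbsRing}.
Implicit Types (x y z w v : X).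

(** The graph of the generator, as a relation between [x] and [w]. *)
Definition right_derivative (N : X -> R) (T : R -> X -> X) (x w : X) : Prop :=
  forall eps, 0 < eps -> exists d, 0 < d /\
    forall h, 0 < h < d -> N (T h x ⊖ x ⊖ RtoC h ⊙ w) <= eps * h.

Record contraction_semigroup (N : X -> R) (T : R -> X -> X) : Prop := {
  cs_linear : forall t, 0 <= t -> linear_map (T t);
  cs_0 : forall x, T 0 x = x;
  cs_plus : forall t s x, 0 <= t -> 0 <= s -> T (t + s) x = T t (T s x);
  cs_contraction : forall t, 0 <= t -> bounded_by N (T t) 1;
  cs_continuous : forall x eps, 0 < eps -> exists d, 0 < d /\
    forall h, 0 <= h < d -> N (T h x ⊖ x) <= eps
}.

Definition surjective_resolvent (N : X -> R) (T : R -> X -> X) (l : C) : Prop :=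
  forall y, exists x w, right_derivative N T x w /\ l ⊙ x ⊖ w = y.

(** The operator [mu (mu - A)^-1]: its value [v] at [y] lies in the domain of
    [A] and satisfies [A v = mu (v - y)]. *)
Definition yosida_op (N : X -> R) (T : R -> X -> X) (mu : R) (y : X) : X :=
  iota (fun v => right_derivative N T v (RtoC mu ⊙ (v ⊖ y))).

Context {N : X -> R} {M : R} (HN : equivalent_norm N M).
Context {T : R -> X -> X} (HT : contraction_semigroup N T).

Local Notation gen := (right_derivative N T).
Local Notation surjective := (surjective_resolvent N T).
Local Notation yosida := (yosida_op N T).

Lemma gen_plus x1 w1 x2 w2 : gen x1 w1 -> gen x2 w2 -> gen (x1 ⊕ x2) (w1 ⊕ w2).
Proof.
  intros H1 H2 eps Heps.
  destruct (H1 (eps / 2)) as [d1 [Hd1 H1']]; [lra|].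
  destruct (H2 (eps / 2)) as [d2 [Hd2 H2']]; [lra|].
  exists (Rmin d1 d2); split; [now apply Rmin_pos|]; intros h Hh.
  pose proof (Rmin_l d1 d2); pose proof (Rmin_r d1 d2).
  specialize (H1' h ltac:(lra)); specialize (H2' h ltac:(lra)).
  rewrite (lin_plus _ (cs_linear _ _ HT h ltac:(lra))).
  replace (T h x1 ⊕ T h x2 ⊖ (x1 ⊕ x2) ⊖ RtoC h ⊙ (w1 ⊕ w2))
    with ((T h x1 ⊖ x1 ⊖ RtoC h ⊙ w1) ⊕ (T h x2 ⊖ x2 ⊖ RtoC h ⊙ w2)) by vec.
  eapply Rle_trans; [apply (en_plus _ _ HN)|]; lra.
Qed.

Lemma gen_map (P : X -> X) p x w :
  linear_map P -> bounded_by N P p -> (forall t y, 0 <= t -> T t (P y) = P (T t y)) ->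
  gen x w -> gen (P x) (P w).
Proof.
  intros HP HPb Hc H eps Heps.
  assert (Hp : 0 < Rabs p + 1) by (pose proof (Rabs_pos p); lra).
  destruct (H (eps / (Rabs p + 1))) as [d [Hd H']]; [now apply Rdiv_lt_0_compat|].
  exists d; split; [easy|]; intros h Hh; specialize (H' h Hh).
  rewrite Hc, <- (lin_scal _ HP), <- !(lin_minus _ HP) by lra.
  eapply Rle_trans; [apply HPb|].
  set (n := N _) in *; assert (0 <= n) by apply (N_ge0 HN).
  assert (H1 : (Rabs p + 1) * n <= eps * h).
  { apply (Rmult_le_compat_l (Rabs p + 1)) in H'; [|lra].
    replace ((Rabs p + 1) * (eps / (Rabs p + 1) * h)) with (eps * h) in H' by (field; lra).
    easy. }
  pose proof (Rle_abs p); nra.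
Qed.

Lemma gen_scal (a : C) x w : gen x w -> gen (a ⊙ x) (a ⊙ w).
Proof.
  apply (gen_map (fun y => a ⊙ y) (Cmod a)).
  - split; intros; vec.
  - intros y; rewrite (N_scal HN); lra.
  - intros t y Ht; now rewrite (lin_scal _ (cs_linear _ _ HT t Ht)).
Qed.

Lemma gen_minus x1 w1 x2 w2 : gen x1 w1 -> gen x2 w2 -> gen (x1 ⊖ x2) (w1 ⊖ w2).
Proof.
  intros H1 H2.
  replace (x1 ⊖ x2) with (x1 ⊕ (-1)%C ⊙ x2) by vec.
  replace (w1 ⊖ w2) with (w1 ⊕ (-1)%C ⊙ w2) by vec.
  now apply gen_plus; [|apply gen_scal].
Qed.

Lemma T_comm t s x : 0 <= t -> 0 <= s -> T t (T s x) = T s (T t x).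
Proof. intros; rewrite <- !(cs_plus _ _ HT) by easy; f_equal; ring. Qed.

Lemma gen_T t x w : 0 <= t -> gen x w -> gen (T t x) (T t w).
Proof.
  intros Ht; apply (gen_map (T t) 1).
  - now apply (cs_linear _ _ HT).
  - now apply (cs_contraction _ _ HT).
  - intros; now apply T_comm.
Qed.

(** [(1 + l h) x] is [T h x + h (l x - w)] up to [o(h)], and [T h] contracts. *)
Lemma gen_dissipative (l : C) x w : gen x w -> Re l * N x <= N (l ⊙ x ⊖ w).
Proof.
  intros H; apply le_epsilon; intros eps Heps.
  destruct (H eps Heps) as [d [Hd H']].
  set (h := d / 2); assert (Hh : 0 < h) by (unfold h; lra).
  specialize (H' h ltac:(unfold h; lra)).
  set (e := T h x ⊖ x ⊖ RtoC h ⊙ w) in *.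
  assert (E : (1 + h * l)%C ⊙ x = T h x ⊕ RtoC h ⊙ (l ⊙ x ⊖ w) ⊖ e) by (unfold e; vec).
  apply (f_equal N) in E; rewrite (N_scal HN) in E.
  pose proof (N_minus HN (T h x ⊕ RtoC h ⊙ (l ⊙ x ⊖ w)) e) as H1.
  pose proof (en_plus _ _ HN (T h x) (RtoC h ⊙ (l ⊙ x ⊖ w))) as H2.
  rewrite (N_scal HN), Cmod_R, Rabs_pos_eq in H2 by lra.
  pose proof (cs_contraction _ _ HT h ltac:(lra) x) as H3.
  assert (Hm : 1 + h * Re l <= Cmod (1 + h * l)).
  { pose proof (re_le_Cmod (1 + h * l)) as Hr.
    replace (Re (1 + h * l)) with (1 + h * Re l) in Hr
      by (destruct l; unfold Re; simpl; ring).
    pose proof (Rle_abs (1 + h * Re l)); lra. }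
  pose proof (N_ge0 HN x).
  apply (Rmult_le_reg_l h); [easy|]; nra.
Qed.

(** * The resolvent in the right half-plane *)

(** The equation [l x - w = y] is solved by the fixed point of
    [x |-> (l0 - A)^-1 (y + (l0 - l) x)]. *)
Lemma surjective_near (l0 l : C) (beta : R) :
  surjective l0 -> 0 < beta ->
  (forall x w, gen x w -> beta * N x <= N (l0 ⊙ x ⊖ w)) ->
  Cmod (l - l0) < beta -> surjective l.
Proof.
  intros Hs Hb Hlow Hl y.
  assert (HR : forall z, exists x, exists w, gen x w /\ l0 ⊙ x ⊖ w = z) by exact Hs.
  set (Rf := fun z => proj1_sig (constructive_indefinite_description _ (HR z))).
  assert (HRf : forall z, exists w, gen (Rf z) w /\ l0 ⊙ Rf z ⊖ w = z)
    by (intros z; exact (proj2_sig (constructive_indefinite_description _ (HR z)))).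
  assert (HLip : forall z1 z2, beta * N (Rf z1 ⊖ Rf z2) <= N (z1 ⊖ z2)).
  { intros z1 z2; destruct (HRf z1) as [w1 [Hg1 E1]]; destruct (HRf z2) as [w2 [Hg2 E2]].
    eapply Rle_trans; [apply Hlow, (gen_minus _ _ _ _ Hg1 Hg2)|]; right.
    rewrite <- E1 at 2; rewrite <- E2 at 2; f_equal; vec. }
  set (f := fun x => Rf (y ⊕ (l0 - l)%C ⊙ x)).
  set (q := Cmod (l - l0) / beta).
  assert (Hq : 0 <= q < 1).
  { unfold q; split; [apply Rdiv_le_0_compat; [apply Cmod_ge_0|easy]|].
    apply Rlt_div_l; lra. }
  assert (Hf : forall x1 x2, N (f x1 ⊖ f x2) <= q * N (x1 ⊖ x2)).
  { intros x1 x2; unfold f.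
    pose proof (HLip (y ⊕ (l0 - l)%C ⊙ x1) (y ⊕ (l0 - l)%C ⊙ x2)) as H.
    replace (y ⊕ (l0 - l)%C ⊙ x1 ⊖ (y ⊕ (l0 - l)%C ⊙ x2))
      with ((l0 - l)%C ⊙ (x1 ⊖ x2)) in H by vec.
    rewrite (N_scal HN) in H.
    replace (Cmod (l0 - l)) with (Cmod (l - l0)) in H
      by (rewrite <- Cmod_opp; f_equal; ring).
    unfold q; apply (Rmult_le_reg_l beta); [easy|].
    replace (beta * (Cmod (l - l0) / beta * N (x1 ⊖ x2)))
      with (Cmod (l - l0) * N (x1 ⊖ x2)) by (field; lra); easy. }
  destruct (tends_geometric HN (fun n => Nat.iter n f vzero) (N (f vzero ⊖ vzero)) q Hq)
    as [x [Hx _]].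
  { intros n; induction n as [|n IH]; [simpl; lra|].
    change (N (f (Nat.iter (S n) f vzero) ⊖ f (Nat.iter n f vzero))
            <= N (f vzero ⊖ vzero) * (q * q ^ n)).
    eapply Rle_trans; [apply Hf|].
    apply (Rmult_le_compat_l q) in IH; [|easy]; lra. }
  assert (Ex : f x = x).
  { apply (tends_unique HN (fun n => Nat.iter (S n) f vzero)).
    - intros eps Heps; destruct (Hx eps Heps) as [n0 H0]; exists n0; intros n Hn.
      eapply Rle_trans; [exact (Hf (Nat.iter n f vzero) x)|].
      specialize (H0 n Hn); cbv beta in H0; pose proof (N_ge0 HN (Nat.iter n f vzero ⊖ x)); nra.
    - intros eps Heps; destruct (Hx eps Heps) as [n0 H0]; exists n0; intros n Hn.
      apply H0; lia. }
  destruct (HRf (y ⊕ (l0 - l)%C ⊙ x)) as [w [Hg E]].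
  fold (f x) in Hg, E; rewrite Ex in Hg, E.
  exists x, w; split; [easy|].
  replace (l ⊙ x ⊖ w) with ((l0 ⊙ x ⊖ w) ⊖ (l0 - l)%C ⊙ x) by vec.
  rewrite E; vec.
Qed.

Context (K : R) (HK : 1 <= K)
  (Hsurj : forall s, s <> 0 -> surjective (0, s))
  (Hlow : forall s x w, s <> 0 -> gen x w ->
     Rabs s * N x <= K * N ((0, s) ⊙ x ⊖ w)).

Lemma Cmod_lt_of_sqr (z : C) r :
  0 <= r -> Re z * Re z + Im z * Im z < r * r -> Cmod z < r.
Proof.
  intros Hr H; apply Rsqr_incrst_0; [|apply Cmod_ge_0|easy].
  rewrite Cmod_sqr; exact H.
Qed.

(** From [i] one moves to the right of the axis, then increases the abscissa
    until the disc in which the perturbation argument applies contains [l]. *)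
Lemma surjective_right (l : C) : 0 < Re l -> surjective l.
Proof.
  intros Hl.
  assert (Hdis : forall (a b : R) x w, gen x w -> a * N x <= N ((a, b) ⊙ x ⊖ w)).
  { intros a b x w Hg; exact (gen_dissipative (a, b) x w Hg). }
  assert (HK' : 0 < / (2 * K)) by (apply Rinv_0_lt_compat; lra).
  assert (H1 : surjective (/ (2 * K), 1)).
  { apply (surjective_near (0, 1) _ (/ K)).
    - apply Hsurj; lra.
    - apply Rinv_0_lt_compat; lra.
    - intros x w Hg; pose proof (Hlow 1 x w ltac:(lra) Hg) as H.
      rewrite Rabs_R1 in H; apply (Rmult_le_reg_l K); [lra|].
      rewrite <- Rmult_assoc, Rinv_r by lra; easy.
    - apply Cmod_lt_of_sqr; [left; apply Rinv_0_lt_compat; lra|].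
      unfold Re, Im; simpl; rewrite Rinv_mult.
      assert (0 < / K) by (apply Rinv_0_lt_compat; lra); nra. }
  assert (H2 : forall n, surjective ((3 / 2) ^ n * / (2 * K), 1)).
  { induction n as [|n IH]; [now rewrite pow_O, Rmult_1_l|].
    assert (Hp : 0 < (3 / 2) ^ n * / (2 * K)) by (apply Rmult_lt_0_compat; [apply pow_lt; lra|easy]).
    apply (surjective_near _ _ ((3 / 2) ^ n * / (2 * K)) IH Hp); [apply Hdis|].
    apply Cmod_lt_of_sqr; [lra|]; unfold Re, Im; simpl; nra. }
  destruct l as [a b]; unfold Re in Hl; simpl in Hl.
  set (c := (a * a + (b - 1) * (b - 1)) / (2 * a) + 1).
  destruct (INR_unbounded (2 * (c * (2 * K)))) as [n Hn].
  set (r := (3 / 2) ^ n * / (2 * K)).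
  assert (Hr : c <= r).
  { unfold r; pose proof (poly n (/ 2) ltac:(lra)) as H.
    replace (1 + / 2) with (3 / 2) in H by lra.
    apply (Rmult_le_reg_r (2 * K)); [lra|].
    rewrite Rmult_assoc, Rinv_l by lra; lra. }
  assert (Hc : a * a + (b - 1) * (b - 1) < 2 * a * c).
  { unfold c; replace (2 * a * ((a * a + (b - 1) * (b - 1)) / (2 * a) + 1))
      with (a * a + (b - 1) * (b - 1) + 2 * a) by (field; lra); lra. }
  assert (Hr0 : 0 < r) by (apply Rmult_lt_0_compat; [apply pow_lt; lra|easy]).
  apply (surjective_near (r, 1) _ r (H2 n) Hr0); [apply Hdis|].
  apply Cmod_lt_of_sqr; [lra|]; unfold Re, Im; simpl; nra.
Qed.

(** Near the imaginary axis this comes from the hypothesis on the axis, and in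
    the remaining sector from dissipativity. *)
Lemma gen_sectorial (l : C) x w :
  0 < Re l -> gen x w -> Cmod l * N x <= 3 * K * N (l ⊙ x ⊖ w).
Proof.
  intros Hl Hg; pose proof (gen_dissipative l x w Hg) as Hd.
  destruct l as [a s]; unfold Re in *; simpl in *.
  set (y := (a, s) ⊙ x ⊖ w) in *.
  pose proof (N_ge0 HN x) as Hx; pose proof (N_ge0 HN y) as Hy.
  assert (Hm : Cmod (a, s) <= a + Rabs s).
  { replace (a, s) with (RtoC a + (0, s))%C
      by (unfold RtoC, Cplus; simpl; f_equal; ring).
    eapply Rle_trans; [apply Cmod_triangle|].
    rewrite Cmod_R, Rabs_pos_eq by lra; apply Rplus_le_compat_l.
    unfold Cmod; simpl; replace (0 * (0 * 1) + s * (s * 1)) with (s²) by (unfold Rsqr; ring).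
    rewrite sqrt_Rsqr_abs; apply Rle_refl. }
  destruct (Rle_lt_dec (2 * K * a) (Rabs s)) as [Hs|Hs].
  - assert (Hs0 : s <> 0) by (intros ->; rewrite Rabs_R0 in Hs; nra).
    pose proof (Hlow s x w Hs0 Hg) as H.
    replace ((0, s) ⊙ x ⊖ w) with (y ⊖ RtoC a ⊙ x) in H.
    + pose proof (N_minus HN y (RtoC a ⊙ x)) as H1.
      rewrite (N_scal HN), Cmod_R, Rabs_pos_eq in H1 by lra.
      assert (H2 : Rabs s * N x <= K * N y + K * a * N x) by nra.
      assert (K * a * N x <= Rabs s / 2 * N x) by (apply Rmult_le_compat_r; lra).
      assert (a <= Rabs s / 2) by nra.
      nra.
    + unfold y; replace ((0, s) : C) with ((a, s) - a)%C; [vec|].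
      unfold Cminus, Cplus, Copp; simpl; f_equal; ring.
  - assert (Cmod (a, s) <= 3 * K * a) by nra.
    apply Rle_trans with (3 * K * (a * N x)); nra.
Qed.

(** * Yosida approximation *)

Lemma yosida_unique mu y v1 v2 :
  0 < mu -> gen v1 (RtoC mu ⊙ (v1 ⊖ y)) -> gen v2 (RtoC mu ⊙ (v2 ⊖ y)) -> v1 = v2.
Proof.
  intros Hmu H1 H2; pose proof (gen_minus _ _ _ _ H1 H2) as H.
  apply (gen_dissipative mu) in H.
  replace (RtoC mu ⊙ (v1 ⊖ v2) ⊖ (RtoC mu ⊙ (v1 ⊖ y) ⊖ RtoC mu ⊙ (v2 ⊖ y)))
    with (vzero : X) in H by vec.
  rewrite (N_zero HN) in H; simpl in H.
  apply (N_separates HN); intros eps Heps.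
  pose proof (N_ge0 HN (v1 ⊖ v2)); nra.
Qed.

Lemma yosida_gen mu y : 0 < mu -> gen (yosida mu y) (RtoC mu ⊙ (yosida mu y ⊖ y)).
Proof.
  intros Hmu; apply (iota_correct (fun v => gen v (RtoC mu ⊙ (v ⊖ y)))).
  destruct (surjective_right mu Hmu y) as [x [w [Hg E]]].
  assert (Hv : gen (RtoC mu ⊙ x) (RtoC mu ⊙ (RtoC mu ⊙ x ⊖ y))).
  { apply (gen_scal mu) in Hg; rewrite <- E.
    replace (RtoC mu ⊙ x ⊖ (RtoC mu ⊙ x ⊖ w)) with w by vec; easy. }
  exists (RtoC mu ⊙ x); split; [easy|].
  intros v Hv2; now apply (yosida_unique mu y).
Qed.

Lemma yosida_eq mu y v : 0 < mu -> gen v (RtoC mu ⊙ (v ⊖ y)) -> yosida mu y = v.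
Proof. intros Hmu H; apply (yosida_unique mu y); [easy|now apply yosida_gen|easy]. Qed.

Lemma linear_yosida mu : 0 < mu -> linear_map (yosida mu).
Proof.
  intros Hmu; split.
  - intros x y; apply yosida_eq; [easy|].
    replace (RtoC mu ⊙ (yosida mu x ⊕ yosida mu y ⊖ (x ⊕ y)))
      with (RtoC mu ⊙ (yosida mu x ⊖ x) ⊕ RtoC mu ⊙ (yosida mu y ⊖ y)) by vec.
    now apply gen_plus; apply yosida_gen.
  - intros a x; apply yosida_eq; [easy|].
    replace (RtoC mu ⊙ (a ⊙ yosida mu x ⊖ a ⊙ x))
      with (a ⊙ RtoC mu ⊙ (yosida mu x ⊖ x)) by vec.
    now apply gen_scal, yosida_gen.
Qed.

Lemma yosida_contraction mu : 0 < mu -> bounded_by N (yosida mu) 1.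
Proof.
  intros Hmu y; pose proof (gen_dissipative mu _ _ (yosida_gen mu y Hmu)) as H.
  replace (RtoC mu ⊙ yosida mu y ⊖ RtoC mu ⊙ (yosida mu y ⊖ y)) with (RtoC mu ⊙ y) in H by vec.
  rewrite (N_scal HN), Cmod_R, Rabs_pos_eq in H by lra; simpl in H.
  apply (Rmult_le_reg_l mu); lra.
Qed.

Lemma yosida_of_gen mu x w :
  0 < mu -> gen x w -> yosida mu w = RtoC mu ⊙ (yosida mu x ⊖ x).
Proof.
  intros Hmu Hg; apply yosida_eq; [easy|].
  apply gen_scal, gen_minus; [now apply yosida_gen|easy].
Qed.

Lemma yosida_comm_T mu t y : 0 < mu -> 0 <= t -> yosida mu (T t y) = T t (yosida mu y).
Proof.
  intros Hmu Ht; apply yosida_eq; [easy|].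
  pose proof (cs_linear _ _ HT t Ht) as HL.
  rewrite <- (lin_minus _ HL), <- (lin_scal _ HL).
  now apply gen_T, yosida_gen.
Qed.

Lemma yosida_comm mu nu y :
  0 < mu -> 0 < nu -> yosida mu (yosida nu y) = yosida nu (yosida mu y).
Proof.
  intros Hmu Hnu; apply yosida_eq; [easy|].
  pose proof (linear_yosida nu Hnu) as HL.
  rewrite <- (lin_minus _ HL), <- (lin_scal _ HL).
  apply (gen_map (yosida nu) 1); [easy|now apply yosida_contraction| |now apply yosida_gen].
  intros t z Ht; symmetry; now apply yosida_comm_T.
Qed.

(** With [l = mu (1 - z)], one has [(1 - z V)^-1 = 1 + z mu (l - A)^-1]. *)
Lemma yosida_Ritt mu : 0 < mu -> Ritt_bound N (yosida mu) (5 * K).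
Proof.
  intros Hmu z x Hz; set (v := yosida mu x); set (y := x ⊖ z ⊙ v).
  assert (Hre : 0 < Re (mu * (1 - z))).
  { pose proof (re_le_Cmod z); pose proof (Rle_abs (Re z)).
    destruct z as [a b]; unfold Re in *; simpl in *; nra. }
  pose proof (gen_sectorial _ _ _ Hre (yosida_gen mu x Hmu)) as H.
  fold v in H.
  replace ((mu * (1 - z))%C ⊙ v ⊖ RtoC mu ⊙ (v ⊖ x)) with (RtoC mu ⊙ y) in H
    by (unfold y; vec).
  rewrite Cmod_mult, (N_scal HN), Cmod_R, Rabs_pos_eq in H by lra.
  assert (H1 : Cmod (1 - z) * N v <= 3 * K * N y) by (apply (Rmult_le_reg_l mu); nra).
  assert (H2 : N x <= N y + N v).
  { replace x with (y ⊕ z ⊙ v) at 1 by (unfold y; vec).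
    eapply Rle_trans; [apply (en_plus _ _ HN)|]; rewrite (N_scal HN).
    pose proof (N_ge0 HN v); nra. }
  assert (H3 : Cmod (1 - z) <= 2).
  { pose proof (Cmod_triangle 1 (- z)) as H3; rewrite Cmod_opp, Cmod_1 in H3.
    unfold Cminus; lra. }
  pose proof (Cmod_ge_0 (1 - z)); pose proof (N_ge0 HN y).
  apply (Rmult_le_compat_l (Cmod (1 - z))) in H2; [|easy]; nra.
Qed.

(** The mean value inequality for orbits, obtained by subdivision, takes the
    place of the integral of the orbit. *)
Lemma gen_increment y w tau delta :
  gen y w -> 0 < tau ->
  (forall s, 0 <= s <= tau -> N (T s w ⊖ w) <= delta) ->
  N (T tau y ⊖ y ⊖ RtoC tau ⊙ w) <= tau * delta.
Proof.
  intros Hg Htau Hdelta; apply le_epsilon; intros eps Heps.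
  destruct (Hg (eps / tau)) as [d [Hd H]]; [now apply Rdiv_lt_0_compat|].
  destruct (INR_unbounded (tau / d)) as [k Hk].
  assert (Hk0 : 0 < INR k) by (assert (0 < tau / d) by (now apply Rdiv_lt_0_compat); lra).
  set (h := tau / INR k); assert (Hh : 0 < h) by now apply Rdiv_lt_0_compat.
  assert (Hhd : h < d).
  { apply Rlt_div_l in Hk; [|easy]; unfold h; apply Rlt_div_l; lra. }
  specialize (H h ltac:(lra)).
  assert (Hind : forall j, (j <= k)%nat ->
    N (T (INR j * h) y ⊖ y ⊖ RtoC (INR j * h) ⊙ w) <= INR j * h * (delta + eps / tau)).
  { induction j as [|j IH]; intros Hj.
    - simpl; rewrite Rmult_0_l, (cs_0 _ _ HT).
      replace (_ ⊖ _) with (vzero : X) by vec; rewrite (N_zero HN); lra.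
    - specialize (IH ltac:(lia)); pose proof (pos_INR j) as Hj0.
      assert (Hjh : 0 <= INR j * h) by nra.
      assert (Hjt : INR j * h <= tau).
      { assert (Hjk : INR j <= INR k) by (apply le_INR; lia).
        replace tau with (INR k * h) by (unfold h; field; lra); nra. }
      rewrite S_INR; replace ((INR j + 1) * h) with (INR j * h + h) by ring.
      rewrite (cs_plus _ _ HT) by lra.
      pose proof (cs_linear _ _ HT _ Hjh) as HL.
      replace (T (INR j * h) (T h y) ⊖ y ⊖ RtoC (INR j * h + h) ⊙ w)
        with ((T (INR j * h) y ⊖ y ⊖ RtoC (INR j * h) ⊙ w)
              ⊕ (T (INR j * h) (T h y ⊖ y ⊖ RtoC h ⊙ w)
                 ⊕ RtoC h ⊙ (T (INR j * h) w ⊖ w))).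
      2:{ rewrite !(lin_minus _ HL), (lin_scal _ HL), RtoC_plus; vec. }
      eapply Rle_trans; [apply (en_plus _ _ HN)|].
      pose proof (en_plus _ _ HN (T (INR j * h) (T h y ⊖ y ⊖ RtoC h ⊙ w))
                    (RtoC h ⊙ (T (INR j * h) w ⊖ w))) as H1.
      rewrite (N_scal HN), Cmod_R, Rabs_pos_eq in H1 by lra.
      pose proof (cs_contraction _ _ HT _ Hjh (T h y ⊖ y ⊖ RtoC h ⊙ w)) as H2.
      specialize (Hdelta (INR j * h) ltac:(lra)); nra. }
  specialize (Hind k (le_n _)).
  replace (INR k * h) with tau in Hind by (unfold h; field; lra).
  replace (tau * delta + eps) with (tau * (delta + eps / tau)) by (field; lra); easy.
Qed.

(** [A] applied to [y = (mu - A)^-1 x] is estimated by the increment of the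
    orbit of [y] over a short fixed time, while [y] itself tends to [0]. *)
Lemma yosida_tends x : tends N (fun n => yosida (INR n + 1) x) x.
Proof.
  intros eps Heps.
  destruct (cs_continuous _ _ HT x (eps / 4) ltac:(lra)) as [d [Hd Hc]].
  set (tau := d / 2); assert (Htau : 0 < tau) by (unfold tau; lra).
  destruct (INR_unbounded (4 * N x / (tau * eps))) as [n0 Hn0].
  exists n0; intros n Hn; apply le_INR in Hn; pose proof (pos_INR n).
  set (mu := INR n + 1); assert (Hmu : 0 < mu) by (unfold mu; lra).
  pose proof (linear_yosida mu Hmu) as HL.
  set (y := (/ mu)%C ⊙ yosida mu x).
  set (w := yosida mu x ⊖ x).
  assert (Hmu0 : RtoC mu <> RtoC 0) by (intros [= E]; lra).
  assert (Hg : gen y w).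
  { pose proof (gen_scal (/ mu)%C _ _ (yosida_gen mu x Hmu)) as H1.
    rewrite scalA, Cinv_l, scal1 in H1 by easy; exact H1. }
  pose proof (gen_increment y w tau (eps / 2) Hg Htau) as H1.
  assert (H2 : forall s, 0 <= s <= tau -> N (T s w ⊖ w) <= eps / 2).
  { intros s Hs; specialize (Hc s ltac:(unfold tau in *; lra)).
    replace (T s w ⊖ w) with (yosida mu (T s x ⊖ x) ⊖ (T s x ⊖ x)).
    - pose proof (N_minus HN (yosida mu (T s x ⊖ x)) (T s x ⊖ x)) as H2.
      pose proof (yosida_contraction mu Hmu (T s x ⊖ x)); lra.
    - unfold w; rewrite (lin_minus _ HL), yosida_comm_T by lra.
      rewrite (lin_minus _ (cs_linear _ _ HT s ltac:(lra))); vec. }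
  specialize (H1 H2).
  assert (Hy : N y <= N x / mu).
  { unfold y; rewrite (N_scal HN), <- RtoC_inv, Cmod_R, Rabs_pos_eq
      by (try lra; left; now apply Rinv_0_lt_compat).
    pose proof (yosida_contraction mu Hmu x).
    assert (0 < / mu) by now apply Rinv_0_lt_compat.
    unfold Rdiv; nra. }
  assert (Hx : N x / mu <= tau * eps / 4).
  { apply Rlt_div_l in Hn0; [|nra]; apply Rle_div_l; [easy|].
    assert (INR n0 * (tau * eps) <= mu * (tau * eps))
      by (apply Rmult_le_compat_r; unfold mu; nra); nra. }
  pose proof (cs_contraction _ _ HT tau ltac:(lra) y) as H3.
  assert (E : RtoC tau ⊙ w = (T tau y ⊖ y) ⊖ (T tau y ⊖ y ⊖ RtoC tau ⊙ w)) by vec.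
  apply (f_equal N) in E; rewrite (N_scal HN), Cmod_R, Rabs_pos_eq in E by lra.
  pose proof (N_minus HN (T tau y ⊖ y) (T tau y ⊖ y ⊖ RtoC tau ⊙ w)) as H4.
  pose proof (N_minus HN (T tau y) y) as H5.
  apply (Rmult_le_reg_l tau); [easy|]; fold w; lra.
Qed.

Lemma gen_dense : dense N (fun x => exists w, gen x w).
Proof.
  intros x eps Heps; destruct (yosida_tends x eps Heps) as [n H].
  exists (yosida (INR n + 1) x); split.
  - exists (RtoC (INR n + 1) ⊙ (yosida (INR n + 1) x ⊖ x)).
    apply yosida_gen; pose proof (pos_INR n); lra.
  - rewrite (N_minus_sym HN); apply H; lia.
Qed.

End Generator.

(** * Increments of exponentials bounded on a cone *)

Lemma cone_plus K z w : 0 <= K -> cone K z -> cone K w -> cone K (z + w).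
Proof.
  unfold cone; intros HK Hz Hw; destruct z as [a b], w as [c d]; unfold Re, Im in *; simpl in *.
  pose proof (Rabs_triang b d); nra.
Qed.

Lemma cone_scal K r z : 0 <= r -> cone K z -> cone K (r * z).
Proof.
  unfold cone; intros Hr Hz; destruct z as [a b]; unfold Re, Im in *; simpl in *.
  replace (r * b + 0 * a) with (r * b) by ring; replace (r * a - 0 * b) with (r * a) by ring.
  rewrite Rabs_mult, (Rabs_pos_eq r) by easy; nra.
Qed.

Lemma cone_segment K r z h :
  0 <= K -> 0 <= r <= 1 -> cone K z -> cone K (z + h) -> cone K (z + r * h).
Proof.
  intros HK Hr Hz Hzh.
  replace (z + r * h)%C with (RtoC (1 - r) * z + r * (z + h))%C by (rewrite RtoC_minus; ring).
  apply cone_plus; [easy| |]; apply cone_scal; easy || lra.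
Qed.

Lemma cone_real K t : 0 <= t -> cone K t.
Proof. intros Ht; unfold cone; simpl; rewrite Rabs_R0; lra. Qed.

Lemma RtoC_neq_0 r : r <> 0 -> RtoC r <> RtoC 0.
Proof. intros Hr E; now apply Hr, RtoC_inj. Qed.

Section ConeExponential.

Context {X : CompleteNormedModule C_AbsRing} {N : X -> R} {M : R}
  (HN : equivalent_norm N M).

Local Notation expm := (exp_op N).

Context (K c : R) (HK : 0 <= K) (Hc : 0 <= c).

Lemma div_INR_pos k : (0 < k)%nat -> 0 < / INR k.
Proof. intros Hk; apply Rinv_0_lt_compat; now apply lt_0_INR. Qed.

Lemma expm_small_step (B : X -> X) b k (h : C) x :
  linear_map B -> 0 <= b -> bounded_by N B b -> (0 < k)%nat ->
  N (expm B (h / INR k) x ⊖ (x ⊕ (h / INR k)%C ⊙ B x))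
  <= exp (Cmod h * b) * (Cmod h * b)² * N x * (/ INR k * / INR k).
Proof.
  intros HB Hb HBb Hk; pose proof (div_INR_pos k Hk) as Hk'.
  eapply Rle_trans; [apply (expm_first_order HN B b); easy|].
  rewrite Cmod_div_INR by easy.
  assert (Hh : 0 <= Cmod h * b) by (apply Rmult_le_pos; [apply Cmod_ge_0|easy]).
  replace (Cmod h / INR k * b) with (Cmod h * b * / INR k)
    by (unfold Rdiv; ring).
  replace (exp (Cmod h * b) * (Cmod h * b)² * N x * (/ INR k * / INR k))
    with (exp (Cmod h * b) * (Cmod h * b * / INR k)² * N x) by (unfold Rsqr; ring).
  apply Rmult_le_compat_r; [apply (N_ge0 HN)|].
  apply Rmult_le_compat_r; [apply Rle_0_sqr|].
  apply exp_le.
  assert (/ INR k <= 1).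
  { rewrite <- Rinv_1; apply Rinv_le_contravar; [lra|]; apply (le_INR 1); lia. }
  nra.
Qed.

Section OneOperator.

Context (B : X -> X) (b : R) (HB : linear_map B) (Hb : 0 <= b)
  (HBb : bounded_by N B b)
  (Hcone : forall z, cone K z -> bounded_by N (expm B z) c).

(** The segment from [z] to [z + h] stays in the cone, which is convex; each of
    its [k] pieces contributes [|h| |B v| / k] up to [O(1 / k^2)]. *)
Lemma expm_increment z h v :
  cone K z -> cone K (z + h) ->
  N (expm B (z + h) v ⊖ expm B z v) <= c * Cmod h * N (B v).
Proof.
  intros Hz Hzh; set (C0 := exp (Cmod h * b) * (Cmod h * b)² * N v).
  apply (le_of_vanishing_error _ _ (c * C0)); exists O; intros n _.
  set (k := S n); assert (Hk : (0 < k)%nat) by (unfold k; lia).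
  pose proof (div_INR_pos k Hk) as Hk'; apply lt_0_INR in Hk as Hk0.
  set (a := (h / INR k)%C); set (e := / INR k) in *.
  assert (Ha : Cmod a = Cmod h * e) by (unfold a; now rewrite Cmod_div_INR).
  pose proof (expm_small_step B b k h v HB Hb HBb Hk) as Hs; fold a e C0 in Hs.
  assert (Hs' : N (expm B a v ⊖ v) <= Cmod h * e * N (B v) + C0 * (e * e)).
  { replace (expm B a v ⊖ v) with (a ⊙ B v ⊕ (expm B a v ⊖ (v ⊕ a ⊙ B v))) by vec.
    eapply Rle_trans; [apply (en_plus _ _ HN)|]; rewrite (N_scal HN), Ha; lra. }
  assert (Hind : forall j, (j <= k)%nat ->
    N (expm B (z + INR j * a) v ⊖ expm B z v)
    <= INR j * (c * (Cmod h * e * N (B v) + C0 * (e * e)))).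
  { induction j as [|j IH]; intros Hj.
    - simpl; replace (z + 0 * a)%C with z by ring.
      replace (_ ⊖ _) with (vzero : X) by vec; rewrite (N_zero HN); lra.
    - specialize (IH ltac:(lia)); pose proof (pos_INR j).
      assert (Hcj : cone K (z + INR j * a)).
      { replace (INR j * a)%C with (RtoC (INR j * e) * h)%C
          by (unfold a, e, Cdiv; rewrite RtoC_mult, RtoC_inv by lra; ring).
        apply cone_segment; auto; split; [nra|].
        apply le_INR in Hj; rewrite S_INR in Hj.
        replace 1 with (INR k * e) by (unfold e; field; lra); nra. }
      replace (z + INR (S j) * a)%C with (z + INR j * a + a)%C
        by (rewrite S_INR, RtoC_plus; ring).
      rewrite (expm_plus HN B b), S_INR by easy.
      pose proof (linear_expm HN B b HB Hb HBb (z + INR j * a)) as HL.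
      replace (expm B (z + INR j * a) (expm B a v) ⊖ expm B z v)
        with ((expm B (z + INR j * a) v ⊖ expm B z v)
              ⊕ expm B (z + INR j * a) (expm B a v ⊖ v))
        by (rewrite (lin_minus _ HL); vec).
      eapply Rle_trans; [apply (en_plus _ _ HN)|].
      pose proof (Hcone _ Hcj (expm B a v ⊖ v)) as H1.
      apply (Rmult_le_compat_l c) in Hs'; [|easy]; lra. }
  specialize (Hind k (le_n _)).
  replace (INR k * a)%C with h in Hind
    by (unfold a; field; apply RtoC_neq_0; lra).
  eapply Rle_trans; [exact Hind|]; right.
  replace (INR n + 1) with (INR k) by (unfold k; apply S_INR); unfold e; field; lra.
Qed.

Lemma expm_increment2 z h y :
  cone K z -> cone K (z + h) ->
  N (expm B (z + h) y ⊖ expm B z y ⊖ h ⊙ expm B z (B y))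
  <= c * (Cmod h)² * N (B (B y)).
Proof.
  intros Hz Hzh; set (C0 := exp (Cmod h * b) * (Cmod h * b)² * N y).
  apply (le_of_vanishing_error _ _ (c * C0)); exists O; intros n _.
  set (k := S n); assert (Hk : (0 < k)%nat) by (unfold k; lia).
  pose proof (div_INR_pos k Hk) as Hk'; apply lt_0_INR in Hk as Hk0.
  set (a := (h / INR k)%C); set (e := / INR k) in *.
  assert (Ha : Cmod a = Cmod h * e) by (unfold a; now rewrite Cmod_div_INR).
  pose proof (expm_small_step B b k h y HB Hb HBb Hk) as Hs; fold a e C0 in Hs.
  pose proof (N_ge0 HN (B (B y))) as Hy; pose proof (Cmod_ge_0 h) as Hh.
  assert (Hind : forall j, (j <= k)%nat ->
    N (expm B (z + INR j * a) y ⊖ expm B z y ⊖ (INR j * a)%C ⊙ expm B z (B y))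
    <= INR j * (c * (C0 * (e * e)) + Cmod h * e * (c * Cmod h * N (B (B y))))).
  { induction j as [|j IH]; intros Hj.
    - simpl; replace (z + 0 * a)%C with z by ring.
      replace (_ ⊖ _) with (vzero : X) by vec; rewrite (N_zero HN); lra.
    - specialize (IH ltac:(lia)); pose proof (pos_INR j).
      assert (Eja : (INR j * a)%C = (RtoC (INR j * e) * h)%C)
        by (unfold a, e, Cdiv; rewrite RtoC_mult, RtoC_inv by lra; ring).
      assert (Hje : 0 <= INR j * e <= 1).
      { split; [nra|]; apply le_INR in Hj; rewrite S_INR in Hj.
        replace 1 with (INR k * e) by (unfold e; field; lra); nra. }
      assert (Hcj : cone K (z + INR j * a)) by (rewrite Eja; now apply cone_segment).
      replace (z + INR (S j) * a)%C with (z + INR j * a + a)%C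
        by (rewrite S_INR, RtoC_plus; ring).
      rewrite (expm_plus HN B b), S_INR, RtoC_plus by easy.
      pose proof (linear_expm HN B b HB Hb HBb (z + INR j * a)) as HL.
      replace (expm B (z + INR j * a) (expm B a y) ⊖ expm B z y
               ⊖ ((INR j + 1) * a)%C ⊙ expm B z (B y))
        with ((expm B (z + INR j * a) y ⊖ expm B z y ⊖ (INR j * a)%C ⊙ expm B z (B y))
              ⊕ (expm B (z + INR j * a) (expm B a y ⊖ (y ⊕ a ⊙ B y))
                 ⊕ a ⊙ (expm B (z + INR j * a) (B y) ⊖ expm B z (B y))))
        by (rewrite (lin_minus _ HL), (lin_plus _ HL), (lin_scal _ HL); vec).
      eapply Rle_trans; [apply (en_plus _ _ HN)|].
      pose proof (en_plus _ _ HN (expm B (z + INR j * a) (expm B a y ⊖ (y ⊕ a ⊙ B y)))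
        (a ⊙ (expm B (z + INR j * a) (B y) ⊖ expm B z (B y)))) as H1.
      rewrite (N_scal HN), Ha in H1.
      pose proof (Hcone _ Hcj (expm B a y ⊖ (y ⊕ a ⊙ B y))) as H2.
      pose proof (expm_increment z (INR j * a) (B y) Hz Hcj) as H3.
      rewrite Eja, Cmod_mult, Cmod_R, Rabs_pos_eq in H3 by lra; rewrite <- Eja in H3.
      assert (H4 : N (expm B (z + INR j * a) (B y) ⊖ expm B z (B y))
                   <= c * Cmod h * N (B (B y))).
      { eapply Rle_trans; [exact H3|]; apply Rmult_le_compat_r; [easy|].
        apply Rmult_le_compat_l; [easy|]; nra. }
      apply (Rmult_le_compat_l c) in Hs; [|easy].
      apply (Rmult_le_compat_l (Cmod h * e)) in H4; [|nra]; lra. }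
  specialize (Hind k (le_n _)).
  replace (INR k * a)%C with h in Hind
    by (unfold a; field; apply RtoC_neq_0; lra).
  eapply Rle_trans; [exact Hind|]; right.
  replace (INR n + 1) with (INR k) by (unfold k; apply S_INR); unfold e, Rsqr; field; lra.
Qed.

End OneOperator.

(** Telescoping over [k] small steps: the bound depends on [B1] and [B2] only
    through their difference at [x] and the bound [c] on the cone. *)
Lemma expm_compare (B1 B2 : X -> X) b z x :
  linear_map B1 -> linear_map B2 -> 0 <= b -> bounded_by N B1 b -> bounded_by N B2 b ->
  (forall y, B1 (B2 y) = B2 (B1 y)) ->
  (forall z, cone K z -> bounded_by N (expm B1 z) c) ->
  (forall z, cone K z -> bounded_by N (expm B2 z) c) ->
  cone K z ->
  N (expm B1 z x ⊖ expm B2 z x) <= c * c * Cmod z * N (B1 x ⊖ B2 x).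
Proof.
  intros HB1 HB2 Hb Hb1 Hb2 H12 Hc1 Hc2 Hz.
  set (C0 := exp (Cmod z * b) * (Cmod z * b)² * N x).
  apply (le_of_vanishing_error _ _ (c * c * (2 * C0))); exists O; intros n _.
  set (k := S n); assert (Hk : (0 < k)%nat) by (unfold k; lia).
  pose proof (div_INR_pos k Hk) as Hk'; apply lt_0_INR in Hk as Hk0.
  set (a := (z / INR k)%C); set (e := / INR k) in *.
  assert (Ha : Cmod a = Cmod z * e) by (unfold a; now rewrite Cmod_div_INR).
  assert (Ha' : a = (RtoC e * z)%C) by (unfold a, e, Cdiv; rewrite RtoC_inv by lra; ring).
  pose proof (expm_small_step B1 b k z x HB1 Hb Hb1 Hk) as Hs1.
  pose proof (expm_small_step B2 b k z x HB2 Hb Hb2 Hk) as Hs2.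
  fold a e C0 in Hs1, Hs2.
  assert (Hd : N (expm B1 a x ⊖ expm B2 a x)
               <= Cmod z * e * N (B1 x ⊖ B2 x) + 2 * C0 * (e * e)).
  { replace (expm B1 a x ⊖ expm B2 a x)
      with ((expm B1 a x ⊖ (x ⊕ a ⊙ B1 x)) ⊖ (expm B2 a x ⊖ (x ⊕ a ⊙ B2 x))
            ⊕ a ⊙ (B1 x ⊖ B2 x)) by vec.
    eapply Rle_trans; [apply (en_plus _ _ HN)|]; rewrite (N_scal HN), Ha.
    pose proof (N_minus HN (expm B1 a x ⊖ (x ⊕ a ⊙ B1 x)) (expm B2 a x ⊖ (x ⊕ a ⊙ B2 x))).
    lra. }
  assert (Hcj : forall j, cone K (INR j * a)).
  { intros j; apply cone_scal; [apply pos_INR|]; rewrite Ha'; apply cone_scal; lra || easy. }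
  assert (Ek : (INR k * a)%C = z) by (unfold a; field; apply RtoC_neq_0; lra).
  pose proof (telescope HN (expm B1 a) (expm B2 a)
    (c * (c * N (expm B1 a x ⊖ expm B2 a x))) k x) as Ht.
  rewrite (expm_iter HN B1 b), (expm_iter HN B2 b), Ek in Ht by easy.
  eapply Rle_trans; [apply Ht|].
  - now apply (linear_expm HN B1 b).
  - now apply (linear_expm HN B2 b).
  - intros y; apply (expm_comm HN B2 b) with (p := exp (Cmod a * b)); try easy.
    + now apply (linear_expm HN B1 b).
    + now apply (bounded_by_expm HN B1 b).
    + intros y'; symmetry; now apply (expm_comm HN B1 b) with (p := b).
  - intros i j _.
    rewrite (expm_iter HN B1 b), (expm_iter HN B2 b) by easy.
    eapply Rle_trans; [apply Hc1, Hcj|]; apply Rmult_le_compat_l; [easy|].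
    apply Hc2, Hcj.
  - apply (Rmult_le_compat_l (INR k * (c * c))) in Hd; [|apply Rmult_le_pos; nra].
    replace (INR k * (c * (c * N (expm B1 a x ⊖ expm B2 a x))))
      with (INR k * (c * c) * N (expm B1 a x ⊖ expm B2 a x)) by ring.
    eapply Rle_trans; [exact Hd|]; right.
    replace (INR n + 1) with (INR k) by (unfold k; apply S_INR); unfold e; field; lra.
Qed.

End ConeExponential.

(** * The holomorphic extension *)

Section Extension.

Context {X : CompleteNormedModule C_AbsRing}.

(** The limit of the exponentials of the Yosida approximations of the
    generator, along [mu = n + 1]. *)
Definition holomorphic_extension (N : X -> R) (T : R -> X -> X) (z : C) (x : X) : X :=
  vlim N (fun n => exp_op N
    (fun y => RtoC (INR n + 1) ⊙ (yosida_op N T (INR n + 1) y ⊖ y)) z x).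

Context {N : X -> R} {M : R} (HN : equivalent_norm N M).
Context {T : R -> X -> X} (HT : contraction_semigroup N T).

Local Notation gen := (right_derivative N T).
Local Notation expm := (exp_op N).
Local Notation extension := (holomorphic_extension N T).

Context (K : R) (HK : 1 <= K)
  (Hsurj : forall s, s <> 0 -> surjective_resolvent N T (0, s))
  (Hlow : forall s x w, s <> 0 -> gen x w ->
     Rabs s * N x <= K * N ((0, s) ⊙ x ⊖ w)).

Let V (n : nat) : X -> X := yosida_op N T (INR n + 1).
Let B (n : nat) (x : X) : X := RtoC (INR n + 1) ⊙ (V n x ⊖ x).
Let c : R := 384 * (5 * K).

Lemma mu_pos n : 0 < INR n + 1.
Proof. pose proof (pos_INR n); lra. Qed.

Lemma c_pos : 0 < c.
Proof. unfold c; lra. Qed.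

Lemma linear_V n : linear_map (V n).
Proof. exact (linear_yosida HN HT K HK Hsurj Hlow _ (mu_pos n)). Qed.

Lemma V_contraction n : bounded_by N (V n) 1.
Proof. exact (yosida_contraction HN HT K HK Hsurj Hlow _ (mu_pos n)). Qed.

Lemma linear_B n : linear_map (B n).
Proof. exact (linear_gen (V n) _ (linear_V n)). Qed.

Lemma bounded_B n : bounded_by N (B n) (2 * (INR n + 1)).
Proof. exact (bounded_by_gen HN (V n) _ (V_contraction n) (mu_pos n)). Qed.

Lemma bounded_B_ge0 n : 0 <= 2 * (INR n + 1).
Proof. pose proof (mu_pos n); lra. Qed.

Lemma B_comm n m x : B n (B m x) = B m (B n x).
Proof.
  pose proof (linear_V n) as Hn; pose proof (linear_V m) as Hm; unfold B.
  rewrite (lin_scal _ Hn), (lin_scal _ Hm), (lin_minus _ Hn), (lin_minus _ Hm).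
  replace (V n (V m x)) with (V m (V n x))
    by (apply (yosida_comm HN HT K HK Hsurj Hlow); apply mu_pos).
  vec.
Qed.

Lemma B_comm_T n t x : 0 <= t -> T t (B n x) = B n (T t x).
Proof.
  intros Ht; pose proof (cs_linear _ _ HT t Ht) as HL; unfold B, V.
  rewrite (lin_scal _ HL), (lin_minus _ HL).
  now rewrite (yosida_comm_T HN HT K HK Hsurj Hlow) by (try apply mu_pos; easy).
Qed.

Lemma B_of_gen n x w : gen x w -> B n x = V n w.
Proof.
  intros Hg; symmetry.
  exact (yosida_of_gen HN HT K HK Hsurj Hlow _ x w (mu_pos n) Hg).
Qed.

Lemma V_tends x : tends N (fun n => V n x) x.
Proof. exact (yosida_tends HN HT K HK Hsurj Hlow x). Qed.

Lemma B_tends x w : gen x w -> tends N (fun n => B n x) w.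
Proof.
  intros Hg; apply (tends_ext (fun n => V n w)); [|apply V_tends].
  intros n; symmetry; now apply B_of_gen.
Qed.

Lemma linear_E n z : linear_map (expm (B n) z).
Proof. exact (linear_expm HN _ _ (linear_B n) (bounded_B_ge0 n) (bounded_B n) z). Qed.

Lemma E_cone n z : cone (5 * K) z -> bounded_by N (expm (B n) z) c.
Proof.
  apply (exp_gen_cone HN (V n) (5 * K) (INR n + 1)); auto using linear_V, V_contraction, mu_pos.
  - lra.
  - apply (yosida_Ritt HN HT K HK Hsurj Hlow), mu_pos.
Qed.

Lemma E_power n k t x :
  0 < t -> N (Nat.iter k (B n) (expm (B n) t x))
           <= 96 * (5 * K) * INR (fact (S k)) * (4 * (5 * K) / t) ^ k * N x.
Proof.
  apply (exp_gen_power HN (V n) (5 * K) (INR n + 1)); auto using linear_V, V_contraction, mu_pos.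
  - lra.
  - apply (yosida_Ritt HN HT K HK Hsurj Hlow), mu_pos.
Qed.

Lemma E_plus n z w x : expm (B n) (z + w) x = expm (B n) z (expm (B n) w x).
Proof. exact (expm_plus HN _ _ (linear_B n) (bounded_B_ge0 n) (bounded_B n) z w x). Qed.

Lemma E_B_comm n z x : B n (expm (B n) z x) = expm (B n) z (B n x).
Proof.
  apply (expm_comm HN _ _ (linear_B n) (bounded_B_ge0 n) (bounded_B n) (B n)
           (2 * (INR n + 1))); auto using linear_B, bounded_B.
Qed.

Lemma E_tends_on_domain z x w :
  cone (5 * K) z -> gen x w -> exists l, tends N (fun n => expm (B n) z x) l.
Proof.
  intros Hz Hg; apply (tends_cauchy HN); intros eps Heps.
  set (q := c * c * Cmod z + 1).
  assert (Hq : 0 < q).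
  { unfold q; pose proof c_pos; pose proof (Cmod_ge_0 z).
    assert (0 <= c * c * Cmod z) by (apply Rmult_le_pos; nra); lra. }
  destruct (B_tends x w Hg (eps / 2 / q)) as [n0 H0].
  { apply Rdiv_lt_0_compat; lra. }
  exists n0; intros n m Hn Hm.
  pose proof (H0 n Hn) as Hn'; pose proof (H0 m Hm) as Hm'.
  pose proof (expm_compare HN (5 * K) c (Rlt_le _ _ c_pos) (B n) (B m)
    (2 * (INR n + 1) + 2 * (INR m + 1)) z x (linear_B n) (linear_B m)) as H.
  pose proof (bounded_B_ge0 n); pose proof (bounded_B_ge0 m).
  eapply Rle_trans; [apply H; auto using B_comm, E_cone|].
  - lra.
  - intros y; pose proof (bounded_B n y); pose proof (N_ge0 HN y); nra.
  - intros y; pose proof (bounded_B m y); pose proof (N_ge0 HN y); nra.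
  - pose proof (N_chain HN w (B n x) (B m x)) as Hch.
    rewrite (N_minus_sym HN w) in Hch.
    assert (Hnm : N (B n x ⊖ B m x) <= eps / q).
    { replace (eps / q) with (eps / 2 / q + eps / 2 / q) by (field; lra); lra. }
    apply Rle_div_r in Hnm; [|easy].
    pose proof (N_ge0 HN (B n x ⊖ B m x)); unfold q in Hnm; nra.
Qed.

Lemma extension_tends z x :
  cone (5 * K) z -> tends N (fun n => expm (B n) z x) (extension z x).
Proof.
  intros Hz; apply (vlim_tends HN).
  apply (tends_on_dense HN (fun n => expm (B n) z) c (fun x => exists w, gen x w)).
  - intros n; apply linear_E.
  - intros n; now apply E_cone.
  - exact (gen_dense HN HT K HK Hsurj Hlow).
  - intros y [w Hw]; now apply (E_tends_on_domain z y w).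
Qed.

Lemma linear_extension z : cone (5 * K) z -> linear_map (extension z).
Proof.
  intros Hz; apply (linear_limit HN (fun n => expm (B n) z)).
  - intros n; apply linear_E.
  - intros x; now apply extension_tends.
Qed.

Lemma bounded_extension z : cone (5 * K) z -> bounded_by N (extension z) c.
Proof.
  intros Hz; apply (bounded_by_limit HN (fun n => expm (B n) z)).
  - intros n; now apply E_cone.
  - intros x; now apply extension_tends.
Qed.

Lemma extension_plus z w x :
  cone (5 * K) z -> cone (5 * K) w -> extension (z + w) x = extension z (extension w x).
Proof.
  intros Hz Hw; apply (tends_unique HN (fun n => expm (B n) (z + w) x)).
  - apply extension_tends, cone_plus; easy || lra.
  - apply (tends_ext (fun n => expm (B n) z (expm (B n) w x))).
    { intros n; symmetry; apply E_plus. }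
    apply (tends_map HN (fun n => expm (B n) z) c (fun n => expm (B n) w x) (extension w x)).
    + intros n; apply linear_E.
    + intros n; now apply E_cone.
    + now apply extension_tends.
    + now apply extension_tends.
Qed.

Lemma T_iter k t x : 0 <= t -> Nat.iter k (T t) x = T (INR k * t) x.
Proof.
  intros Ht; induction k as [|k IH].
  - simpl; rewrite Rmult_0_l; symmetry; apply (cs_0 _ _ HT).
  - change (T t (Nat.iter k (T t) x) = T (INR (S k) * t) x).
    pose proof (pos_INR k).
    rewrite IH, <- (cs_plus _ _ HT) by nra; f_equal; rewrite S_INR; ring.
Qed.

Lemma E_vs_T n t x w : 0 <= t -> gen x w ->
  N (expm (B n) t x ⊖ T t x) <= t * N (B n x ⊖ w).
Proof.
  intros Ht Hg; destruct (Rle_lt_or_eq_dec 0 t Ht) as [Ht0|<-].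
  2:{ rewrite (expm_0 HN _ _ (linear_B n) (bounded_B_ge0 n) (bounded_B n)), (cs_0 _ _ HT).
      replace (_ ⊖ _) with (vzero : X) by vec; rewrite (N_zero HN); lra. }
  apply le_epsilon; intros eps Heps.
  set (b := 2 * (INR n + 1)); set (C0 := exp (t * b) * (t * b)² * N x).
  destruct (Hg (eps / t)) as [d [Hd Hg']]; [now apply Rdiv_lt_0_compat|].
  apply (le_of_vanishing_error _ _ C0).
  destruct (INR_unbounded (t / d)) as [n0 Hn0].
  exists n0; intros m Hm; set (k := S m).
  assert (Hk : (0 < k)%nat) by (unfold k; lia).
  pose proof (div_INR_pos k Hk) as Hk'; apply lt_0_INR in Hk as Hk0.
  set (e := / INR k) in *; set (h := t * e).
  assert (Hh : 0 < h) by (unfold h; nra).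
  assert (Hhd : h < d).
  { apply Rlt_div_l in Hn0; [|easy].
    assert (INR n0 <= INR k) by (apply le_INR; unfold k; lia).
    unfold h, e; apply Rlt_div_l; [easy|]; nra. }
  specialize (Hg' h ltac:(lra)).
  assert (Ea : (t / INR k)%C = RtoC h)
    by (unfold h, e, Cdiv; now rewrite RtoC_mult, RtoC_inv by lra).
  pose proof (expm_small_step HN (B n) b k t x (linear_B n) (bounded_B_ge0 n)
                (bounded_B n) Hk) as Hs.
  rewrite Ea, Cmod_R, Rabs_pos_eq in Hs by lra; fold e C0 in Hs.
  assert (Hdif : N (expm (B n) h x ⊖ T h x)
                 <= C0 * (e * e) + h * N (B n x ⊖ w) + eps / t * h).
  { replace (expm (B n) h x ⊖ T h x)
      with ((expm (B n) h x ⊖ (x ⊕ RtoC h ⊙ B n x)) ⊕ RtoC h ⊙ (B n x ⊖ w)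
            ⊖ (T h x ⊖ x ⊖ RtoC h ⊙ w)) by vec.
    eapply Rle_trans; [apply (N_minus HN)|].
    pose proof (en_plus _ _ HN (expm (B n) h x ⊖ (x ⊕ RtoC h ⊙ B n x))
                  (RtoC h ⊙ (B n x ⊖ w))) as H1.
    rewrite (N_scal HN), Cmod_R, Rabs_pos_eq in H1 by lra; lra. }
  assert (Ehk : INR k * h = t) by (unfold h, e; field; lra).
  pose proof (telescope HN (expm (B n) h) (T h) (N (expm (B n) h x ⊖ T h x)) k x
    (linear_E n h) (cs_linear _ _ HT h ltac:(lra))) as Ht1.
  rewrite (expm_iter HN (B n) b (linear_B n) (bounded_B_ge0 n) (bounded_B n)),
    T_iter, <- RtoC_mult, Ehk in Ht1 by lra.
  eapply Rle_trans; [apply Ht1|].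
  - intros y; symmetry.
    apply (expm_comm HN _ _ (linear_B n) (bounded_B_ge0 n) (bounded_B n) (T h) 1).
    + apply (cs_linear _ _ HT); lra.
    + apply (cs_contraction _ _ HT); lra.
    + intros; apply B_comm_T; lra.
  - intros i j _.
    pose proof (contraction_iter (expm (B n) h) i
      (exp_gen_contraction HN (V n) _ (linear_V n) (V_contraction n) (mu_pos n) h
         (Rlt_le _ _ Hh)) (Nat.iter j (T h) (expm (B n) h x ⊖ T h x))) as H1.
    pose proof (contraction_iter (T h) j (cs_contraction _ _ HT h ltac:(lra))
      (expm (B n) h x ⊖ T h x)) as H2.
    fold (B n) in H1; lra.
  - apply (Rmult_le_compat_l (INR k)) in Hdif; [|lra].
    eapply Rle_trans; [exact Hdif|]; right.
    replace (INR m + 1) with (INR k) by (unfold k; apply S_INR).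
    unfold h, e; field; lra.
Qed.

Lemma extension_real t x : 0 <= t -> extension t x = T t x.
Proof.
  intros Ht; assert (Hc : cone (5 * K) t) by now apply cone_real.
  apply (eq_on_dense HN (extension t) (T t) (c + 1) (fun x => exists w, gen x w)).
  - now apply linear_extension.
  - now apply (cs_linear _ _ HT).
  - intros y; pose proof (bounded_extension t Hc y); pose proof (N_ge0 HN y); nra.
  - intros y; pose proof (cs_contraction _ _ HT t Ht y); pose proof (N_ge0 HN y).
    pose proof c_pos; nra.
  - exact (gen_dense HN HT K HK Hsurj Hlow).
  - intros y [w Hg]; apply (tends_unique HN (fun n => expm (B n) t y)).
    + now apply extension_tends.
    + intros eps Heps.
      destruct (B_tends y w Hg (eps / (t + 1))) as [n0 H0].
      { apply Rdiv_lt_0_compat; lra. }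
      exists n0; intros n Hn; specialize (H0 n Hn); apply Rle_div_r in H0; [|lra].
      eapply Rle_trans; [now apply (E_vs_T n t y w)|].
      pose proof (N_ge0 HN (B n y ⊖ w)); nra.
Qed.

(** The Yosida approximation of [A] at [x] is the contraction [V n] applied to
    [w = A x], so that it is bounded uniformly in [n]. *)
Lemma extension_increment z x w :
  cone (5 * K) z -> gen x w -> N (extension z x ⊖ x) <= c * Cmod z * N w.
Proof.
  intros Hz Hg.
  apply (tends_bound HN (fun n => expm (B n) z x ⊖ x)).
  { apply (tends_minus HN); [now apply extension_tends|apply (tends_const HN)]. }
  exists O; intros n _.
  assert (H0 : cone (5 * K) 0) by (apply cone_real; lra).
  pose proof (expm_increment HN (5 * K) c ltac:(lra) (Rlt_le _ _ c_pos) (B n) _ (linear_B n)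
    (bounded_B_ge0 n) (bounded_B n) (E_cone n) 0 z x H0) as H.
  rewrite Cplus_0_l, (expm_0 HN _ _ (linear_B n) (bounded_B_ge0 n) (bounded_B n)) in H.
  eapply Rle_trans; [now apply H|].
  rewrite (B_of_gen n x w Hg).
  pose proof (V_contraction n w); pose proof (Cmod_ge_0 z); pose proof c_pos.
  apply Rmult_le_compat_l; [nra|lra].
Qed.

Lemma extension_continuous x eps : 0 < eps ->
  exists d, 0 < d /\ forall z, cone (5 * K) z -> Cmod z < d -> N (extension z x ⊖ x) <= eps.
Proof.
  intros Heps; pose proof c_pos as Hc.
  destruct (gen_dense HN HT K HK Hsurj Hlow x (eps / 2 / (c + 1))) as [y [[w Hg] Hxy]].
  { apply Rdiv_lt_0_compat; lra. }
  apply Rle_div_r in Hxy; [|lra].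
  pose proof (N_ge0 HN w) as Hw.
  exists (eps / 2 / (c * (N w + 1))); split.
  { apply Rdiv_lt_0_compat; nra. }
  intros z Hz Hzd; apply Rlt_div_r in Hzd; [|nra].
  pose proof (extension_increment z y w Hz Hg) as H1.
  pose proof (bounded_extension z Hz (x ⊖ y)) as H2.
  replace (extension z x ⊖ x)
    with ((extension z (x ⊖ y) ⊖ (x ⊖ y)) ⊕ (extension z y ⊖ y))
    by (rewrite (lin_minus _ (linear_extension z Hz)); vec).
  eapply Rle_trans; [apply (en_plus _ _ HN)|].
  pose proof (N_minus HN (extension z (x ⊖ y)) (x ⊖ y)).
  pose proof (Cmod_ge_0 z); nra.
Qed.

(** The point [z] is reached from [z - tau] by the real time [tau], which
    smooths: the second derivative is bounded uniformly in the approximation,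
    and so the first order expansions pass to the limit. *)
Lemma extension_differentiable z tau :
  0 < tau -> cone (5 * K) (z - tau) ->
  exists L D1 D2, linear_map L /\ bounded_by N L D1 /\ 0 <= D2 /\
    forall h x, cone (5 * K) (z - tau + h) ->
      N (extension (z + h) x ⊖ extension z x ⊖ h ⊙ L x) <= D2 * (Cmod h)² * N x.
Proof.
  intros Htau Hz.
  assert (Hz1 : cone (5 * K) z).
  { replace z with ((z - tau) + tau)%C by ring.
    apply cone_plus; [lra|easy|apply cone_real; lra]. }
  set (d1 := 96 * (5 * K) * INR (fact 2) * (4 * (5 * K) / tau) ^ 1).
  set (d2 := 96 * (5 * K) * INR (fact 3) * (4 * (5 * K) / tau) ^ 2).
  assert (Ez : forall n h x, expm (B n) (z + h) x = expm (B n) (z - tau + h) (expm (B n) tau x)).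
  { intros n h x; rewrite <- E_plus; f_equal; ring. }
  assert (Ez0 : forall n x, expm (B n) z x = expm (B n) (z - tau) (expm (B n) tau x)).
  { intros n x; rewrite <- E_plus; f_equal; ring. }
  assert (HB1 : forall n, bounded_by N (fun x => B n (expm (B n) z x)) (c * d1)).
  { intros n x; rewrite Ez0, E_B_comm.
    eapply Rle_trans; [apply E_cone, Hz|].
    pose proof (E_power n 1 tau x Htau) as H; fold d1 in H.
    change (Nat.iter 1 (B n) (expm (B n) tau x)) with (B n (expm (B n) tau x)) in H.
    pose proof c_pos; rewrite Rmult_assoc; apply Rmult_le_compat_l; lra. }
  assert (HBl : forall n, linear_map (fun x => B n (expm (B n) z x))).
  { intros n; apply (linear_comp (B n) (expm (B n) z)); [apply linear_B|apply linear_E]. }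
  assert (HL : forall x, exists l, tends N (fun n => B n (expm (B n) z x)) l).
  { apply (tends_on_dense HN (fun n x => B n (expm (B n) z x)) (c * d1)
             (fun x => exists w, gen x w)); auto.
    - exact (gen_dense HN HT K HK Hsurj Hlow).
    - intros x [w Hg]; exists (extension z w).
      apply (tends_ext (fun n => expm (B n) z (V n w))).
      { intros n; now rewrite E_B_comm, (B_of_gen n x w Hg). }
      apply (tends_map HN (fun n => expm (B n) z) c (fun n => V n w) w).
      + intros n; apply linear_E.
      + intros n; now apply E_cone.
      + apply V_tends.
      + now apply extension_tends. }
  set (L := fun x => vlim N (fun n => B n (expm (B n) z x))).
  assert (HLt : forall x, tends N (fun n => B n (expm (B n) z x)) (L x))
    by (intros x; apply (vlim_tends HN), HL).
  exists L, (c * d1), (c * d2); split; [|split; [|split]].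
  - now apply (linear_limit HN (fun n x => B n (expm (B n) z x))).
  - now apply (bounded_by_limit HN (fun n x => B n (expm (B n) z x))).
  - pose proof c_pos; apply Rmult_le_pos; [lra|]; unfold d2.
    apply Rmult_le_pos; [apply Rmult_le_pos; [lra|apply pos_INR]|].
    apply pow_le, Rdiv_le_0_compat; lra.
  - intros h x Hzh.
    assert (Hzh1 : cone (5 * K) (z + h)).
    { replace (z + h)%C with ((z - tau + h) + tau)%C by ring.
      apply cone_plus; [lra|easy|apply cone_real; lra]. }
    apply (tends_bound HN
      (fun n => expm (B n) (z + h) x ⊖ expm (B n) z x ⊖ h ⊙ B n (expm (B n) z x))).
    { apply (tends_minus HN); [apply (tends_minus HN); now apply extension_tends|].
      apply (tends_scal HN), HLt. }
    exists O; intros n _; rewrite Ez, Ez0, E_B_comm.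
    eapply Rle_trans.
    + apply (expm_increment2 HN (5 * K) c ltac:(lra) (Rlt_le _ _ c_pos) (B n) _ (linear_B n)
        (bounded_B_ge0 n) (bounded_B n) (E_cone n)); easy.
    + pose proof (E_power n 2 tau x Htau) as H; fold d2 in H.
      change (Nat.iter 2 (B n) (expm (B n) tau x)) with (B n (B n (expm (B n) tau x))) in H.
      pose proof c_pos; pose proof (Rle_0_sqr (Cmod h)).
      apply (Rmult_le_compat_l (c * (Cmod h)²)) in H; [|nra]; lra.
Qed.

End Extension.

(** * Renorming a bounded semigroup *)

Section OperatorNorm.

Context {X : CompleteNormedModule C_AbsRing}.

Lemma norm_equivalent : equivalent_norm (fun x : X => norm x) 1.
Proof.
  split; intros.
  - exact (norm_triangle x y).
  - exact (norm_scal a x).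
  - apply Rle_refl.
  - rewrite Rmult_1_l; apply Rle_refl.
Qed.

Lemma norm_le_of_opnorm (B : X -> X) (c : R) :
  linear_map B -> Rbar_le (opnorm B) c -> forall x, norm (B x) <= c * norm x.
Proof.
  intros HB Hc x.
  assert (Hunit : forall y : X, norm y <= 1 -> norm (B y) <= c).
  { intros y Hy.
    destruct (Lub_Rbar_correct
      (fun r : R => exists x : X, norm x <= 1 /\ r = norm (B x))) as [Hub _].
    assert (H : Rbar_le (norm (B y)) (opnorm B)) by (apply Hub; now exists y).
    exact (Rbar_le_trans _ _ _ H Hc). }
  pose proof norm_equivalent as HN.
  destruct (Req_dec (norm x) 0) as [Hx|Hx].
  - assert (Hx0 : x = vzero) by (apply (N_eq0 HN); lra).
    rewrite Hx0, (lin_zero _ HB), (N_zero HN); lra.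
  - assert (Hpos : 0 < norm x) by (pose proof (norm_ge_0 x); lra).
    assert (Hpos' : 0 < / norm x) by now apply Rinv_0_lt_compat.
    pose proof (Hunit (RtoC (/ norm x) ⊙ x)) as H.
    rewrite (lin_scal _ HB), !(N_scal HN), Cmod_R, Rabs_pos_eq, Rinv_l in H by lra.
    specialize (H (Rle_refl _)).
    apply (Rmult_le_compat_r (norm x)) in H; [|lra].
    replace (/ norm x * norm (B x) * norm x) with (norm (B x)) in H by (field; lra).
    exact H.
Qed.

Lemma opnorm_le (B : X -> X) (c : R) :
  0 <= c -> (forall x, norm (B x) <= c * norm x) -> Rbar_le (opnorm B) c.
Proof.
  intros Hc H; apply Lub_Rbar_correct.
  intros r [x [Hx ->]]; simpl; eapply Rle_trans; [apply H|].
  rewrite <- (Rmult_1_r c) at 2; now apply Rmult_le_compat_l.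
Qed.

Lemma linear_of_is_linear (B : X -> X) : is_linear B -> linear_map B.
Proof. intros [H1 H2 _]; now split. Qed.

Lemma is_linear_of_linear (B : X -> X) (c : R) :
  linear_map B -> (forall x, norm (B x) <= c * norm x) -> is_linear B.
Proof.
  intros HB H; split.
  - apply (lin_plus _ HB).
  - apply (lin_scal _ HB).
  - exists (Rabs c + 1); split; [pose proof (Rabs_pos c); lra|].
    intros x; eapply Rle_trans; [apply H|].
    apply Rmult_le_compat_r; [apply norm_ge_0|pose proof (Rle_abs c); lra].
Qed.

End OperatorNorm.

Section Renorming.

Context {X : CompleteNormedModule C_AbsRing}.

(** An equivalent norm in which the semigroup is contractive. *)
Definition orbit_norm (T : R -> X -> X) (x : X) : R :=
  real (Lub_Rbar (fun r : R => exists t, 0 <= t /\ r = norm (T t x))).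

Context (T : R -> X -> X) (M : R) (HT : C0_semigroup T) (HM : 1 <= M)
  (HTM : forall t, 0 <= t -> Rbar_le (opnorm (T t)) M).

Local Notation N := (orbit_norm T).

Lemma linear_T t : 0 <= t -> linear_map (T t).
Proof. intros Ht; apply linear_of_is_linear, (C0_bounded _ HT t Ht). Qed.

Lemma norm_T t x : 0 <= t -> norm (T t x) <= M * norm x.
Proof. intros Ht; apply norm_le_of_opnorm; [now apply linear_T|auto]. Qed.

Lemma orbit_norm_spec x :
  (forall t, 0 <= t -> norm (T t x) <= N x) /\
  (forall c, (forall t, 0 <= t -> norm (T t x) <= c) -> N x <= c).
Proof.
  unfold orbit_norm.
  set (E := fun r : R => exists t, 0 <= t /\ r = norm (T t x)).
  destruct (Lub_Rbar_correct E) as [Hub Hleast].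
  assert (H0 : Rbar_le (norm (T 0 x)) (Lub_Rbar E)) by (apply Hub; exists 0; split; [lra|easy]).
  assert (H1 : Rbar_le (Lub_Rbar E) (M * norm x)).
  { apply Hleast; intros r [t [Ht ->]]; simpl; now apply norm_T. }
  destruct (Lub_Rbar E) as [l| |]; simpl in *; try easy.
  split.
  - intros t Ht; apply (Hub (norm (T t x))); now exists t.
  - intros c Hc; apply (Hleast (Finite c)); intros r [t [Ht ->]]; simpl; auto.
Qed.

Lemma norm_T_le_orbit t x : 0 <= t -> norm (T t x) <= N x.
Proof. apply orbit_norm_spec. Qed.

Lemma orbit_norm_le x c : (forall t, 0 <= t -> norm (T t x) <= c) -> N x <= c.
Proof. apply orbit_norm_spec. Qed.

Lemma orbit_norm_equivalent : equivalent_norm N M.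
Proof.
  pose proof (@norm_equivalent X) as HN0; split.
  - intros x y; apply orbit_norm_le; intros t Ht.
    rewrite (lin_plus _ (linear_T t Ht)).
    eapply Rle_trans; [apply (en_plus _ _ HN0)|].
    apply Rplus_le_compat; now apply norm_T_le_orbit.
  - intros a x; apply orbit_norm_le; intros t Ht.
    rewrite (lin_scal _ (linear_T t Ht)), (N_scal HN0).
    apply Rmult_le_compat_l; [apply Cmod_ge_0|now apply norm_T_le_orbit].
  - intros x; rewrite <- (C0_zero _ HT x) at 1; apply norm_T_le_orbit; lra.
  - intros x; apply orbit_norm_le; intros t Ht; now apply norm_T.
Qed.

Lemma orbit_norm_contraction : contraction_semigroup N T.
Proof.
  pose proof orbit_norm_equivalent as HN; split.
  - exact linear_T.
  - apply (C0_zero _ HT).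
  - apply (C0_add _ HT).
  - intros t Ht x; rewrite Rmult_1_l; apply orbit_norm_le; intros s Hs.
    rewrite <- (C0_add _ HT) by easy; apply norm_T_le_orbit; lra.
  - intros x eps Heps.
    pose proof (C0_continuous _ HT x) as H.
    assert (Heps' : 0 < eps / M) by (apply Rdiv_lt_0_compat; lra).
    destruct (proj1 (filterlim_locally_ball_norm
      (U := CompleteNormedModule.NormedModule _ X) (F := at_right 0)
      (fun t => T t x) x) H (mkposreal _ Heps')) as [d Hd].
    exists d; split; [apply cond_pos|]; intros h Hh.
    destruct (Rle_lt_or_eq_dec 0 h (proj1 Hh)) as [Hh0|<-].
    + assert (Hb : norm (T h x ⊖ x) < eps / M).
      { apply (Hd h); [|easy]; change (Rabs (h - 0) < d); rewrite Rabs_pos_eq; lra. }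
      eapply Rle_trans; [apply (en_upper _ _ HN)|].
      apply Rlt_div_r in Hb; [|lra]; lra.
    + rewrite (C0_zero _ HT); replace (x ⊖ x) with (vzero : X) by vec.
      rewrite (N_zero HN); lra.
Qed.

Lemma generator_value_right_derivative x w :
  is_generator_value T x w <-> right_derivative N T x w.
Proof.
  pose proof orbit_norm_equivalent as HN; pose proof (@norm_equivalent X) as HN0.
  assert (Hq : forall h, 0 < h ->
    norm (RtoC (/ h) ⊙ (T h x ⊖ x) ⊖ w) = / h * norm (T h x ⊖ x ⊖ RtoC h ⊙ w)).
  { intros h Hh.
    transitivity (norm (RtoC (/ h) ⊙ (T h x ⊖ x ⊖ RtoC h ⊙ w))).
    - f_equal; rewrite RtoC_inv by lra; vec_goals; field; apply RtoC_neq_0; lra.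
    - rewrite (N_scal HN0), Cmod_R, Rabs_pos_eq; [easy|].
      left; now apply Rinv_0_lt_compat. }
  unfold is_generator_value.
  eapply iff_trans; [exact (filterlim_locally_ball_norm
    (U := CompleteNormedModule.NormedModule _ X) (F := at_right 0)
    (fun h => RtoC (/ h) ⊙ (T h x ⊖ x)) w)|].
  split.
  - intros H eps Heps.
    assert (Heps' : 0 < eps / M) by (apply Rdiv_lt_0_compat; lra).
    destruct (H (mkposreal _ Heps')) as [d Hd].
    exists d; split; [apply cond_pos|]; intros h Hh.
    assert (Hb : norm (RtoC (/ h) ⊙ (T h x ⊖ x) ⊖ w) < eps / M).
    { apply (Hd h); [|easy]; change (Rabs (h - 0) < d); rewrite Rabs_pos_eq; lra. }
    rewrite Hq in Hb by easy.
    eapply Rle_trans; [apply (en_upper _ _ HN)|].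
    apply Rlt_div_r in Hb; [|lra].
    apply (Rmult_lt_compat_l h) in Hb; [|easy].
    replace (h * (/ h * norm (T h x ⊖ x ⊖ RtoC h ⊙ w) * M))
      with (M * norm (T h x ⊖ x ⊖ RtoC h ⊙ w)) in Hb by (field; lra); lra.
  - intros H eps; pose proof (cond_pos eps).
    destruct (H (eps / 2)) as [d [Hd Hg]]; [lra|].
    exists (mkposreal _ Hd); intros h Hhd Hh.
    change (Rabs (h - 0) < d) in Hhd; rewrite Rabs_pos_eq in Hhd by lra.
    specialize (Hg h ltac:(lra)).
    change (norm (RtoC (/ h) ⊙ (T h x ⊖ x) ⊖ w) < eps); rewrite Hq by easy.
    pose proof (en_lower _ _ HN (T h x ⊖ x ⊖ RtoC h ⊙ w)) as Hl.
    apply Rle_lt_trans with (/ h * (eps / 2 * h)).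
    + apply Rmult_le_compat_l; [left; now apply Rinv_0_lt_compat|lra].
    + replace (/ h * (eps / 2 * h)) with (eps / 2) by (field; lra); lra.
Qed.

Lemma generator_val x w : is_generator_value T x w -> op_val (generator T) x = w.
Proof.
  intros H; apply (iota_unique (is_generator_value T x)); [|easy].
  intros y Hy.
  apply (filterlim_locally_unique (V := CompleteNormedModule.NormedModule _ X)
           (F := at_right 0) _ y w Hy H).
Qed.

Lemma resolvent_spec (l : C) : in_resolvent_set (generator T) l ->
  forall x y, (exists w, is_generator_value T x w /\ l ⊙ x ⊖ w = y)
              <-> resolvent l (generator T) y = x.
Proof.
  intros Hl x y.
  pose proof (iota_correct _ (Hl y)) as [Hdom Heq].
  fold (resolvent l (generator T) y) in Hdom, Heq.
  split.
  - intros [w [Hg E]].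
    destruct (Hl y) as [x' [_ Hu]].
    transitivity x'; [symmetry|]; apply Hu; split; auto.
    + now exists w.
    + rewrite (generator_val x w Hg); exact E.
  - intros <-; destruct Hdom as [w Hw]; exists w; split; [exact Hw|].
    rewrite (generator_val _ w Hw) in Heq; exact Heq.
Qed.

Lemma surjective_of_resolvent (l : C) :
  in_resolvent_set (generator T) l -> surjective_resolvent N T l.
Proof.
  intros Hl y.
  destruct (proj2 (resolvent_spec l Hl (resolvent l (generator T) y) y) eq_refl)
    as [w [Hg E]].
  exists (resolvent l (generator T) y), w; split; [|easy].
  now apply generator_value_right_derivative.
Qed.

Lemma linear_resolvent (l : C) :
  in_resolvent_set (generator T) l -> linear_map (resolvent l (generator T)).
Proof.
  intros Hl; pose proof orbit_norm_equivalent as HN.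
  pose proof orbit_norm_contraction as HS.
  assert (Hspec : forall y, exists w,
    right_derivative N T (resolvent l (generator T) y) w
    /\ l ⊙ resolvent l (generator T) y ⊖ w = y).
  { intros y; destruct (proj2 (resolvent_spec l Hl _ y) eq_refl) as [w [Hg E]].
    exists w; split; [now apply generator_value_right_derivative|easy]. }
  split.
  - intros x y; apply (resolvent_spec l Hl).
    destruct (Hspec x) as [wx [Hx Ex]]; destruct (Hspec y) as [wy [Hy Ey]].
    exists (wx ⊕ wy); split.
    + apply generator_value_right_derivative; now apply (gen_plus HN HS).
    + rewrite <- Ex at 2; rewrite <- Ey at 2; vec.
  - intros a x; apply (resolvent_spec l Hl).
    destruct (Hspec x) as [wx [Hx Ex]]; exists (a ⊙ wx); split.
    + apply generator_value_right_derivative; now apply (gen_scal HN HS).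
    + rewrite <- Ex at 2; vec.
Qed.

(** The resolvent commutes with the semigroup, so its bound holds along
    orbits. *)
Lemma resolvent_bound_orbit_norm (l : C) (b : R) x w :
  in_resolvent_set (generator T) l -> 0 <= b ->
  Rbar_le (opnorm (resolvent l (generator T))) b ->
  right_derivative N T x w -> N x <= b * N (l ⊙ x ⊖ w).
Proof.
  intros Hl Hb Hbound Hg; apply orbit_norm_le; intros t Ht.
  pose proof orbit_norm_equivalent as HN; pose proof orbit_norm_contraction as HS.
  assert (E : resolvent l (generator T) (T t (l ⊙ x ⊖ w)) = T t x).
  { apply (resolvent_spec l Hl); exists (T t w); split.
    - apply generator_value_right_derivative; now apply (gen_T HN HS).
    - rewrite (lin_minus _ (linear_T t Ht)), (lin_scal _ (linear_T t Ht)); easy. }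
  rewrite <- E.
  eapply Rle_trans; [apply (norm_le_of_opnorm _ _ (linear_resolvent l Hl) Hbound)|].
  apply Rmult_le_compat_l; [easy|]; now apply norm_T_le_orbit.
Qed.

End Renorming.

(** * Sectors *)

Lemma Rabs_sin_le t : Rabs (sin t) <= Rabs t.
Proof.
  assert (H : forall s, 0 <= s -> Rabs (sin s) <= s).
  { intros s [Hs|<-]; [|rewrite sin_0, Rabs_R0; lra].
    pose proof (sin_lt_x s Hs) as H1; pose proof (SIN_bound s) as H2.
    destruct (Rle_lt_dec s 1) as [H3|H3].
    - rewrite Rabs_pos_eq; [lra|]; apply sin_ge_0; [lra|].
      pose proof PI2_1; lra.
    - apply Rabs_le; lra. }
  destruct (Rle_lt_dec 0 t) as [Ht|Ht].
  - rewrite (Rabs_pos_eq t) by easy; now apply H.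
  - rewrite <- (Ropp_involutive t), sin_neg, Rabs_Ropp, Rabs_Ropp, (Rabs_pos_eq (- t)) by lra.
    apply H; lra.
Qed.

Lemma cos_lower_half t : Rabs t <= 1 -> / 2 <= cos t.
Proof.
  intros Ht; replace t with (2 * (t / 2)) by field.
  rewrite cos_2a_sin; pose proof (Rabs_sin_le (t / 2)) as H.
  unfold Rdiv in H at 2; rewrite Rabs_mult, (Rabs_pos_eq (/ 2)) in H by lra.
  assert (Hs : Rabs (sin (t / 2)) <= / 2) by lra.
  apply Rabs_le_between in Hs; nra.
Qed.

Lemma cone_gap_of_arg K z theta :
  1 <= K -> is_arg z theta -> Rabs theta <= 1 / (16 * K) ->
  Cmod z * (8 * K) * (1 / (16 * K) - Rabs theta) <= Re z - 8 * K * Rabs (Im z).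
Proof.
  intros HK [_ Ez] Ht.
  assert (HK1 : 1 / (16 * K) <= 1) by (apply Rle_div_l; lra).
  pose proof (cos_lower_half theta ltac:(lra)) as Hc.
  pose proof (Rabs_sin_le theta) as Hs; pose proof (Cmod_ge_0 z) as Hz.
  rewrite Ez at 2 3; unfold Re, Im; simpl.
  rewrite Rabs_mult, (Rabs_pos_eq (Cmod z)) by easy.
  replace (Cmod z * (8 * K) * (1 / (16 * K) - Rabs theta))
    with (Cmod z * (/ 2 - 8 * K * Rabs theta)) by (field; lra).
  replace (Cmod z * cos theta - 8 * K * (Cmod z * Rabs (sin theta)))
    with (Cmod z * (cos theta - 8 * K * Rabs (sin theta))) by ring.
  apply Rmult_le_compat_l; [easy|]; nra.
Qed.

Lemma cone_of_arg K z theta :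
  1 <= K -> is_arg z theta -> Rabs theta <= 1 / (16 * K) -> cone K z.
Proof.
  intros HK Hz Ht; pose proof (cone_gap_of_arg K z theta HK Hz Ht) as H.
  unfold cone; pose proof (Cmod_ge_0 z).
  assert (0 <= Cmod z * (8 * K) * (1 / (16 * K) - Rabs theta))
    by (apply Rmult_le_pos; [apply Rmult_le_pos|]; lra).
  lra.
Qed.

(** A point of the open sector has room for a translation to the left and for
    a small disc. *)
Lemma cone_room K z :
  1 <= K -> sector (1 / (16 * K)) z ->
  exists tau r, 0 < tau /\ 0 < r /\
    cone K (z - tau) /\ forall h, Cmod h < r -> cone K (z - tau + h).
Proof.
  intros HK [Hz [theta [Harg Ht]]].
  pose proof (cone_gap_of_arg K z theta HK Harg (Rlt_le _ _ Ht)) as H.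
  apply Cmod_gt_0 in Hz.
  set (g := Re z - 8 * K * Rabs (Im z)) in *.
  assert (Hg : 0 < g).
  { eapply Rlt_le_trans; [|exact H].
    apply Rmult_lt_0_compat; [apply Rmult_lt_0_compat|]; lra. }
  assert (Hr : 0 < g / 2 / (1 + 8 * K)) by (apply Rdiv_lt_0_compat; lra).
  assert (Hh : forall h, Cmod h < g / 2 / (1 + 8 * K) -> cone K (z - RtoC (g / 2) + h)).
  { intros h Hh; apply Rlt_div_r in Hh; [|lra].
    pose proof (re_le_Cmod h) as H1.
    assert (H2 : Rabs (Im h) <= Cmod h).
    { pose proof (Rmax_Cmod h); pose proof (Rmax_r (Rabs (fst h)) (Rabs (snd h))).
      unfold Im; lra. }
    unfold cone, g in *; destruct z as [a b], h as [a' b']; unfold Re, Im in *; simpl in *.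
    replace (b + - 0 + b') with (b + b') by ring.
    pose proof (Rabs_triang b b'); apply Rabs_le_between in H1.
    set (m := Cmod (a', b')) in *; clearbody m.
    assert (8 * K * Rabs (b + b') <= 8 * K * Rabs b + 8 * K * m) by nra.
    lra. }
  exists (g / 2), (g / 2 / (1 + 8 * K)); split; [lra|]; split; [easy|]; split; [|easy].
  rewrite <- (Cplus_0_r (z - RtoC (g / 2))%C); apply Hh; now rewrite Cmod_0.
Qed.

Lemma Cmod_ball_0 d h : ball (RtoC 0) d h -> Cmod h < 2 * d.
Proof.
  intros H; change (Rabs (fst h - 0) < d /\ Rabs (snd h - 0) < d) in H.
  rewrite !Rminus_0_r in H; destruct H as [H1 H2].
  replace h with ((fst h, 0) + (0, snd h))%C by (destruct h; unfold Cplus; simpl; f_equal; ring).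
  eapply Rle_lt_trans; [apply Cmod_triangle|].
  assert (E1 : Cmod (fst h, 0) = Rabs (fst h)) by exact (Cmod_R (fst h)).
  assert (E2 : Cmod (0, snd h) = Rabs (snd h)).
  { unfold Cmod; simpl; replace (0 * (0 * 1) + snd h * (snd h * 1)) with ((snd h)²)
      by (unfold Rsqr; ring); apply sqrt_Rsqr_abs. }
  lra.
Qed.

Theorem theorem3p12 :
  exists c c' : R, 0 < c /\ 0 < c' /\
  forall (X : CompleteNormedModule C_AbsRing) (T : R -> X -> X) (M K : R),
    C0_semigroup T ->
    1 <= M ->
    (forall t : R, 0 <= t -> Rbar_le (opnorm (T t)) M) ->
    1 <= K ->
    (forall s : R, 0 < Rabs s ->
       in_resolvent_set (generator T) (0, s) /\
       Rbar_le (opnorm (resolvent (0, s) (generator T))) (K / Rabs s)) ->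
    exists (delta : R) (S : C -> X -> X),
      c / (K * M) < delta /\
      bounded_holomorphic_semigroup delta S /\
      extends_semigroup T S /\
      forall z : C, z <> RtoC 0 -> closed_sector (c / (K * M)) z ->
        Rbar_le (opnorm (S z)) (c' * (K * M) * (1 + ln (K * M))).
Proof.
  exists (/ 100), 1920; split; [lra|]; split; [lra|].
  intros X T M K HT HM HTM HK Hres.
  pose proof (orbit_norm_equivalent T M HT HTM) as HN.
  pose proof (orbit_norm_contraction T M HT HM HTM) as HS.
  set (N := orbit_norm T) in *.
  assert (Hsurj : forall s, s <> 0 -> surjective_resolvent N T (0, s)).
  { intros s Hs; apply (surjective_of_resolvent T M HT HM HTM).
    apply Hres, Rabs_pos_lt, Hs. }
  assert (Hlow : forall s x w, s <> 0 -> right_derivative N T x w ->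
    Rabs s * N x <= K * N ((0, s) ⊙ x ⊖ w)).
  { intros s x w Hs Hg; apply Rabs_pos_lt in Hs; destruct (Hres s Hs) as [H1 H2].
    assert (Hb : 0 <= K / Rabs s) by (apply Rdiv_le_0_compat; lra).
    pose proof (resolvent_bound_orbit_norm T M HT HM HTM _ _ x w H1 Hb H2 Hg) as H.
    fold N in H; apply (Rmult_le_compat_l (Rabs s)) in H; [|lra].
    replace (Rabs s * (K / Rabs s * N ((0, s) ⊙ x ⊖ w)))
      with (K * N ((0, s) ⊙ x ⊖ w)) in H by (field; lra); exact H. }
  set (S := holomorphic_extension N T).
  set (delta := 1 / (16 * (5 * K))).
  set (b := 1920 * K * M).
  assert (Hb : 0 <= b) by (unfold b; nra).
  assert (Hlin : forall z, cone (5 * K) z -> linear_map (S z))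
    by exact (linear_extension HN HS K HK Hsurj Hlow).
  assert (Hbound : forall z, cone (5 * K) z -> forall x, norm (S z x) <= b * norm x).
  { intros z Hz x; pose proof (bounded_extension HN HS K HK Hsurj Hlow z Hz x) as H.
    fold S in H; pose proof (en_lower _ _ HN (S z x)); pose proof (en_upper _ _ HN x).
    apply (Rmult_le_compat_l (1920 * K)) in H1; [|lra]; unfold b; lra. }
  assert (Hdelta : 0 < delta) by (apply Rdiv_lt_0_compat; lra).
  assert (Hsec : forall z, sector delta z -> cone (5 * K) z).
  { intros z [_ [theta [Harg Ht]]].
    apply (cone_of_arg (5 * K) z theta); [lra|easy|fold delta; lra]. }
  assert (Hcsec : forall d z, d < delta -> closed_sector d z -> cone (5 * K) z).
  { intros d z Hd [theta [Harg Ht]].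
    apply (cone_of_arg (5 * K) z theta); [lra|easy|fold delta; lra]. }
  assert (Hc0 : cone (5 * K) 0) by (apply cone_real; lra).
  assert (HKM : 1 <= K * M) by nra.
  assert (Hangle : / 100 / (K * M) < delta).
  { unfold delta; apply Rlt_div_l; [nra|].
    replace (1 / (16 * (5 * K)) * (K * M)) with (M / 80) by (field; lra); lra. }
  exists delta, S; split; [exact Hangle|]; split; [split|split].
  - split; [easy|]; pose proof PI2_1.
    assert (delta <= 1) by (unfold delta; apply Rle_div_l; lra); lra.
  - intros z Hz; assert (Hz' : cone (5 * K) z) by (destruct Hz as [Hz| ->]; auto).
    apply (is_linear_of_linear _ b); auto.
  - intros z1 z2 x H1 H2; apply (extension_plus HN HS K HK Hsurj Hlow); auto.
  - intros z Hz.
    destruct (cone_room (5 * K) z ltac:(lra) Hz) as [tau [r [Htau [Hr [Hzt Hroom]]]]].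
    destruct (extension_differentiable HN HS K HK Hsurj Hlow z tau Htau Hzt)
      as [L [D1 [D2 [HL [HLb [HD2 Hd]]]]]].
    exists L; split.
    { apply (is_linear_of_linear _ (Rabs D1 * M) HL); intros x.
      pose proof (HLb x); pose proof (en_lower _ _ HN (L x)); pose proof (en_upper _ _ HN x).
      pose proof (Rle_abs D1); pose proof (N_ge0 HN x); pose proof (Rabs_pos D1).
      apply (Rmult_le_compat_l (Rabs D1)) in H1; [|easy]; nra. }
    intros eps; pose proof (cond_pos eps) as Heps.
    assert (HDM : 0 <= D2 * M) by nra.
    set (q := Rmin r (eps / (D2 * M + 1)) / 2).
    assert (Hq : 0 < q).
    { apply Rdiv_lt_0_compat; [|lra]; apply Rmin_pos; [easy|]; apply Rdiv_lt_0_compat; lra. }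
    exists (mkposreal q Hq); intros h Hh Hh0; apply Cmod_ball_0 in Hh; simpl in Hh.
    replace (2 * q) with (Rmin r (eps / (D2 * M + 1))) in Hh by (unfold q; field).
    pose proof (Rmin_l r (eps / (D2 * M + 1))); pose proof (Rmin_r r (eps / (D2 * M + 1))).
    assert (Hhe : Cmod h * (D2 * M + 1) < eps) by (apply Rlt_div_r; lra).
    apply Cmod_gt_0 in Hh0 as Hhpos.
    apply Rbar_le_lt_trans with (Finite (D2 * M * Cmod h)); [|simpl; lra].
    apply opnorm_le; [nra|]; intros x.
    pose proof (Hd h x (Hroom h ltac:(lra))) as H1; fold S in H1.
    pose proof (@norm_equivalent X) as HN0.
    assert (E : (/ h)%C ⊙ (S (z + h)%C x ⊖ S z x) ⊖ L x
                = (/ h)%C ⊙ (S (z + h)%C x ⊖ S z x ⊖ h ⊙ L x)).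
    { vec_goals; field; easy. }
    change (norm ((/ h)%C ⊙ (S (z + h)%C x ⊖ S z x) ⊖ L x) <= D2 * M * Cmod h * norm x).
    rewrite E, (N_scal HN0), Cmod_inv by easy.
    pose proof (en_lower _ _ HN (S (z + h)%C x ⊖ S z x ⊖ h ⊙ L x)) as H2.
    pose proof (en_upper _ _ HN x) as H3.
    apply (Rmult_le_reg_l (Cmod h)); [easy|].
    rewrite <- Rmult_assoc, Rinv_r, Rmult_1_l by lra.
    apply (Rmult_le_compat_l (D2 * (Cmod h)²)) in H3.
    2:{ apply Rmult_le_pos; [easy|apply Rle_0_sqr]. }
    unfold Rsqr in *; lra.
  - intros d x Hd.
    apply (proj2 (filterlim_locally_ball_norm
      (U := CompleteNormedModule.NormedModule _ X)
      (F := within (closed_sector d) (locally (RtoC 0))) (fun z => S z x) x)).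
    intros eps; pose proof (cond_pos eps) as Heps.
    destruct (extension_continuous HN HS K HK Hsurj Hlow x (eps / 2) ltac:(lra))
      as [r [Hr H]].
    assert (Hr2 : 0 < r / 2) by lra.
    exists (mkposreal _ Hr2); intros z Hz Hzs; apply Cmod_ball_0 in Hz; simpl in Hz.
    specialize (H z (Hcsec d z (proj2 Hd) Hzs) ltac:(lra)); fold S in H.
    change (norm (S z x ⊖ x) < eps).
    pose proof (en_lower _ _ HN (S z x ⊖ x)); lra.
  - intros d Hd; exists b; intros z Hz; apply opnorm_le; [easy|].
    apply Hbound, (Hcsec d); [apply Hd|easy].
  - intros t x Ht; apply (extension_real HN HS K HK Hsurj Hlow t x Ht).
  - intros z _ Hz.
    assert (Hln : 0 <= ln (K * M)) by (rewrite <- ln_1; apply ln_le; lra).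
    apply Rbar_le_trans with (Finite b).
    + apply opnorm_le; [easy|]; apply Hbound, (Hcsec _ z Hangle Hz).
    + simpl; unfold b; nra.
Qed.
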